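(* Let $G$ be a matching covered bipartite graph with at least four vertices. Then the following three statements are equivalent: (i) $G$ is strongly uniform; (ii) $G$ has no conformal minor in $\mathcal{A}=\{A_1,A_2,A_3,A_4\}$; (iii) $G\in \mathcal{B}_0\cup\mathcal{B}_1\cup\mathcal{B}_2\cup\mathcal{B}_3$.
   Context: All graphs are finite, simple and undirected. A graph is matchable if it has a perfect matching (the graph with no vertices counts as matchable). A connected graph is matching covered if each of its edges belongs to a perfect matching. Forcing numbers. For a perfect matching $M$ of a graph $G$, an anti-forcing set of $M$ is a set $S\subseteq E(G)\setminus M$ such that $M$ is the only perfect matching of $G-S$; $af(G,M)$ is the smallest size of such a set, and $Af(G)$ is the maximum of $af(G,M)$ over all perfect matchings $M$ of $G$. A global forcing set of a matchable graph $G$ is a set $S\subseteq E(G)$ such that $S\cap M_1\neq S\cap M_2$ for any two distinct perfect matchings $M_1,M_2$ of $G$; $gf(G)$ is the smallest size of such a set. Conformality. A subgraph $H$ of a matchable graph $G$ is conformal if $G-V(H)$ is matchable. A matchable graph $G$ is strongly uniform if $gf(H)=Af(H)$ for every conformal matchable subgraph $H$ of $G$. A bisubdivision of a graph $J$ is a graph obtained from $J$ by replacing each edge in some edge subset by a path of odd length (length 1 allowed), these paths being internally disjoint. $J$ is a conformal minor of a matchable graph $G$ if some bisubdivision of $J$ is a conformal subgraph of $G$. The graphs $A_i$. $A_1$ consists of two vertices joined by three internally disjoint paths of length 3 (8 vertices, 9 edges). $A_2$ is the cycle $v_1v_2\cdots v_8v_1$ plus the chords $v_1v_4$ and $v_1v_6$.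 $A_3$ is the cycle $v_1v_2\cdots v_{10}v_1$ plus the chords $v_1v_4$ and $v_6v_9$. $A_4=K_{3,3}$. Chords. Let $C$ be an even cycle with a proper black-white coloring of its vertices. A chord of $C$ is an edge not in $C$ with both end vertices on $C$. Let $x_1x_2$ and $y_1y_2$ be two disjoint chords (each joining vertices of different colors), labelled so that $x_1$ and $y_1$ have the same color. They are parallel if their end vertices appear in the cyclic order $x_1,x_2,y_1,y_2$ along $C$ (in one of the two directions of traversal), and crossed if they appear in the cyclic order $x_1,y_1,x_2,y_2$ along $C$. Crossed chords $x_1x_2,y_1y_2$ are strongly crossed if $\{x_1y_2,x_2y_1\}\subseteq E(C)$. The families $\mathcal{B}_i$. $\mathcal{B}_0$ is the set of all even cycles; $\mathcal{B}_1$ is the set of bipartite graphs consisting of a Hamilton cycle and exactly one chord; $\mathcal{B}_2$ is the set of graphs consisting of an (even) Hamilton cycle and exactly two chords, which are strongly crossed; $\mathcal{B}_3$ is the set of bipartite graphs consisting of a Hamilton cycle with pairwise parallel chords. *)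

(* Defs.v *)
From HB Require Import structures.
From mathcomp Require Import all_boot.

Set Implicit Arguments.
Unset Strict Implicit.
Unset Printing Implicit Defensive.

(* A finite simple graph drawn inside an ambient finite type T; its vertex set
   may be a proper subset of T, so that the subgraphs of a graph have the same
   type as the graph itself. *)
Record graph (T : finType) := Graph {
  vset : {set T};
  eset : {set {set T}};
  graphP : [forall e in eset, (e \subset vset) && (#|e| == 2)]
}.

Lemma del_verts_subproof (T : finType) (G : graph T) (X : {set T}) :
  [forall e in [set e in eset G | [disjoint e & X]],
    (e \subset vset G :\: X) && (#|e| == 2)].
Proof.
apply/forall_inP => e; rewrite inE => /andP[eG eX].
have /andP[eV ->] := forall_inP (graphP G) e eG.
by rewrite subsetD eV eX.
Qed.

Lemma del_edges_subproof (T : finType) (G : graph T) (S : {set {set T}}) :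
  [forall e in eset G :\: S, (e \subset vset G) && (#|e| == 2)].
Proof.
apply/forall_inP => e; rewrite inE => /andP[_ eG].
exact: (forall_inP (graphP G) e eG).
Qed.

Definition del_verts (T : finType) (G : graph T) (X : {set T}) : graph T :=
  Graph (del_verts_subproof G X).

Definition del_edges (T : finType) (G : graph T) (S : {set {set T}}) : graph T :=
  Graph (del_edges_subproof G S).

Section Matchings.
Variable T : finType.
Implicit Types (G H : graph T) (M S : {set {set T}}).

Definition adj G : rel T := [rel x y | [set x; y] \in eset G].

Definition subgraph H G : bool :=
  (vset H \subset vset G) && (eset H \subset eset G).

Definition connected G : Prop :=
  forall x y, x \in vset G -> y \in vset G -> connect (adj G) x y.

Definition proper_coloring (B : {set T}) (F : {set {set T}}) : Prop :=
  forall x y, [set x; y] \in F -> (x \in B) != (y \in B).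

Definition bipartite G : Prop :=
  exists B : {set T}, proper_coloring B (eset G).

Definition perfect_matching G M : bool :=
  (M \subset eset G) && partition M (vset G).

Definition matchable G : Prop := exists M, perfect_matching G M.

Definition matching_covered G : Prop :=
  connected G /\
  forall e, e \in eset G -> exists2 M, perfect_matching G M & e \in M.

Definition anti_forcing G M S : bool :=
  (S \subset eset G :\: M) &&
  [forall M', perfect_matching (del_edges G S) M' == (M' == M)].

Definition global_forcing G S : bool :=
  (S \subset eset G) &&
  [forall M1, forall M2,
    [&& perfect_matching G M1, perfect_matching G M2 & M1 != M2] ==>
      (S :&: M1 != S :&: M2)].

(* The defaults of the two minima below do satisfy the constraint: see
   [anti_forcing_compl] and [global_forcing_eset]. *)
Definition af G M : nat :=
  #|[arg min_(S < eset G :\: M | anti_forcing G M S) #|S|]|.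

Definition Af G : nat := \max_(M | perfect_matching G M) af G M.

Definition gf G : nat :=
  #|[arg min_(S < eset G | global_forcing G S) #|S|]|.

Definition conformal H G : Prop :=
  subgraph H G /\ matchable (del_verts G (vset H)).

Definition strongly_uniform G : Prop :=
  matchable G /\
  forall H, conformal H G -> matchable H -> gf H = Af H.

Lemma anti_forcing_compl G M :
  perfect_matching G M -> anti_forcing G M (eset G :\: M).
Proof.
move=> /andP[MG pM]; rewrite /anti_forcing subxx /=.
have eqM : eset G :\: (eset G :\: M) = M.
  by rewrite setDDr setDv set0U; apply/setIidPr.
apply/forallP => M'; apply/eqP; rewrite /perfect_matching /= eqM.
apply/andP/eqP => [[sM' pM']|->]; last by rewrite subxx.
apply/eqP; rewrite eqEsubset sM' /=; apply/subsetP => e eM.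
have /and3P[/eqP cM tM nM] := pM; have /and3P[/eqP cM' _ _] := pM'.
have /set0Pn[x xe] : e != set0 by apply: contraNneq nM => <-.
have : x \in cover M' by rewrite cM' -cM; apply/bigcupP; exists e.
case/bigcupP => e' e'M' xe'; have e'M := subsetP sM' _ e'M'.
by rewrite -(def_pblock tM eM xe) (def_pblock tM e'M xe').
Qed.

Lemma global_forcing_eset G : global_forcing G (eset G).
Proof.
rewrite /global_forcing subxx; apply/forallP => M1; apply/forallP => M2.
apply/implyP => /and3P[/andP[s1 _] /andP[s2 _]].
by rewrite (setIidPr s1) (setIidPr s2).
Qed.

End Matchings.

Definition path_edges (T : finType) (s : seq T) : {set {set T}} :=
  [set [set z.1; z.2] | z in zip s (behead s)].

(* H is, up to isomorphism, a bisubdivision of J: f sends the vertices of J to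
   the branch vertices of H, and p x y lists in order the internal vertices of
   the path of H that replaces the edge xy of J.  The path has length
   (size (p x y)).+1, which is odd; p x y = [::] means that xy is kept. *)
Definition bisubdivision (T U : finType) (J : graph T) (H : graph U) : Prop :=
  exists (f : T -> U) (p : T -> T -> seq U),
  [/\ {in vset J &, injective f},
      forall x y, adj J x y ->
        [/\ p y x = rev (p x y), ~~ odd (size (p x y)), uniq (p x y)
          & forall z, z \in p x y -> z \notin f @: vset J],
      forall x y x' y', adj J x y -> adj J x' y' ->
        [set x; y] != [set x'; y'] -> [disjoint p x y & p x' y'],
      vset H = (f @: vset J)
        :|: \bigcup_(x : T) \bigcup_(y : T | adj J x y) [set z in p x y]
    & eset H = \bigcup_(x : T) \bigcup_(y : T | adj J x y)
                 path_edges (f x :: rcons (p x y) (f y))].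

Definition conformal_minor (T U : finType) (J : graph T) (G : graph U) : Prop :=
  exists2 H : graph U, bisubdivision J H & conformal H G.

Lemma mk_graph_subproof n (s : seq (nat * nat)) :
  [forall e in [set [set x; y] | x in 'I_n, y in 'I_n
                  & (x != y) && ((val x, val y) \in s)],
     (e \subset [set: 'I_n]) && (#|e| == 2)].
Proof.
apply/forall_inP => e /imset2P[x y _]; rewrite inE => /andP[_ /andP[xy _]] ->.
by rewrite subsetT cards2 xy.
Qed.

Definition mk_graph n (s : seq (nat * nat)) : graph 'I_n :=
  Graph (mk_graph_subproof n s).

Definition cycle_pairs (n : nat) : seq (nat * nat) :=
  [seq (i, i.+1 %% n) | i <- iota 0 n].

(* The end vertices are 0 and 1. *)
Definition A1 : graph 'I_8 := mk_graph 8
  [:: (0, 2); (2, 3); (3, 1); (0, 4); (4, 5); (5, 1); (0, 6); (6, 7); (7, 1)].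

(* In A2 and A3 the vertex v_i is i - 1. *)
Definition A2 : graph 'I_8 :=
  mk_graph 8 (cycle_pairs 8 ++ [:: (0, 3); (0, 5)]).

Definition A3 : graph 'I_10 :=
  mk_graph 10 (cycle_pairs 10 ++ [:: (0, 3); (5, 8)]).

Definition A4 : graph 'I_6 :=
  mk_graph 6 [seq (i, j) | i <- [:: 0; 1; 2], j <- [:: 3; 4; 5]].

Section Chords.
Variable T : finType.
Implicit Types (G : graph T) (c s : seq T) (e f B : {set T}).

Definition hamilton_cycle G c : bool :=
  [&& 2 < size c, uniq c, [set x in c] == vset G & cycle (adj G) c].

Definition cycle_edges c : {set {set T}} := [set [set x; next c x] | x in c].

(* For a Hamilton cycle c, every edge of G outside c has both ends on c. *)
Definition chords G c : {set {set T}} := eset G :\: cycle_edges c.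

Definition cyclic_order c s : Prop :=
  exists i, subseq s (rot i c) \/ subseq s (rot i (rev c)).

Definition labelled_chords c e f (x1 x2 y1 y2 : T) : Prop :=
  [/\ e = [set x1; x2], f = [set y1; y2], [disjoint e & f]
    & exists2 B, proper_coloring B (cycle_edges c) &
        [/\ (x1 \in B) != (x2 \in B), (y1 \in B) != (y2 \in B)
          & (x1 \in B) = (y1 \in B)]].

Definition parallel c e f : Prop :=
  exists x1 x2 y1 y2, labelled_chords c e f x1 x2 y1 y2 /\
    cyclic_order c [:: x1; x2; y1; y2].

Definition strongly_crossed c e f : Prop :=
  exists x1 x2 y1 y2,
    [/\ labelled_chords c e f x1 x2 y1 y2,
        cyclic_order c [:: x1; y1; x2; y2],
        [set x1; y2] \in cycle_edges c & [set x2; y1] \in cycle_edges c].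

Definition B0 G : Prop :=
  exists2 c, hamilton_cycle G c & ~~ odd (size c) /\ chords G c = set0.

Definition B1 G : Prop :=
  bipartite G /\ exists2 c, hamilton_cycle G c & #|chords G c| = 1.

Definition B2 G : Prop :=
  exists2 c, hamilton_cycle G c & ~~ odd (size c) /\
    exists e f, [/\ e != f, chords G c = [set e; f] & strongly_crossed c e f].

Definition B3 G : Prop :=
  bipartite G /\ exists2 c, hamilton_cycle G c &
    forall e f, e \in chords G c -> f \in chords G c -> e != f ->
      parallel c e f.

End Chords.

(* Main.v *)
(** (i) implies (ii).  In a bisubdivision of J, a perfect matching is determined
    by the perfect matching of J it induces, and every edge of J keeps an edge
    in its path that is matched exactly when it is.  So gf can only grow and Af
    can only drop under bisubdivision, and for the four graphs A_i a finite
    check gives Af < gf.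

    (ii) implies (iii).  Let C be a longest cycle that is closed under some fixed
    perfect matching M.  If C were not Hamiltonian, an M-alternating ear would
    either lengthen it or form with it an A_1.  So G is a Hamilton cycle with
    chords.  Two chords with a common end give A_2, two noncrossing chords that
    are not parallel give A_3, two crossed chords that are not strongly crossed
    give A_1, and a third chord beside two strongly crossed ones forces K_{3,3}.

    (iii) implies (i).  If H is a conformal subgraph of G and N a perfect
    matching of G - V(H), then M |-> M u N identifies the perfect matchings of H
    with those of G inside a fixed edge set F.  With pairwise parallel chords,
    these are one matching M_A for each set A of chords and one more matching;
    those M_A inside F have A ranging over an interval of sets, and both numbers
    are the dimension of that interval, plus 1 if the extra matching lies
    inside F.  With two strongly crossed chords there are four matchings,
    arranged as a square, and one inspects its subsets. *)

Require Import Defs.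
From mathcomp Require Import all_boot zify.

Set Implicit Arguments.
Unset Strict Implicit.
Unset Printing Implicit Defensive.

(** * Matchings, paths and forcing numbers *)

(** A conformal subgraph need be neither connected nor matching covered, so the four classes do not
    pass to it and strong uniformity cannot be proved by staying inside a class. The equality of the
    two numbers is therefore proved for families of matchings: [separates] and [blocks] mention no
    graph, and for a given G all the families [pms_in G F] are treated at once. The common value is
    pinned by four bounds. The upper bounds come from explicit sets. The lower bound for separating
    sets is a count: a set S tells at most 2^|S| matchings apart. The lower bound for blocking sets
    is a packing: if the differences of some members with M are pairwise disjoint, a set that blocks
    M needs an element in each of them. The geometry of the chords becomes arithmetic: vertices of
    the Hamilton cycle are replaced by their positions, colours by parities, and cyclic orders by
    inequalities that [lia] decides. *)

Lemma seq2_rect (T : Type) (P : seq T -> Type) :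
  P [::] -> (forall x, P [:: x]) -> (forall x y s, P s -> P [:: x, y & s]) ->
  forall s, P s.
Proof.
move=> P0 P1 P2 s; suff [] : P s * (forall x, P (x :: s)) by [].
by elim: s => [|y s [IH1 IH2]]; split=> // x; apply: P2.
Qed.

Lemma count_eq1 (T : eqType) (a : pred T) (s : seq T) (x : T) :
  uniq s -> x \in s -> a x -> {in s, forall y, a y -> y = x} -> count a s = 1.
Proof.
move=> us xs ax ux; rewrite (@eq_in_count _ _ (pred1 x)) => [|y ys /=].
  by rewrite count_uniq_mem // xs.
by apply/idP/eqP => [/(ux y ys)|->].
Qed.

Section Sets.
Variable T : finType.
Implicit Types (G H : graph T) (M S : {set {set T}}) (e : {set T}) (s c : seq T) (x y v : T).

Lemma eq_set2 (x y x' y' : T) :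
  [set x; y] = [set x'; y'] -> (x = x' /\ y = y') \/ (x = y' /\ y = x').
Proof.
move=> E.
have := set21 x y; have := set22 x y; rewrite {1 2}E !inE.
have := set21 x' y'; have := set22 x' y'; rewrite -{1 2}E !inE.
by do 4 (case/orP => /eqP ?); subst; auto.
Qed.

Lemma eset2P G e : e \in eset G ->
  exists x y, [/\ x != y, e = [set x; y], x \in vset G & y \in vset G].
Proof.
move=> /(forall_inP (graphP G))/andP[sV /cards2P[x [y [xy E]]]].
by exists x, y; split=> //; apply: (subsetP sV); rewrite E !inE eqxx ?orbT.
Qed.

Lemma eset_vset G e v : e \in eset G -> v \in e -> v \in vset G.
Proof.
by move=> /(forall_inP (graphP G))/andP[/subsetP sV _]; apply: sV.
Qed.

Lemma adj_sym G : symmetric (adj G).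
Proof. by move=> x y; rewrite /adj /= setUC. Qed.

Lemma adj_irr G x : adj G x x = false.
Proof.
apply/negP => /(forall_inP (graphP G))/andP[_].
by rewrite cards2 eqxx.
Qed.

Lemma adj_vset G x y : adj G x y -> x \in vset G.
Proof. by move=> /eset_vset; apply; rewrite !inE eqxx. Qed.

Lemma pmP G M : reflect
  [/\ M \subset eset G,
      forall v, v \in vset G -> exists2 e, e \in M & v \in e
    & forall e e' v, e \in M -> e' \in M -> v \in e -> v \in e' -> e = e']
  (perfect_matching G M).
Proof.
apply: (iffP andP) => [[ME /and3P[/eqP cM /trivIsetP tM _]]|[ME cM uM]].
  split=> // [v|e e' v eM e'M ve ve'].
    by rewrite -cM => /bigcupP[e eM ve]; exists e.
  apply/eqP; apply: contraT => /(tM _ _ eM e'M).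
  by move/pred0P/(_ v); rewrite /= ve ve'.
split=> //; apply/and3P; split.
- apply/eqP/setP => v; apply/bigcupP/idP => [[e eM ve]|/cM[e eM ve]].
    exact: eset_vset (subsetP ME _ eM) ve.
  by exists e.
- apply/trivIsetP => e e' eM e'M; apply: contraR => /pred0Pn[v /andP[/= ve ve']].
  by apply/eqP; apply: uM ve'.
- apply/negP => /(subsetP ME)/(forall_inP (graphP G))/andP[_].
  by rewrite cards0.
Qed.

(** Explicit matchings are given as vertex lists in which successive entries are matched two by two;
    covering and disjointness then reduce to a list of even size without repetition. *)
Fixpoint pairs s : {set {set T}} :=
  if s is x :: y :: s' then [set x; y] |: pairs s' else set0.

Lemma pairsP x0 s e : reflect
  (exists i, [/\ ~~ odd i, i.+1 < size s & e = [set nth x0 s i; nth x0 s i.+1]])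
  (e \in pairs s).
Proof.
elim/seq2_rect: s e => [|x|x y s IH] e /=; try by rewrite inE; right=> -[[|i] []].
rewrite in_setU1; apply: (iffP orP) => [[/eqP->|/IH[i [i1 i2 ->]]]|[i [i1 i2 ->]]].
- by exists 0.
- by exists i.+2; rewrite /= negbK.
- case: i i1 i2 => [|[|i]] //= i1 i2; [by left | right; apply/IH].
  by exists i; rewrite negbK in i1.
Qed.

Lemma pairs_cat s1 s2 : ~~ odd (size s1) -> pairs (s1 ++ s2) = pairs s1 :|: pairs s2.
Proof.
elim/seq2_rect: s1 => [|x|x y s IH] //=; first by rewrite set0U.
by rewrite negbK => /IH ->; rewrite setUA.
Qed.

Lemma pairs_cover s v : ~~ odd (size s) -> v \in s -> exists2 e, e \in pairs s & v \in e.
Proof.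
elim/seq2_rect: s => [|x|x y s IH] //=.
rewrite negbK !inE => os; rewrite orbA => /orP[vxy|/(IH os)[e es ve]].
  by exists [set x; y]; rewrite ?setU11 // !inE.
by exists e; rewrite // inE es orbT.
Qed.

Lemma pairs_mem s e v : e \in pairs s -> v \in e -> v \in s.
Proof.
elim/seq2_rect: s => [|x|x y s IH] //=; try by rewrite inE.
rewrite in_setU1 => /orP[/eqP->|es ve].
  by rewrite !inE => /orP[]->; rewrite ?orbT.
by rewrite !inE (IH es ve) !orbT.
Qed.

Lemma pairs_inj s e e' v :
  uniq s -> e \in pairs s -> e' \in pairs s -> v \in e -> v \in e' -> e = e'.
Proof.
elim/seq2_rect: s => [|x|x y s IH] //=; try by rewrite inE.
rewrite inE negb_or => /and3P[/andP[_ xs] ys us].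
have X f : f \in pairs s -> v \in f -> v \in [set x; y] -> False.
  by move=> fs /(pairs_mem fs) vs /set2P[] E; move: vs; rewrite E ?(negPf xs) ?(negPf ys).
rewrite !in_setU1 => /orP[/eqP->|es] /orP[/eqP->|es'] // ve ve'.
- by case: (X _ es' ve' ve).
- by case: (X _ es ve ve').
- exact: IH us es es' ve ve'.
Qed.

Lemma pairs_pm G s : ~~ odd (size s) -> uniq s -> pairs s \subset eset G ->
  vset G = [set x in s] -> perfect_matching G (pairs s).
Proof.
move=> os us sE V; apply/pmP; split=> // [v|e e' v]; last exact: pairs_inj.
by rewrite V inE; apply: pairs_cover.
Qed.

Lemma path_edges_cons x y s :
  path_edges [:: x, y & s] = [set x; y] |: path_edges (y :: s).
Proof.
apply/setP => e; rewrite in_setU1; apply/imsetP/orP => [[z]|[/eqP->|/imsetP[z zs ->]]].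
- rewrite /= inE => /orP[/eqP-> ->|zs ->]; first by left.
  by right; apply/imsetP; exists z.
- by exists (x, y); rewrite //= inE eqxx.
- by exists z; rewrite //= inE zs orbT.
Qed.

Lemma path_edges0 : path_edges ([::] : seq T) = set0.
Proof. by apply/setP => e; rewrite inE; apply/imsetP => -[]. Qed.

Lemma path_edges1 x : path_edges [:: x] = set0.
Proof. by apply/setP => e; rewrite inE; apply/imsetP => -[]. Qed.

Lemma path_edges_cat s1 a s2 :
  path_edges (s1 ++ a :: s2) = path_edges (rcons s1 a) :|: path_edges (a :: s2).
Proof.
elim: s1 => [|x [|y s1] IH] /=; first by rewrite path_edges1 set0U.
  by rewrite !path_edges_cons path_edges1 setU0.
by rewrite !path_edges_cons -!cat_cons IH setUA.
Qed.

Lemma path_edges_rcons s a b :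
  path_edges (rcons (rcons s a) b) = path_edges (rcons s a) :|: [set [set a; b]].
Proof. by rewrite -cats1 cat_rcons path_edges_cat path_edges_cons path_edges1 setU0. Qed.

Lemma path_edges_rev s : path_edges (rev s) = path_edges s.
Proof.
elim: s => [|x [|y s] IH] //=.
by rewrite 2!rev_cons path_edges_rcons -rev_cons IH path_edges_cons setUC [[set y; x]]setUC.
Qed.

Lemma path_edgesP x0 s e : reflect
  (exists2 i, i.+1 < size s & e = [set nth x0 s i; nth x0 s i.+1])
  (e \in path_edges s).
Proof.
elim: s e => [|x [|y s] IH] e; rewrite ?path_edges0 ?path_edges1 ?inE.
- by right=> -[].
- by right=> -[].
rewrite path_edges_cons in_setU1; apply: (iffP orP) => [[/eqP->|/IH[i i1 ->]]|[[|i] i1 ->]].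
- by exists 0.
- by exists i.+1.
- by left.
- by right; apply/IH; exists i.
Qed.

Lemma path_edges_mem s e v : e \in path_edges s -> v \in e -> v \in s.
Proof.
case: s => [|x0 s]; first by rewrite path_edges0 inE.
by move=> /(path_edgesP x0)[i i1 ->] /set2P[]->; apply: mem_nth => //; apply: ltnW.
Qed.

Lemma path_edges_path G x s : path_edges (x :: s) \subset eset G = path (adj G) x s.
Proof.
elim: s x => [|y s IH] x /=; first by rewrite path_edges1 sub0set.
by rewrite path_edges_cons subUset IH sub1set.
Qed.

Lemma pairs_path_edges s : pairs s \subset path_edges s.
Proof.
case: s => [|x0 s]; first by rewrite sub0set.
apply/subsetP => e /(pairsP x0)[i [_ i1 ->]]; apply/(path_edgesP x0); by exists i.
Qed.

Lemma cycle_edgesP x0 c e : uniq c -> reflect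
  (exists2 i, i < size c & e = [set nth x0 c i; nth x0 c (i.+1 %% size c)])
  (e \in cycle_edges c).
Proof.
move=> uc; have N i : i < size c -> next c (nth x0 c i) = nth x0 c (i.+1 %% size c).
  case: c uc => // y c uc ic; rewrite next_nth mem_nth // index_uniq //.
  move: ic; rewrite /= ltnS leq_eqVlt => /orP[/eqP->|ic].
    by rewrite modnn nth_default.
  by rewrite modn_small ?ltnS //=; apply: set_nth_default.
apply: (iffP imsetP) => [[x xc ->]|[i ic ->]].
  by exists (index x c); rewrite ?index_mem // -N ?index_mem // nth_index.
by exists (nth x0 c i); rewrite ?N // mem_nth.
Qed.

Lemma cycle_edges_rot i c : uniq c -> cycle_edges (rot i c) = cycle_edges c.
Proof.
move=> uc; apply/setP => e; apply/imsetP/imsetP => -[x xc ->]; exists x; rewrite ?next_rot //.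
  by rewrite mem_rot in xc.
by rewrite mem_rot.
Qed.

Lemma cycle_edges_rev c : uniq c -> cycle_edges (rev c) = cycle_edges c.
Proof.
move=> uc; apply/setP => e; apply/imsetP/imsetP => -[x xc ->].
  exists (prev c x); first by rewrite mem_prev -mem_rev.
  by rewrite next_rev // next_prev // setUC.
by exists (next c x); rewrite ?mem_rev ?mem_next // next_rev // prev_next // setUC.
Qed.

Lemma cycle_edges_adj G c : uniq c -> cycle (adj G) c -> cycle_edges c \subset eset G.
Proof.
by move=> uc cG; apply/subsetP => e /imsetP[x xc ->]; have := next_cycle cG xc.
Qed.

Lemma hamilton_rot G i c : hamilton_cycle G (rot i c) = hamilton_cycle G c.
Proof.
rewrite /hamilton_cycle size_rot rot_uniq rot_cycle.
by rewrite (_ : [set x in rot i c] = [set x in c]) //; apply/setP=> x; rewrite !inE mem_rot.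
Qed.

Lemma hamilton_rev G c : hamilton_cycle G (rev c) = hamilton_cycle G c.
Proof.
rewrite /hamilton_cycle size_rev rev_uniq rev_cycle.
rewrite (_ : [set x in rev c] = [set x in c]); last by apply/setP=> x; rewrite !inE mem_rev.
by congr [&& _, _, _ & _]; apply: eq_cycle => x y; apply: adj_sym.
Qed.

(* Only intersections with matchings matter, so a separating or blocking set
   may contain sets that are not edges. *)
Definition pms G : {set {set {set T}}} := [set M | perfect_matching G M].

Definition separates (P : {set {set {set T}}}) S :=
  {in P &, injective (fun M => S :&: M)}.

Definition blocks (P : {set {set {set T}}}) M S :=
  [disjoint S & M] /\ {in P, forall M', M' != M -> ~~ [disjoint S & M']}.

Lemma separatesP G S : S \subset eset G -> reflect (separates (pms G) S) (global_forcing G S).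
Proof.
move=> SE; apply: (iffP andP) => [[_ /forallP FS] M1 M2|sepS].
  rewrite !inE => P1 P2 E; apply/eqP/negPn/negP => D.
  by have /forallP/(_ M2) := FS M1; rewrite P1 P2 D E eqxx.
split=> //; apply/forallP => M1; apply/forallP => M2; apply/implyP => /and3P[P1 P2].
by apply: contra => /eqP E; apply/eqP/sepS; rewrite ?inE.
Qed.

Lemma gf_witness G : exists2 S, separates (pms G) S & #|S| = gf G.
Proof.
rewrite /gf; case: arg_minnP => [|S FS _]; first exact: global_forcing_eset.
exists S => //; apply/separatesP => //; by case/andP: FS.
Qed.

Lemma gf_leq G S : separates (pms G) S -> gf G <= #|S|.
Proof.
move=> sepS; pose S' := S :&: eset G.
have /separatesP : separates (pms G) S'.
  move=> M1 M2 P1 P2 E; apply: sepS => //; move: E; rewrite /S' -!setIA.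
  move: P1 P2; rewrite !inE => /andP[s1 _] /andP[s2 _].
  by rewrite (setIidPr s1) (setIidPr s2).
rewrite subsetIr => /(_ isT) FS; apply: leq_trans (subset_leq_card (subsetIl S (eset G))).
rewrite /gf; case: arg_minnP => [|S0 _]; first exact: global_forcing_eset.
by apply.
Qed.

Lemma pm_del_edges G S M :
  perfect_matching (del_edges G S) M = perfect_matching G M && [disjoint S & M].
Proof. by rewrite /perfect_matching /= subsetD disjoint_sym andbAC. Qed.

Lemma blocksP G M S : M \in pms G -> S \subset eset G ->
  reflect (blocks (pms G) M S) (anti_forcing G M S).
Proof.
rewrite inE => PM SE; apply: (iffP andP) => [[sS /forallP FS]|[dS FS]].
  have dS : [disjoint S & M] by move: sS; rewrite subsetD => /andP[].
  split=> // M'; rewrite inE => PM' D; have := FS M'.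
  by rewrite pm_del_edges PM' (negPf D) /=; case: disjoint.
split; first by rewrite subsetD SE.
apply/forallP => M'; rewrite pm_del_edges; apply/eqP.
case: eqVneq => [->|D]; first by rewrite PM.
case PM': perfect_matching => //=; apply: negbTE; apply: FS => //; by rewrite inE.
Qed.

Lemma af_witness G M : M \in pms G -> exists2 S, blocks (pms G) M S & #|S| = af G M.
Proof.
move=> PM; rewrite /af; case: arg_minnP => [|S FS _].
  by apply: anti_forcing_compl; move: PM; rewrite inE.
exists S => //; apply/blocksP => //; by case/andP: FS; rewrite subsetD => /andP[].
Qed.

Lemma af_leq G M S : M \in pms G -> blocks (pms G) M S -> af G M <= #|S|.
Proof.
move=> PM [dS FS]; pose S' := S :&: eset G.
have /blocksP : blocks (pms G) M S'.
  split; first exact: disjointWl (subsetIl _ _) dS.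
  move=> M' PM' /(FS M' PM'); apply: contra; rewrite -!setI_eq0 /S' -setIA.
  by move: PM'; rewrite inE => /andP[s _]; rewrite (setIidPr s).
rewrite subsetIr => /(_ PM isT) AS.
apply: leq_trans (subset_leq_card (subsetIl S (eset G))).
rewrite /af; case: arg_minnP => [|S0 _]; last by apply.
by apply: anti_forcing_compl; move: PM; rewrite inE.
Qed.

Lemma Af_leq G k :
  (forall M, M \in pms G -> exists2 S, blocks (pms G) M S & #|S| <= k) -> Af G <= k.
Proof.
move=> bS; apply/bigmax_leqP => M PM; have PM' : M \in pms G by rewrite inE.
by have [S bM] := bS M PM'; apply: leq_trans; apply: af_leq.
Qed.

Lemma leq_Af G M k : M \in pms G ->
  (forall S, blocks (pms G) M S -> k <= #|S|) -> k <= Af G.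
Proof.
move=> PM bS; have [S /bS kS E] := af_witness PM.
rewrite E in kS; apply: leq_trans kS _; rewrite inE in PM.
exact: (leq_bigmax_cond (F := af G) M PM).
Qed.

End Sets.

(** * Bisubdivisions and their perfect matchings *)

Lemma flatten_uniqP (T U : eqType) (q : T -> seq U) (s : seq T) : uniq s ->
  reflect ({in s, forall e, uniq (q e)} /\
           {in s &, forall e e' z, z \in q e -> z \in q e' -> e = e'})
    (uniq (flatten [seq q e | e <- s])).
Proof.
elim: s => [|e s IH] /=; first by left.
case/andP => es us; rewrite cat_uniq; apply: (iffP and3P) => [[ue /hasPn de /IH]|].
  case=> // u1 u2; split=> [e' /predU1P[->|/u1]|e1 e2] //.
  have X e' z : e' \in s -> z \in q e -> z \in q e' -> False.
    move=> e's ze ze'; have /de/negP : z \in flatten [seq q i | i <- s].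
      by apply/flattenP; exists (q e') => //; apply: map_f.
    by apply.
  move=> /predU1P[->|e1s] /predU1P[->|e2s] z z1 z2 //.
  - by case: (X _ _ e2s z1 z2).
  - by case: (X _ _ e1s z2 z1).
  - exact: (u2 e1 e2 e1s e2s z).
case=> u1 u2; split; first by apply: u1; rewrite mem_head.
  apply/hasPn => z /flattenP[_ /mapP[e' e's ->] ze']; apply/negP => /= ze.
  by move: es; rewrite (u2 e e' _ _ z) ?mem_head ?e's ?in_cons ?e's ?orbT.
apply/IH => //; split=> [e' e's|e1 e2 e1s e2s]; first by apply: u1; rewrite in_cons e's orbT.
by apply: u2; rewrite in_cons ?e1s ?e2s orbT.
Qed.

Lemma pairs_flatten (T : eqType) (U : finType) (F : T -> seq U) (s : seq T) (g : {set U}) :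
  {in s, forall e, ~~ odd (size (F e))} ->
  reflect (exists2 e, e \in s & g \in pairs (F e)) (g \in pairs (flatten [seq F e | e <- s])).
Proof.
elim: s => [|e s IH] ev /=; first by rewrite inE; right=> -[].
rewrite pairs_cat ?ev ?mem_head // inE.
apply: (iffP orP) => [[ge|/IH[|e' e's ge']]|[e' /predU1P[->|e's] ge']].
- by exists e; rewrite ?mem_head.
- by move=> e' e's; apply: ev; rewrite in_cons e's orbT.
- by exists e'; rewrite // in_cons e's orbT.
- by left.
- right; apply/IH; last by exists e'.
  by move=> e2 e2s; apply: ev; rewrite in_cons e2s orbT.
Qed.

Section Subdivision.
Variables (T : finType) (n : nat) (s : seq (nat * nat)).

(** Each edge is listed in one orientation only, because a list stores the interior of a path once,
    whereas [bisubdivision] gives it for both orders of the ends. *)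
Definition simple_pairs : bool :=
  uniq s && all (fun e => [&& e.1 < n, e.2 < n, e.1 != e.2 & (e.2, e.1) \notin s]) s.

Definition track (h : nat -> T) (q : nat * nat -> seq T) (e : nat * nat) : seq T :=
  h e.1 :: rcons (q e) (h e.2).

(** Kept as a list: its [uniq] says at once that branch vertices are distinct, that no path repeats
    a vertex, and that interiors avoid one another and the branch vertices. *)
Definition track_verts (h : nat -> T) (q : nat * nat -> seq T) : seq T :=
  [seq h i | i <- iota 0 n] ++ flatten [seq q e | e <- s].

(* A bisubdivision of [mk_graph n s] given by lists: [h i] is the branch vertex
   of i and [q e] the interior of the path that replaces the pair e. *)
Definition subdivides h q (H : graph T) : Prop :=
  [/\ uniq (track_verts h q), all (fun e => ~~ odd (size (q e))) s,
      vset H = [set x in track_verts h q]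
    & eset H = [set g | has (fun e => g \in path_edges (track h q e)) s]].

Hypothesis s_simple : simple_pairs.

Lemma simple_ends e : e \in s -> [/\ e.1 < n, e.2 < n, e.1 != e.2 & (e.2, e.1) \notin s].
Proof. by case/andP: s_simple => _ /allP/[apply] /and4P. Qed.

Lemma adj_mk_graph (x y : 'I_n) :
  adj (mk_graph n s) x y = ((val x, val y) \in s) || ((val y, val x) \in s).
Proof.
apply/imset2P/orP => [[x' y' _]|[xys|yxs]].
- rewrite inE => /andP[_ /andP[_ xys]] /eq_set2[][-> ->]; by [left|right].
- by exists x y => //; rewrite !inE xys -val_eqE /=; case: (simple_ends xys) => _ _ ->.
- by exists y x; rewrite ?inE ?yxs -?val_eqE //=; [case: (simple_ends yxs) => _ _ ->|rewrite setUC].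
Qed.

Lemma track_vertsP h q : uniq (track_verts h q) ->
  [/\ forall i j, i < n -> j < n -> h i = h j -> i = j,
      forall e z i, e \in s -> z \in q e -> i < n -> z != h i,
      {in s, forall e, uniq (q e)}
    & {in s &, forall e e' z, z \in q e -> z \in q e' -> e = e'}].
Proof.
rewrite cat_uniq => /and3P[uh /hasPn d /(flatten_uniqP _ (andP s_simple).1)[u1 u2]].
split=> // [i j ni nj E|e z i es ze ni].
  move/(uniqP (h 0)): uh => /(_ i j); rewrite !inE !size_map !size_iota ni nj => /(_ isT isT).
  by rewrite !(nth_map 0) ?size_iota // !nth_iota //; apply.
have /d : z \in flatten [seq q e | e <- s].
  by apply/flattenP; exists (q e) => //; apply: map_f.
by apply: contra => /eqP ->; apply: map_f; rewrite mem_iota.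
Qed.

Lemma subdivides_bisubdivision h q H :
  subdivides h q H -> bisubdivision (mk_graph n s) H.
Proof.
case=> uV ev vH eH; have [injh qh uq dq] := track_vertsP uV.
(* A pair that is listed in the opposite order has its path read backwards. *)
pose p (x y : 'I_n) := let e := (val x, val y) in let e' := (val y, val x) in
  if e \in s then q e else if e' \in s then rev (q e') else [::].
have pC x y : p y x = rev (p x y).
  rewrite /p; case: ifP => [yxs|_]; last by case: ifP => //; rewrite revK.
  case: ifP => [xys|_]; last by rewrite revK.
  by have [_ _ _] := simple_ends xys; rewrite yxs.
have pE x y : adj (mk_graph n s) x y -> exists2 e, e \in s &
    (e = (val x, val y) /\ p x y = q e) \/ (e = (val y, val x) /\ p x y = rev (q e)).
  rewrite adj_mk_graph /p; case: ifP => [xys _|_ /= yxs].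
    by exists (val x, val y) => //; left.
  by exists (val y, val x) => //; right; rewrite yxs.
have hK (i : nat) (ni : i < n) : h i = h (Ordinal ni) by [].
exists (fun i => h (val i)), p; split.
- by move=> x y _ _ E; apply: val_inj; exact: injh (ltn_ord x) (ltn_ord y) E.
- move=> x y xy; have [e es [[_ E]|[_ E]]] := pE x y xy; rewrite pC E ?size_rev ?rev_uniq;
    (split; [by []|exact: (allP ev)|exact: uq|]) => z; rewrite ?mem_rev => ze;
    apply/imsetP => -[i _ Ez]; by have := qh e z _ es ze (ltn_ord i); rewrite Ez eqxx.
- move=> x y x' y' xy xy' D; apply/pred0P => z /=; apply/negP => /andP[z1 z2].
  have [e es Ee] := pE x y xy; have [e' es' Ee'] := pE x' y' xy'.
  have Eee : e = e'.
    by apply: (dq e e' es es' z); [case: Ee => [][_ E]|case: Ee' => [][_ E]];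
       move: z1 z2; rewrite E ?mem_rev.
  rewrite -Eee in Ee'; case/negP: D; apply/eqP.
  by case: Ee => -[E1 _]; case: Ee' => -[E2 _]; move: E2; rewrite E1 => -[]
    /ord_inj-> /ord_inj->; rewrite // setUC.
- rewrite vH; apply/setP => v; rewrite inE mem_cat; apply/orP/setUP => -[].
  + move=> /mapP[i]; rewrite mem_iota => /andP[_ ni] ->; left.
    by apply/imsetP; exists (Ordinal ni); rewrite ?inE.
  + move=> /flattenP[_ /mapP[[i j] es ->] ve]; right; have [/= ni nj _ _] := simple_ends es.
    apply/bigcupP; exists (Ordinal ni) => //; apply/bigcupP; exists (Ordinal nj).
      by rewrite adj_mk_graph es.
    by rewrite inE /p /= es.
  + by move=> /imsetP[i _ ->]; left; apply/map_f; rewrite mem_iota; apply: ltn_ord.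
  + move=> /bigcupP[x _ /bigcupP[y xy]]; rewrite inE => vp; right.
    have [e es Ee] := pE x y xy; apply/flattenP; exists (q e); first exact: map_f.
    by case: Ee vp => -[_ ->]; rewrite ?mem_rev.
- rewrite eH; apply/setP => g; rewrite inE; apply/hasP/bigcupP => [[[i j] es ge]|[x _]].
    have [/= ni nj _ _] := simple_ends es; exists (Ordinal ni) => //.
    apply/bigcupP; exists (Ordinal nj); first by rewrite adj_mk_graph es.
    by rewrite /p /= es.
  move=> /bigcupP[y /pE[e es Ee] ge]; exists e => //; rewrite /track.
  case: Ee ge => -[-> ->] //=; rewrite -path_edges_rev.
  by rewrite rev_cons rev_rcons revK rcons_cons.
Qed.

End Subdivision.

(** The successor in [n.+1] makes [inord] available, which turns the numbers in [s] into
    vertices. *)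
Lemma bisubdivision_subdivides (T : finType) n s (H : graph T) : simple_pairs n.+1 s ->
  bisubdivision (mk_graph n.+1 s) H -> exists h q, subdivides n.+1 s h q H.
Proof.
move=> ss [f [p [injf pP dp vH eH]]].
have A e : e \in s -> adj (mk_graph n.+1 s) (inord e.1) (inord e.2).
  move=> es; have [n1 n2 _ _] := simple_ends ss es.
  by rewrite adj_mk_graph //= !inordK // -surjective_pairing es.
exists (fun i => f (inord i)), (fun e => p (inord e.1) (inord e.2)).
have inS e : e \in s -> e = (val (@inord n e.1), val (@inord n e.2)).
  by move=> es; have [n1 n2 _ _] := simple_ends ss es; rewrite /= !inordK // -surjective_pairing.
split.
- rewrite cat_uniq; apply/and3P; split.
  + rewrite map_inj_in_uniq ?iota_uniq // => i j; rewrite !mem_iota /= => ni nj /injf E.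
    by rewrite -(inordK ni) -(inordK nj) E ?inE.
  + apply/hasPn => z /flattenP[_ /mapP[e es ->] ze].
    have [_ _ _ /(_ z ze)] := pP _ _ (A e es); apply: contra => /mapP[i _ ->].
    by apply: imset_f; rewrite inE.
  + apply/flatten_uniqP; first by case/andP: ss.
    split=> [e es|e e' es es' z ze ze']; first by have [] := pP _ _ (A e es).
    apply: contraTeq ze' => D.
    have /(dp _ _ _ _ (A _ es) (A _ es'))/pred0P/(_ z)/= :
        [set inord e.1; inord e.2] != [set inord e'.1; inord e'.2] :> {set 'I_n.+1}.
      apply: contra D => /eqP/eq_set2[][E1 E2].
        by rewrite (inS e es) (inS e' es') E1 E2.
      have [n1 n2 _] := simple_ends ss es.
      by rewrite -[e.2](inordK n2) -[e.1](inordK n1) E1 E2 -(inS e' es') es'.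
    by rewrite ze /= => ->.
- by apply/allP => e es; have [] := pP _ _ (A e es).
- rewrite vH; apply/setP => v; rewrite [in RHS]inE mem_cat; apply/setUP/orP => -[].
  + move=> /imsetP[i _ ->]; left; apply/mapP; exists (val i); rewrite ?inord_val //.
    by rewrite mem_iota /=.
  + move=> /bigcupP[x _ /bigcupP[y xy]]; rewrite inE => vp; right; apply/flattenP.
    have [pC _ _ _] := pP _ _ xy.
    move: xy; rewrite adj_mk_graph // => /orP[es|es].
      by exists (p x y) => //; apply/mapP; exists (val x, val y); rewrite //= !inord_val.
    exists (p y x); first by apply/mapP; exists (val y, val x); rewrite //= !inord_val.
    by rewrite pC mem_rev.
  + by move=> /mapP[i _ ->]; left; apply: imset_f; rewrite inE.
  + move=> /flattenP[_ /mapP[e es ->] ve]; right; apply/bigcupP; exists (inord e.1) => //.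
    by apply/bigcupP; exists (inord e.2); rewrite ?inE // A.
- rewrite eH; apply/setP => g; rewrite [in RHS]inE; apply/bigcupP/hasP => [[x _]|[e es ge]].
    move=> /bigcupP[y xy ge]; have [pC _ _ _] := pP _ _ xy.
    move: xy; rewrite adj_mk_graph // => /orP[es|es].
      by exists (val x, val y) => //; rewrite /track /= !inord_val.
    exists (val y, val x) => //; rewrite /track /= !inord_val -path_edges_rev.
    by rewrite pC rev_cons rev_rcons revK.
  by exists (inord e.1) => //; apply/bigcupP; exists (inord e.2); rewrite ?A.
Qed.

(** * Perfect matchings of a bisubdivision *)

Definition covers (v : nat) (e : nat * nat) : bool := (e.1 == v) || (e.2 == v).

(** Perfect matchings of [mk_graph n s] in computable form, as lists of pairs. *)
Definition exact_cover n (sel : seq (nat * nat)) : bool :=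
  all (fun v => count (covers v) sel == 1) (iota 0 n).

Section SubdivisionMatchings.
Variables (T : finType) (n : nat) (s : seq (nat * nat)) (H : graph T).
Variables (h : nat -> T) (q : nat * nat -> seq T).
Hypothesis (s_simple : simple_pairs n s) (H_sub : subdivides n s h q H).

Local Notation track := (track h q).
Local Notation tnth e i := (nth (h 0) (track e) i).

Definition first_edge (e : nat * nat) : {set T} := [set tnth e 0; tnth e 1].
Definition last_edge (e : nat * nat) : {set T} :=
  [set tnth e (size (q e)); tnth e (size (q e)).+1].

Let uV : uniq (track_verts n s h q). Proof. by case: H_sub. Qed.

Let h_inj i j : i < n -> j < n -> h i = h j -> i = j.
Proof. by have [+ _ _ _] := track_vertsP s_simple uV; apply. Qed.

Let q_h e i : e \in s -> i < n -> h i \notin q e.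
Proof.
have [_ qh _ _] := track_vertsP s_simple uV => es ni.
by apply/negP => hq; have := qh _ _ _ es hq ni; rewrite eqxx.
Qed.

Let q_even e : e \in s -> ~~ odd (size (q e)).
Proof. by case: H_sub => _ /allP ev _ _; apply: ev. Qed.

Let esetE g : reflect (exists2 e, e \in s & g \in path_edges (track e)) (g \in eset H).
Proof. by case: H_sub => _ _ _ ->; rewrite inE; apply: hasP. Qed.

Let vsetE v : (v \in vset H) = (v \in track_verts n s h q).
Proof. by case: H_sub => _ _ -> _; rewrite inE. Qed.

Lemma size_track e : size (track e) = (size (q e)).+2.
Proof. by rewrite /= size_rcons. Qed.

Lemma track_last e : tnth e (size (q e)).+1 = h e.2.
Proof. by rewrite /= nth_rcons ltnn eqxx. Qed.

Lemma track_mid e i : i < size (q e) -> tnth e i.+1 \in q e.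
Proof. by move=> iq; rewrite /= nth_rcons iq mem_nth. Qed.

Lemma track_uniq e : e \in s -> uniq (track e).
Proof.
move=> es; have [n1 n2 n12 _] := simple_ends s_simple es.
have [_ _ /(_ e es) uq _] := track_vertsP s_simple uV.
rewrite /= mem_rcons inE negb_or rcons_uniq uq !q_h // !andbT.
by apply: contra n12 => /eqP/h_inj->.
Qed.

Lemma mem_track_q e e' v : e \in s -> e' \in s -> v \in q e -> v \in track e' -> e' = e.
Proof.
move=> es es' ve; have [n1 n2 _ _] := simple_ends s_simple es'.
rewrite inE mem_rcons inE => /or3P[/eqP E|/eqP E|ve'].
- by have := q_h es n1; rewrite -E ve.
- by have := q_h es n2; rewrite -E ve.
- by have [_ _ _ dq] := track_vertsP s_simple uV; apply: dq ve.
Qed.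

Lemma mem_track_h e i : e \in s -> i < n -> h i \in track e -> i = e.1 \/ i = e.2.
Proof.
move=> es ni; have [n1 n2 _ _] := simple_ends s_simple es.
rewrite inE mem_rcons inE (negPf (q_h es ni)) orbF.
by case/orP => /eqP/h_inj; auto.
Qed.

(** An edge shared by two different paths would contain no interior vertex of either, so both paths
    would be this single edge; injectivity of [h] and the absence of reversed pairs exclude that. *)
Lemma track_edge_inj e e' g : e \in s -> e' \in s ->
  g \in path_edges (track e) -> g \in path_edges (track e') -> e = e'.
Proof.
move=> es es' ge ge'.
have X e1 e2 g1 : e1 \in s -> e2 \in s -> e1 <> e2 -> g1 \in path_edges (track e1) ->
    g1 \in path_edges (track e2) -> g1 = [set h e1.1; h e1.2].
  move=> s1 s2 D /(path_edgesP (h 0))[i]; rewrite size_track ltnS => i1 Eg g2.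
  have Y j : j < size (q e1) -> tnth e1 j.+1 \in g1 -> False.
    move=> jq /(path_edges_mem g2) j2; apply: D; apply/esym.
    exact: mem_track_q (track_mid jq) j2.
  case: i Eg i1 => [|i] Eg i1; last first.
    by case: (Y i i1); rewrite Eg !inE eqxx.
  case: (ltnP 0 (size (q e1))) => [q0|]; first by case: (Y 0 q0); rewrite Eg !inE eqxx orbT.
  by rewrite leqn0 => /eqP q0; rewrite Eg -(track_last e1) q0.
apply/eqP; apply: contraT => /eqP D.
have E1 := X _ _ _ es es' D ge ge'; have E2 := X _ _ _ es' es (fun E => D (esym E)) ge' ge.
have [n1 n2 _ sy] := simple_ends s_simple es.
have [n1' n2' _ _] := simple_ends s_simple es'.
move: E1; rewrite E2 => /eq_set2[][Ea Eb].
  case: D; rewrite [LHS]surjective_pairing [RHS]surjective_pairing.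
  by rewrite (h_inj n1' n1 Ea) (h_inj n2' n2 Eb).
by move: sy; rewrite -(h_inj n1' n2 Ea) -(h_inj n2' n1 Eb) -surjective_pairing es'.
Qed.

Lemma inner_edge e i g : e \in s -> i < size (q e) -> g \in eset H -> tnth e i.+1 \in g ->
  g = [set tnth e i; tnth e i.+1] \/ g = [set tnth e i.+1; tnth e i.+2].
Proof.
move=> es iq /esetE[e' es' ge'] ig.
have E := mem_track_q es es' (track_mid iq) (path_edges_mem ge' ig); subst e'.
have /(path_edgesP (h 0))[j] := ge'; rewrite size_track ltnS => jq Eg.
have u := track_uniq es; move: ig; rewrite Eg => /set2P[] /eqP;
  by rewrite nth_uniq ?size_track //; try lia; move=> /eqP[->]; auto.
Qed.

Lemma end_edge i g : i < n -> g \in eset H -> h i \in g ->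
  exists2 e, e \in s & (i = e.1 /\ g = first_edge e) \/ (i = e.2 /\ g = last_edge e).
Proof.
move=> ni /esetE[e es ge] ig; exists e => //.
have [n1 n2 n12 _] := simple_ends s_simple es.
have u := track_uniq es; have /(path_edgesP (h 0))[j] := ge.
rewrite size_track ltnS => jq Eg.
case: (mem_track_h es ni (path_edges_mem ge ig)) => Ei; subst i; [left|right]; split=> //.
  move: ig; rewrite Eg (_ : h e.1 = tnth e 0) // => /set2P[] /eqP;
  by rewrite nth_uniq ?size_track //; try lia; move=> /eqP[<-].
move: ig; rewrite Eg -(track_last e) => /set2P[] /eqP;
  by rewrite nth_uniq ?size_track //; try lia; move=> /eqP[<-].
Qed.

Lemma first_edge_in e : e \in s -> first_edge e \in path_edges (track e).
Proof. by move=> es; apply/(path_edgesP (h 0)); exists 0; rewrite ?size_track. Qed.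

Lemma last_edge_in e : e \in s -> last_edge e \in path_edges (track e).
Proof. by move=> es; apply/(path_edgesP (h 0)); exists (size (q e)); rewrite ?size_track. Qed.

Lemma mem_first_edge e : h e.1 \in first_edge e.
Proof. by rewrite !inE eqxx. Qed.

Lemma mem_last_edge e : h e.2 \in last_edge e.
Proof. by rewrite /last_edge track_last !inE eqxx orbT. Qed.

(** An interior vertex has degree two, so exactly one of two successive edges of a path is
    matched. *)
Lemma matching_alternates N e i : N \in pms H -> e \in s -> i <= size (q e) ->
  ([set tnth e i; tnth e i.+1] \in N) = (first_edge e \in N) (+) odd i.
Proof.
rewrite inE => /pmP[NE cN uN] es; elim: i => [|i IH] iq; first by rewrite addbF.
rewrite [odd i.+1]/= addbN -IH 1?ltnW //; apply/idP/negP => [N2 N1|N1].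
  have /eq_set2 := uN _ _ (tnth e i.+1) N1 N2 (set22 _ _) (set21 _ _).
  have u := track_uniq es.
  by case=> -[/eqP+ /eqP+]; rewrite !nth_uniq ?size_track; lia.
have vH : tnth e i.+1 \in vset H.
  rewrite vsetE mem_cat; apply/orP; right; apply/flattenP; exists (q e); first exact: map_f.
  exact: track_mid.
have [g gN ig] := cN _ vH.
by case: (inner_edge es iq (subsetP NE _ gN) ig) => Eg; move: gN; rewrite Eg.
Qed.

Lemma last_first N e : N \in pms H -> e \in s -> (last_edge e \in N) = (first_edge e \in N).
Proof.
by move=> PN es; rewrite matching_alternates // (negPf (q_even es)) addbF.
Qed.

Definition selection (N : {set {set T}}) : seq (nat * nat) :=
  [seq e <- s | first_edge e \in N].

Lemma selection_exact N : N \in pms H -> exact_cover n (selection N).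
Proof.
move=> PN; have := PN; rewrite inE => /pmP[NE cN uN].
apply/allP => v; rewrite mem_iota => /andP[_ nv]; apply/eqP.
have D e : e \in selection N -> covers v e ->
    exists2 g, g \in N & h v \in g /\ g \in path_edges (track e).
  rewrite mem_filter => /andP[fN es] /orP[/eqP <-|/eqP <-].
    by exists (first_edge e); rewrite // mem_first_edge first_edge_in.
  exists (last_edge e); first by rewrite last_first.
  by rewrite mem_last_edge last_edge_in.
have vH : h v \in vset H by rewrite vsetE mem_cat map_f // mem_iota.
have [g gN vg] := cN _ vH.
have [e es Ee] := end_edge nv (subsetP NE _ gN) vg.
have ge : g \in path_edges (track e).
  by case: Ee => -[_ ->]; [apply: first_edge_in | apply: last_edge_in].
apply: (count_eq1 (x := e)).
- by apply: filter_uniq; case/andP: s_simple.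
- rewrite mem_filter es andbT; case: Ee => -[_ E]; first by rewrite -E.
  by rewrite -last_first // -E.
- by rewrite /covers; case: Ee => -[-> _]; rewrite eqxx ?orbT.
- move=> e' se' /(D _ se')[g' g'N [vg' ge']].
  move: se'; rewrite mem_filter => /andP[_ es'].
  by apply: (track_edge_inj (g := g)) => //; rewrite (uN _ _ _ gN g'N vg vg').
Qed.

(** The edge of J whose path contains [g]; the default [(0, 0)] is reached only for [g] outside
    [eset H]. *)
Definition label (g : {set T}) : nat * nat :=
  head (0, 0) [seq e <- s | g \in path_edges (track e)].

Lemma labelP g : g \in eset H -> label g \in s /\ g \in path_edges (track (label g)).
Proof.
move=> /esetE[e es ge].
case E: [seq e <- s | g \in path_edges (track e)] => [|e0 r].
  by have : e \in [::] by rewrite -E mem_filter ge.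
have -> : label g = e0 by rewrite -[RHS]/(head (0, 0) (e0 :: r)) -E.
by have := mem_head e0 r; rewrite -E mem_filter => /andP[].
Qed.

(** The bit comes from the place of [g] on its path and not from the matching. Hence [g] tells two
    matchings apart exactly when its label tells the induced matchings of J apart. *)
Lemma label_parity g : g \in eset H ->
  exists b, forall N, N \in pms H -> (g \in N) = (label g \in selection N) (+) b.
Proof.
move=> /labelP[ls /(path_edgesP (h 0))[i]]; rewrite size_track ltnS => iq Eg.
exists (odd i) => N PN; rewrite {1}Eg matching_alternates //.
by rewrite mem_filter ls andbT.
Qed.

Lemma selection_inj : {in pms H &, injective selection}.
Proof.
move=> N N' PN PN' E; have := PN; rewrite inE => /andP[/subsetP NE _].
have := PN'; rewrite inE => /andP[/subsetP NE' _].
apply/setP => g; case gE: (g \in eset H); last first.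
  by rewrite (contraFF (NE g) gE) (contraFF (NE' g) gE).
by have [b B] := label_parity gE; rewrite !B // E.
Qed.

(** A selected path is matched together with its ends, any other path within its interior; both
    lists have even size, so their successive entries can be paired. *)
Lemma selection_onto (a : pred (nat * nat)) : exact_cover n (filter a s) ->
  exists2 N, N \in pms H & selection N = filter a s.
Proof.
move=> /allP va; pose F e := if a e then track e else q e.
pose ends e := if a e then [:: e.1; e.2] else [::].
have evF : {in s, forall e, ~~ odd (size (F e))}.
  by move=> e es; rewrite /F; case: ifP => _; rewrite ?size_track /= ?negbK q_even.
(* By exactness the ends of the selected pairs run once through all numbers below [n], so the lists
   [F e] together use each vertex of H once. *)
have pE : perm_eq (flatten [seq ends e | e <- s]) (iota 0 n).
  have C v : count_mem v (flatten [seq ends e | e <- s]) = count (covers v) (filter a s).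
    have : {in s, forall e, e.1 != e.2} by move=> e /(simple_ends s_simple)[].
    elim: (s) => [|e r IH] //= D; rewrite count_cat IH; last first.
      by move=> e' er; apply: D; rewrite inE er orbT.
    have := D e (mem_head _ _); rewrite /ends /covers; case: ifP => _ //=.
    move=> e12; congr (_ + _); case: (eqVneq e.1 v) e12 => [<-|_ _] /=; last by rewrite addn0.
    by rewrite eq_sym => /negPf->.
  apply/allP => v; rewrite mem_cat => /orP H0 /=; rewrite C.
  have nv : v \in iota 0 n.
    case: H0 => // /flattenP[_ /mapP[e es ->]]; have [n1 n2 _ _] := simple_ends s_simple es.
    by rewrite /ends mem_iota; case: ifP => // _; rewrite !inE => /orP[]/eqP->.
  by rewrite count_uniq_mem ?iota_uniq // nv va.
have pF : perm_eq (flatten [seq F e | e <- s]) (track_verts n s h q).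
  have := perm_map h pE; rewrite -(perm_cat2r (flatten [seq q e | e <- s])).
  apply: perm_trans.
  elim: (s) => [|e r IH] //=; rewrite map_cat [F e]/F [ends e]/ends; case: ifP => _ /=.
    apply/permP => p; have /permP/(_ p) := IH; rewrite /= -!cats1 !count_cat /=; lia.
  by apply/permP => p; have /permP/(_ p) := IH; rewrite !count_cat /=; lia.
have uL : uniq (flatten [seq F e | e <- s]) by rewrite (perm_uniq pF).
have FT e g : e \in s -> g \in pairs (F e) -> g \in path_edges (track e).
  move=> es /(subsetP (pairs_path_edges _)); rewrite /F; case: ifP => // _.
  rewrite /track -cats1; case: (q e) => [|a0 r]; first by rewrite path_edges0 inE.
  rewrite /= path_edges_cons inE -cat_cons => ga; apply/orP; right; move: ga.
  elim/last_ind: r => [|r b _]; first by rewrite path_edges1 inE.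
  by rewrite -rcons_cons cats1 path_edges_rcons inE => ->.
exists (pairs (flatten [seq F e | e <- s])).
  rewrite inE; apply: pairs_pm => //.
  - have: {in s, forall e, ~~ odd (size (F e))} := evF.
    elim: (s) => [|e r IH] //= D; rewrite size_cat oddD (negPf (D e (mem_head _ _))).
    by rewrite IH // => e' er; apply: D; rewrite inE er orbT.
  - apply/subsetP => g /pairs_flatten-/(_ evF)[e es ge]; apply/esetE; exists e => //.
    exact: FT.
  - by apply/setP => v; rewrite vsetE inE (perm_mem pF).
apply: eq_in_filter => e es; apply/(pairs_flatten _ evF)/idP => [[e' es' ge']|ae].
  have E := track_edge_inj es es' (first_edge_in es) (FT _ _ es' ge'); subst e'.
  move: ge'; rewrite /F; case: ifP => // _ /pairs_mem/(_ (mem_first_edge e)).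
  by have [n1 _ _ _] := simple_ends s_simple es; rewrite (negPf (q_h es n1)).
exists e => //; rewrite /F ae /track /first_edge /=.
by case: (q e) => [|a0 r] /=; rewrite setU11.
Qed.

End SubdivisionMatchings.

(** * Finite checks on J and forcing numbers of its bisubdivisions *)

Fixpoint sublists (T : Type) (s : seq T) : seq (seq T) :=
  if s is x :: s' then map (cons x) (sublists s') ++ sublists s' else [:: [::]].

Lemma filter_sublists (T : eqType) (a : pred T) (s : seq T) : filter a s \in sublists s.
Proof.
elim: s => [|x s IH] //=; rewrite mem_cat; case: (a x); rewrite ?IH ?orbT //.
by rewrite map_f.
Qed.

Lemma sublists_filter (T : eqType) (s r : seq T) :
  uniq s -> r \in sublists s -> r = [seq x <- s | x \in r].
Proof.
move=> us rs; apply/(subseq_uniqP us); move: rs {us}.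
elim: s r => [|x s IH] r /=; first by rewrite inE => /eqP->.
rewrite mem_cat => /orP[/mapP[r' r's ->]|/IH rs]; first by rewrite /= eqxx IH.
exact: subseq_trans rs (subseq_cons _ _).
Qed.

Definition exact_covers n (s : seq (nat * nat)) := filter (exact_cover n) (sublists s).

(** Here and in [Af_at_most] the forcing conditions are tested on the exact covers of J alone, with
    K running through all sets of edges, so that they can be evaluated. *)
Definition gf_exceeds n (s : seq (nat * nat)) k : bool :=
  let V := exact_covers n s in
  all (fun K : seq (nat * nat) => (size K <= k) ==>
    has (fun x : seq (nat * nat) => has (fun y : seq (nat * nat) => (x != y) && all (fun e => (e \in x) == (e \in y)) K) V) V)
    (sublists s).

Definition Af_at_most n (s : seq (nat * nat)) k : bool :=
  let V := exact_covers n s in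
  all (fun x : seq (nat * nat) => has (fun K : seq (nat * nat) => [&& size K <= k, all (fun e => e \notin x) K
    & all (fun y : seq (nat * nat) => (y != x) ==> has (fun e => e \in y) K) V]) (sublists s)) V.

Section SubdivisionForcing.
Variables (T : finType) (n : nat) (s : seq (nat * nat)) (H : graph T).
Variables (h : nat -> T) (q : nat * nat -> seq T).
Hypothesis (s_simple : simple_pairs n s) (H_sub : subdivides n s h q H).

Lemma exact_coversP x : x \in exact_covers n s ->
  exists2 N, N \in pms H & selection s h q N = x.
Proof.
rewrite mem_filter => /andP[vx xs].
have E := sublists_filter (andP s_simple).1 xs.
by have [|N PN EN] := @selection_onto _ _ _ _ _ _ s_simple H_sub (mem x);
  [rewrite -E | exists N; rewrite // EN -E].
Qed.

Lemma selection_covers N : N \in pms H -> selection s h q N \in exact_covers n s.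
Proof.
by move=> PN; rewrite mem_filter (selection_exact s_simple H_sub PN) filter_sublists.
Qed.

Lemma subdivision_gf k : gf_exceeds n s k -> k < gf H.
Proof.
move=> /allP chk; have [S sepS <-] := gf_witness H; rewrite ltnNge; apply/negP => Sk.
(* The labels of S are at most |S| edges of J; two covers that agree on them come from matchings
   that agree on S. *)
pose K := [seq e <- s | e \in [seq label s h q g | g <- enum S]].
have us := (andP s_simple).1.
have /implyP/(_ _)/hasP[|x Vx /hasP[y Vy /andP[xy /allP Kxy]]] := chk K (filter_sublists _ _).
  apply: leq_trans Sk; rewrite cardE -(size_map (label s h q)).
  apply: uniq_leq_size; first exact: filter_uniq.
  by move=> e; rewrite mem_filter => /andP[].
have [N PN EN] := exact_coversP Vx; have [N' PN' EN'] := exact_coversP Vy.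
suff E : N = N' by rewrite -EN -EN' E eqxx in xy.
apply: sepS => //; apply/setP => g; rewrite !inE; case gS: (g \in S) => //=.
case gE: (g \in eset H); last first.
  move: (PN) (PN'); rewrite !inE => /andP[/subsetP NE _] /andP[/subsetP NE' _].
  by rewrite (contraFF (NE g) gE) (contraFF (NE' g) gE).
have [b B] := label_parity s_simple H_sub gE; rewrite !B // EN EN'; congr (_ (+) _).
apply/eqP/Kxy; rewrite mem_filter (labelP H_sub gE).1 andbT.
by apply: map_f; rewrite mem_enum.
Qed.

Lemma subdivision_Af k : Af_at_most n s k -> Af H <= k.
Proof.
move=> /allP chk; apply: Af_leq => N PN.
have /hasP[K Ks /and3P[Kk /allP KN /allP KV]] := chk _ (selection_covers PN).
have sK e : e \in K -> e \in s.
  by rewrite (sublists_filter (andP s_simple).1 Ks) mem_filter => /andP[].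
(* The first edge of a path is matched exactly when its pair is selected, so it can stand for the
   edge of J. *)
exists [set g in [seq first_edge h q e | e <- K]]; last first.
  by apply: leq_trans Kk; rewrite cardsE -(size_map (first_edge h q)) card_size.
split=> [|N' PN' D].
  apply/pred0P => g /=; rewrite inE; apply/negP => /andP[/mapP[e eK ->] eN].
  by have := KN _ eK; rewrite mem_filter eN sK.
have /implyP/(_ _)/hasP[|e eK eN'] := KV _ (selection_covers PN').
  by apply: contra D => /eqP/(selection_inj s_simple H_sub PN' PN)->.
apply/pred0Pn; exists (first_edge h q e); rewrite /= inE map_f //=.
by move: eN'; rewrite mem_filter => /andP[].
Qed.

End SubdivisionForcing.

Lemma strongly_uniform_no_minor (T : finType) (G : graph T) n s k :
  simple_pairs n.+1 s -> exact_covers n.+1 s != [::] ->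
  gf_exceeds n.+1 s k -> Af_at_most n.+1 s k ->
  strongly_uniform G -> ~ conformal_minor (mk_graph n.+1 s) G.
Proof.
move=> ss nV gk ak [_ uG] [H bH cH].
have [h [q sH]] := bisubdivision_subdivides ss bH.
case EV: exact_covers nV => [//|x V] _.
have [|N PN _] := @exact_coversP _ _ _ _ _ _ ss sH x; first by rewrite EV mem_head.
have E := uG H cH (ex_intro _ N _); rewrite inE in PN.
have := subdivision_gf ss sH gk; rewrite (E PN).
by rewrite ltnNge (subdivision_Af ss sH ak).
Qed.

(** Each [k] is a number with Af at most [k] and gf above [k]; both bounds persist in
    bisubdivisions. *)
Lemma strongly_uniform_no_minors (T : finType) (G : graph T) : strongly_uniform G ->
  [/\ ~ conformal_minor A1 G, ~ conformal_minor A2 G,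
      ~ conformal_minor A3 G & ~ conformal_minor A4 G].
Proof.
move=> uG; split.
- by apply: (strongly_uniform_no_minor (k := 1)) uG; vm_compute.
- by apply: (strongly_uniform_no_minor (k := 2)) uG; vm_compute.
- by apply: (strongly_uniform_no_minor (k := 2)) uG; vm_compute.
- by apply: (strongly_uniform_no_minor (k := 3)) uG; vm_compute.
Qed.

(** * Ears and Hamilton cycles *)

(** A vertex without partner is fixed, so this is an involution of the whole type, as is convenient
    for iterating it. *)
Definition mate (T : finType) (M : {set {set T}}) (x : T) : T :=
  odflt x [pick y | [set x; y] \in M].

Section Matched.
Variables (T : finType) (G : graph T).
Implicit Types (M E : {set {set T}}) (X B : {set T}) (c s p : seq T) (x y u v w : T).

Lemma mateE M x y : perfect_matching G M -> [set x; y] \in M -> mate M x = y.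
Proof.
move=> /pmP[ME _ uM] xyM; rewrite /mate; case: pickP => [z xzM|/(_ y)]; last by rewrite xyM.
have := uM _ _ x xyM xzM (set21 _ _) (set21 _ _).
have xy : x != y by apply: contraTneq (subsetP ME _ xyM) => ->; rewrite [_ \in _]adj_irr.
by case/eq_set2 => -[_ E] //; rewrite E eqxx in xy.
Qed.

Lemma mate_in M x : perfect_matching G M -> x \in vset G -> [set x; mate M x] \in M.
Proof.
move=> PM xV; have /pmP[ME cM _] := PM; have [e eM xe] := cM x xV.
have [y [z [_ E _ _]]] := eset2P (subsetP ME _ eM).
move: xe; rewrite E => /set2P[] Ex; subst x.
  by rewrite (mateE (y := z) PM) -?E.
by rewrite (mateE (y := y) PM) setUC -?E.
Qed.

Lemma mate_adj M x : perfect_matching G M -> x \in vset G -> adj G x (mate M x).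
Proof. by move=> PM /(mate_in PM); have /andP[/subsetP ME _] := PM; apply: ME. Qed.

Lemma mate_vset M x : perfect_matching G M -> x \in vset G -> mate M x \in vset G.
Proof. by move=> PM xV; have := mate_adj PM xV; rewrite adj_sym => /adj_vset. Qed.

Lemma mate_out M x : perfect_matching G M -> x \notin vset G -> mate M x = x.
Proof.
move=> /andP[/subsetP ME _] xV; rewrite /mate; case: pickP => //= y /ME/adj_vset.
by rewrite (negPf xV).
Qed.

Lemma mateK M : perfect_matching G M -> involutive (mate M).
Proof.
move=> PM x; case xV: (x \in vset G); last by rewrite !mate_out ?xV.
by apply: (mateE PM); rewrite setUC mate_in.
Qed.

Lemma mate_closed_matchable M X : perfect_matching G M ->
  {in X, forall x, mate M x \in X} -> matchable (del_verts G X).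
Proof.
move=> PM clX; have /pmP[ME cM uM] := PM.
exists [set e in M | [disjoint e & X]]; apply/pmP; split=> /=.
- by apply/subsetP => e; rewrite !inE => /andP[/(subsetP ME)-> ->].
- move=> v /setDP[vV vX]; exists [set v; mate M v]; last exact: set21.
  rewrite inE mate_in //=; apply/pred0P => z /=; apply/negP => /andP[/set2P[]->].
    by rewrite (negPf vX).
  by move/clX; rewrite mateK // (negPf vX).
- by move=> e e' v; rewrite !inE => /andP[eM _] /andP[e'M _]; apply: uM.
Qed.

Lemma adj_path_rev x y p :
  path (adj G) x (rcons p y) = path (adj G) y (rcons (rev p) x).
Proof.
have := @rev_path _ (adj G) x (rcons p y).
rewrite last_rcons belast_rcons rev_cons => ->.
by apply: eq_path => z t; apply: adj_sym.
Qed.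

Lemma path_color B x y p : proper_coloring B (eset G) ->
  path (adj G) x (rcons p y) -> (y \in B) = (x \in B) (+) ~~ odd (size p).
Proof.
move=> colB; elim: p x => [|z p IH] x /=.
  by move=> /andP[/colB]; case: (x \in B); case: (y \in B).
move=> /andP[/colB xz /IH ->]; rewrite negbK.
by move: xz; case: (x \in B); case: (z \in B); case: odd.
Qed.

Lemma exit_edge X x y : connected G -> x \in vset G -> y \in vset G ->
  x \in X -> y \notin X -> exists u v, [/\ u \in X, v \notin X & adj G u v].
Proof.
move=> cG xV yV xX yX.
case E: [exists u, [exists v, [&& u \in X, v \notin X & adj G u v]]].
  by have /existsP[u /existsP[v /and3P[]]] := E; exists u, v.
have cl u v : u \in X -> adj G u v -> v \in X.
  move=> uX uv; apply: contraFT E => vX.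
  by apply/existsP; exists u; apply/existsP; exists v; rewrite uX vX.
have clX : closed (adj G) (mem X).
  by move=> u v uv; apply/idP/idP => [/cl|]; [apply | rewrite adj_sym in uv => /cl; apply].
by have := closed_connect clX (cG x y xV yV); rewrite /= xX (negPf yX).
Qed.

(* Alternate between M and a perfect matching M' through uv, starting with uv:
   the orbit of [mate M' \o mate M] leads back to X. *)
Lemma ear M B X u v : matching_covered G -> proper_coloring B (eset G) ->
  perfect_matching G M -> {in X, forall x, mate M x \in X} ->
  u \in X -> v \notin X -> adj G u v ->
  exists w s, [/\ w \in X /\ (w \in B) != (u \in B), path (adj G) u (rcons s w),
    uniq s /\ {in s, forall x, x \notin X}, ~~ odd (size s) /\ s != [::]
    & {in s, forall x, mate M x \in s}].
Proof.
move=> [_ mcG] colB PM clX uX vX uv.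
have [M' PM' uvM'] := mcG _ uv.
(* The orbit starts at the M-partner of [u], so that [f 0] is in X and [f 1] is [v]. All [f j] have
   the colour of [v]; the ear runs through [f j] and its M-partner for j = 1, 2, ... until the first
   return [f m] to X, which is its end [w]. *)
pose sg x := mate M' (mate M x); pose u0 := mate M u; pose f j := iter j sg u0.
have uV := adj_vset uv.
have fS j : f j.+1 = mate M' (mate M (f j)) by [].
have injs : injective sg by apply: inj_comp; apply: (can_inj (mateK _)).
have fV j : f j \in vset G.
  by elim: j => [|j IH]; rewrite ?fS ?mate_vset.
have fB j : (f j \in B) = ~~ (u \in B).
  have X1 N x : perfect_matching G N -> x \in vset G -> (mate N x \in B) = ~~ (x \in B).
    by move=> PN /(mate_adj PN)/colB; case: (x \in B); case: (_ \in B).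
  by elim: j => [|j IH]; rewrite ?fS ?X1 ?mate_vset // IH negbK.
have f1 : f 1 = v by rewrite fS /f /= /u0 (mateK PM); exact: mateE uvM'.
(* [sg] is injective on a finite type, so the orbit comes back to [f 0]. *)
have ex : exists m, (0 < m) && (f m \in X).
  exists (order sg u0); rewrite order_gt0 /f iter_order //; exact: clX.
have [m /andP[m0 mX] min] := ex_minnP ex.
have out j : 0 < j < m -> f j \notin X.
  by move=> /andP[j0 jm]; apply/negP => jX; have := min j; rewrite j0 jX => /(_ isT); lia.
(* A repetition cancels down to [f 0], which would be a return to X before [m]. *)
have finj i j : 0 < i -> j < m -> i < j -> f i != f j.
  move=> i0 jm ij; apply/eqP => E.
  have E0 : f 0 = f (j - i).
    move: E; rewrite /f -{1}(subnKC (ltnW ij)) iterD; move: (j - i) => d.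
    elim: i {i0 ij} => [//|i IH] /injs.
    exact: IH.
  have /negP[] : f (j - i) \notin X by apply: out; lia.
  by rewrite -E0; apply: clX.
pose q j := [:: f j; mate M (f j)].
have m2 : 1 < m by case: m mX m0 {min out finj} => [|[]] //; rewrite f1 (negPf vX).
have mB j : (mate M (f j) \in B) = (u \in B).
  by have := colB _ _ (mate_adj PM (fV j)); rewrite fB; case: (u \in B); case: (_ \in B).
exists (f m), (flatten [seq q j | j <- iota 1 m.-1]); split.
- by rewrite mX fB; case: (u \in B).
- have : f m.-1.+1 = f m by rewrite prednK.
  move=> <-; elim: (m.-1) => [|k IH].
    by change (adj G u (f 1) && true); rewrite f1 uv.
  have -> : flatten [seq q j | j <- iota 1 k.+1]
      = rcons (rcons (flatten [seq q j | j <- iota 1 k]) (f k.+1)) (mate M (f k.+1)).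
    by rewrite -[k.+1]addn1 iotaD map_cat flatten_cat add1n addn1 -!cats1 -catA.
  rewrite 2!(rcons_path _ _ (rcons _ _)) IH !last_rcons mate_adj // fS.
  by apply: mate_adj; rewrite ?mate_vset.
- split.
    apply/flatten_uniqP; first exact: iota_uniq.
    split=> [j _|i j]; rewrite ?mem_iota.
      rewrite /= inE andbT; apply/eqP => E; have := fB j; rewrite {1}E mB.
      by case: (u \in B).
    move=> Hi Hj z; rewrite !inE.
    have N a b : f a = mate M (f b) -> False.
      by move=> E; have := fB a; rewrite E mB; case: (u \in B).
    have I : f i = f j -> i = j.
      by move=> E; case: (ltngtP i j) => // ij; [have := finj i j|have := finj j i];
         rewrite E eqxx; lia.
    move=> /orP[/eqP->|/eqP->] /orP[] /eqP E; [exact: I|by case: (N _ _ E)| |].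
      by case: (N _ _ (esym E)).
    by apply: I; apply: (can_inj (mateK PM)).
  move=> x /flattenP[_ /mapP[j + ->]]; rewrite mem_iota !inE => Hj.
  have oj : f j \notin X by apply: out; lia.
  case/orP => /eqP-> //; apply: contra oj => /clX; by rewrite mateK.
- split; last by case: m m2 {mX m0 min out finj} => [|[]].
  elim: (iota _ _) => //= j r IH; by rewrite negbK.
- move=> x /flattenP[_ /mapP[j jm ->]] xj; apply/flattenP; exists (q j).
    exact: map_f.
  by move: xj; rewrite !inE => /orP[]/eqP->; rewrite ?mateK ?eqxx ?orbT.
Qed.

End Matched.

Lemma subdivided_minor (T : finType) (G : graph T) n s (h : nat -> T) q :
  simple_pairs n s -> uniq (track_verts n s h q) -> all (fun e => ~~ odd (size (q e))) s ->
  {subset track_verts n s h q <= vset G} ->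
  all (fun e => path (adj G) (h e.1) (rcons (q e) (h e.2))) s ->
  matchable (del_verts G [set x in track_verts n s h q]) ->
  conformal_minor (mk_graph n s) G.
Proof.
move=> ss uV ev sV /allP pG mG.
pose X := [set x in track_verts n s h q].
pose E := [set g | has (fun e => g \in path_edges (track h q e)) s].
have EG : E \subset eset G.
  apply/subsetP => g; rewrite inE => /hasP[e es]; apply/subsetP.
  by rewrite path_edges_path pG.
have gp : [forall e in E, (e \subset X) && (#|e| == 2)].
  apply/forall_inP => g gE; rewrite (andP (forall_inP (graphP G) g (subsetP EG _ gE))).2 andbT.
  move: gE; rewrite inE => /hasP[e es] ge; have [n1 n2 _ _] := simple_ends ss es.
  apply/subsetP => x /(path_edges_mem ge); rewrite !inE mem_cat mem_rcons inE.
  case/or3P => [/eqP->|/eqP->|xq]; try by rewrite map_f // mem_iota.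
  by apply/orP; right; apply/flattenP; exists (q e) => //; apply: map_f.
exists (Graph gp); first by apply: (@subdivides_bisubdivision _ _ _ _ h q).
split=> //; rewrite /subgraph /= EG andbT; apply/subsetP => x; rewrite inE; exact: sV.
Qed.

(* The bits are generalized because [lia] would split on each of them. *)
Ltac count_lia := repeat match goal with |- context [nat_of_bool ?b] =>
  move: (nat_of_bool b) => ? end; clear; lia.

Section Minors.
Variables (T : finType) (G : graph T).
Implicit Types (X B : {set T}) (c s p r : seq T) (x y z u v w : T).

Lemma path_sub x p y : path (adj G) x (rcons p y) -> {subset x :: rcons p y <= vset G}.
Proof.
move=> xp z; rewrite -rcons_cons mem_rcons in_cons => /predU1P[->|].
  by move: xp; rewrite adj_path_rev; case: (rev p) => [|a l] /= /andP[/adj_vset].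
elim: p x xp => [|a p IH] x /=.
  by rewrite inE => /andP[/adj_vset xV _] /eqP->.
by move=> /andP[/adj_vset xV ap]; rewrite inE => /predU1P[->|/(IH _ ap)].
Qed.

(* The first two interior vertices of each path become vertices of A1, the
   remainder having even length. *)
Lemma theta_A1 u w s1 s2 s3 : uniq (u :: w :: s1 ++ s2 ++ s3) ->
  [/\ ~~ odd (size s1), ~~ odd (size s2) & ~~ odd (size s3)] ->
  [/\ s1 != [::], s2 != [::] & s3 != [::]] ->
  [/\ path (adj G) u (rcons s1 w), path (adj G) u (rcons s2 w)
    & path (adj G) u (rcons s3 w)] ->
  matchable (del_verts G [set x in u :: w :: s1 ++ s2 ++ s3]) -> conformal_minor A1 G.
Proof.
case: s1 => [|a1 [|b1 r1]]; case: s2 => [|a2 [|b2 r2]]; case: s3 => [|a3 [|b3 r3]];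
  move=> us [o1 o2 o3] [n1 n2 n3] [p1 p2 p3] mG //.
pose h i := nth u [:: u; w; a1; b1; a2; b2; a3; b3] i.
pose q (e : nat * nat) := if e == (3, 1) then r1 else if e == (5, 1) then r2
  else if e == (7, 1) then r3 else [::].
set V := [:: u, w & _] in us mG.
have pV : perm_eq (track_verts 8 [:: (0, 2); (2, 3); (3, 1); (0, 4); (4, 5); (5, 1);
    (0, 6); (6, 7); (7, 1)] h q) V.
  by apply/permP => P; rewrite /V /track_verts /h /q /= ?count_cat /= ?count_cat /=; count_lia.
have EV : [set x in track_verts 8 [:: (0, 2); (2, 3); (3, 1); (0, 4); (4, 5); (5, 1);
    (0, 6); (6, 7); (7, 1)] h q] = [set x in V].
  by apply/setP => x; rewrite [LHS]in_set [RHS]in_set; apply: perm_mem pV x.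
apply: (@subdivided_minor _ _ _ _ h q) => //.
- by rewrite (perm_uniq pV).
- by move: o1 o2 o3; rewrite /q /= !negbK => -> -> ->.
- move=> x; rewrite (perm_mem pV) /V.
  have := path_sub p1; have := path_sub p2; have := path_sub p3.
  move=> q3 q2 q1; rewrite 2!inE !mem_cat => /or4P[/eqP->|/eqP->|xs|/orP[xs|xs]].
  + by apply: q1; rewrite mem_head.
  + by apply: q1; rewrite -rcons_cons mem_rcons mem_head.
  + by apply: q1; rewrite in_cons mem_rcons in_cons xs !orbT.
  + by apply: q2; rewrite in_cons mem_rcons in_cons xs !orbT.
  + by apply: q3; rewrite in_cons mem_rcons in_cons xs !orbT.
- by move: p1 p2 p3 => /= /and3P[-> -> ->] /and3P[-> -> ->] /and3P[-> -> ->].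
- by rewrite EV.
Qed.

(** Only the vertex set of a [good] cycle has to be closed under M; its edges need not alternate. So
    the cycle stays good when one of its edges is replaced by an ear, and whatever lies outside the
    cycle and the ear is still matched by M. *)
Lemma hamilton_or_A1 : matching_covered G -> bipartite G -> 4 <= #|vset G| ->
  ~ conformal_minor A1 G -> exists c, hamilton_cycle G c.
Proof.
move=> mcG [B colB] V4 nA1; have [cG pmG] := mcG.
have [x0 x0V] : exists x, x \in vset G by apply/set0Pn; rewrite -card_gt0; lia.
have offX X : #|X| < 4 -> exists2 y, y \in vset G & y \notin X.
  move=> X4; have /subsetPn[y] : ~~ (vset G \subset X).
    by apply: contraTN X4 => /subset_leq_card; lia.
  by exists y.
have [M PM] : exists M, perfect_matching G M.
  have [y yV] := offX [set x0] (ltac:(by rewrite cards1)).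
  rewrite inE => yx; have /(_ [set x0])[] // := @exit_edge _ G _ x0 y cG x0V yV.
  - exact: set11.
  - by rewrite inE.
  by move=> u [v [_ _ /pmG[M PM _]]]; exists M.
pose good c := [/\ 2 < size c, uniq c, cycle (adj G) c & {in c, forall x, mate M x \in c}].
have good_rot c i : good c -> good (rot i c).
  case=> c2 uc cc clc; split; rewrite ?size_rot ?rot_uniq ?rot_cycle // => x.
  by rewrite !mem_rot; apply: clc.
(* An ear attached to a single edge of M must join the two ends of that edge, and closes a cycle
   with it. *)
have [c0 good0] : exists c, good c.
  have X2 : #|[set x0; mate M x0]| < 4 by rewrite cards2; lia.
  have [y yV yX] := offX _ X2.
  have [u [v [uX vX uv]]] := exit_edge cG x0V yV (set21 _ _) yX.
  have clX : {in [set x0; mate M x0], forall x, mate M x \in [set x0; mate M x0]}.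
    by move=> x; rewrite !inE => /orP[]/eqP->; rewrite ?(mateK PM) ?eqxx ?orbT.
  have [w [s [[wX wu] us [uqs sX] [os s0] cls]]] := ear mcG colB PM clX uX vX uv.
  have Ew : w = mate M u.
    move: uX wX wu; rewrite !inE => /orP[]/eqP-> /orP[]/eqP->; rewrite ?eqxx ?(mateK PM) //.
  have uV := adj_vset uv.
  exists (u :: rcons s w); split.
  - by rewrite /= size_rcons; case: (s) s0 os => [|? [|]].
  - rewrite /= mem_rcons in_cons rcons_uniq uqs negb_or !andbT.
    rewrite (contraNneq _ wu) => [|->]; last by rewrite eqxx.
    by rewrite /= (contraTN (sX u) uX) (contraTN (sX w) wX).
  - by rewrite /cycle rcons_path us last_rcons adj_sym Ew mate_adj.
  - move=> x; rewrite in_cons mem_rcons !in_cons mem_rcons => /or3P[/eqP->|/eqP->|/cls xs].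
    + by rewrite -Ew in_cons eqxx orbT.
    + by rewrite Ew (mateK PM) eqxx.
    + by rewrite in_cons xs !orbT.
have [k] := ubnP (#|T| - size c0); elim: k c0 good0 => // k IH c good_c ck.
have [c2 uc cc clc] := good_c.
have cV : {subset c <= vset G}.
  by move=> x xc; have := next_cycle cc xc => /adj_vset.
case: (boolP (vset G \subset c)) => [Vc|/subsetPn[y yV yc]].
  exists c; rewrite /hamilton_cycle c2 uc cc !andbT; apply/eqP/setP => x; rewrite inE.
  by apply/idP/idP => [/cV|/(subsetP Vc)].
have [x xc] : exists x, x \in c by case: (c) c2 => // x l; exists x; rewrite mem_head.
have [u [v [uX vX uv]]] := @exit_edge _ G [set x in c] x y cG (cV x xc) yV
  (ltac:(by rewrite inE)) (ltac:(by rewrite inE)).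
have clX : {in [set x in c], forall x, mate M x \in [set x in c]}.
  by move=> z; rewrite !inE; apply: clc.
have [w [s [[wX wu] us [uqs sX] [os s0] cls]]] := ear mcG colB PM clX uX vX uv.
rewrite !inE in uX wX; have [i c' Ec] := rot_to uX.
have := good_rot c i good_c; rewrite Ec => good_c'.
have szc : size c = (size c').+1 by rewrite -(size_rot i) Ec.
have {}sX z : z \in s -> z \notin u :: c'.
  by move=> /sX; rewrite inE -(mem_rot i) Ec.
have wc' : w \in c'.
  move: wX; rewrite -(mem_rot i) Ec inE => /predU1P[Ewu|//].
  by rewrite Ewu eqxx in wu.
have uT : size (c' ++ s) < #|T|.
  have us' : uniq (u :: c' ++ s).
    have [_ + _ _] := good_c'; rewrite -!cat_cons cat_uniq uqs andbT => -> /=.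
    by apply/hasPn => z /sX.
  have := max_card (mem (u :: c' ++ s)); by rewrite (card_uniqP us').
case/splitPr: wc' good_c' szc sX uT {Ec} => c1 c3 [_ uc' cc' clc'] szc sX uT.
have s_gt0 : 0 < size s by case: (s) s0.
move: cc'; rewrite /= rcons_cat rcons_cons -cat_rcons cat_path last_rcons => /andP[p1 p3].
have ev1 : ~~ odd (size c1).
  by have := path_color colB p1; move: wu; case: (w \in B); case: (u \in B); case: odd.
have ev3 : ~~ odd (size c3).
  by have := path_color colB p3; move: wu; case: (w \in B); case: (u \in B); case: odd.
(* [l] is the arc that is kept when the other arc has no inner vertex, that is, when it is an edge
   that the ear can replace. *)
have longer l : path (adj G) w (rcons l u) -> perm_eq (u :: c1 ++ w :: c3) (u :: w :: l) ->
    exists c, hamilton_cycle G c.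
  move=> pl pc; apply: (IH (u :: s ++ w :: l)); last first.
    move: (perm_size pc) szc uT ck s_gt0; rewrite /= ?size_cat /= ?size_cat; clear; lia.
  have pc' : perm_eq (u :: s ++ w :: l) (s ++ (u :: c1 ++ w :: c3)).
    apply/permP => P; have /permP/(_ P) := pc; rewrite /= ?count_cat /= ?count_cat /=; count_lia.
  split.
  - by rewrite /= size_cat /=; move: s_gt0; clear; lia.
  - rewrite (perm_uniq pc') cat_uniq uqs uc' andbT; apply/hasPn => z zc.
    by apply: contraL zc => /sX.
  - rewrite /= rcons_cat rcons_cons -cat_rcons cat_path us last_rcons; exact: pl.
  - move=> z; rewrite !(perm_mem pc') !mem_cat => /orP[/cls->//|/clc'->].
    by rewrite orbT.
case: (eqVneq c1 [::]) => [c10|n1].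
  by apply: longer p3 _; rewrite c10.
case: (eqVneq c3 [::]) => [c30|n3].
  apply: (longer (rev c1)); first by rewrite -adj_path_rev.
  by rewrite c30; apply/permP => P; rewrite /= count_cat count_rev /=; count_lia.
(* Both arcs now have inner vertices, and evenly many, since the ends of the ear have different
   colours. With the ear they form a theta graph. *)
case: nA1; apply: (@theta_A1 u w c1 s (rev c3)).
- have pp : perm_eq (u :: w :: c1 ++ s ++ rev c3) (s ++ (u :: c1 ++ w :: c3)).
    apply/permP => P; rewrite /= ?count_cat /= ?count_cat count_rev /=; count_lia.
  rewrite (perm_uniq pp) cat_uniq uqs uc' andbT; apply/hasPn => z zc.
  by apply: contraL zc => /sX.
- by rewrite size_rev.
- by rewrite -!size_eq0 size_rev !size_eq0.
- by rewrite -adj_path_rev.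
- apply: (mate_closed_matchable PM) => z; rewrite !inE !mem_cat !mem_rev => zz.
  have := clc' z; have := cls z; rewrite !inE !mem_cat !inE.
  by move: zz; do !case: (_ \in _) => //=; rewrite ?orbT //=; move=> *; auto.
Qed.

End Minors.
(** * Pairs of chords of a Hamilton cycle *)

Section CycleMinors.
Variables (T : finType) (G : graph T).
Implicit Types (X B : {set T}) (c s p r : seq T) (x y z u v w : T).

Lemma spanning_matchable s : {subset vset G <= s} -> matchable (del_verts G [set x in s]).
Proof.
move=> Vs; exists set0; apply/pmP; split=> [|v|e e' v]; rewrite ?sub0set ?inE //.
by move=> /andP[+ /Vs vs]; rewrite vs.
Qed.

Lemma hamilton_path x s : hamilton_cycle G (x :: s) -> path (adj G) x (rcons s x).
Proof. by case/and4P. Qed.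

Lemma path_rcons_cat x y z p r : path (adj G) x (rcons (p ++ y :: r) z) =
  path (adj G) x (rcons p y) && path (adj G) y (rcons r z).
Proof. by rewrite rcons_cat rcons_cons -cat_rcons cat_path last_rcons. Qed.

(** A spanning subgraph leaves no vertex over, so it is conformal. *)
Lemma hamilton_spanning_minor n (s : seq (nat * nat)) (h : nat -> T) q c :
  simple_pairs n s -> hamilton_cycle G c -> perm_eq (track_verts n s h q) c ->
  all (fun e => ~~ odd (size (q e))) s ->
  all (fun e => path (adj G) (h e.1) (rcons (q e) (h e.2))) s ->
  conformal_minor (mk_graph n s) G.
Proof.
move=> ss /and4P[_ uc /eqP Ec _] pc ev pG.
apply: (@subdivided_minor _ _ _ _ h q) => //.
- by rewrite (perm_uniq pc).
- by move=> x; rewrite (perm_mem pc) -Ec inE.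
- by apply: spanning_matchable => x; rewrite -Ec inE (perm_mem pc).
Qed.

(** The first one or two vertices of each segment become the vertices of degree two; by the parities
    the rest of every segment is even. [A3_cycle] works in the same way. *)
Lemma A2_cycle x y z s1 s2 s3 : hamilton_cycle G (x :: s1 ++ y :: s2 ++ z :: s3) ->
  adj G x y -> adj G x z -> ~~ odd (size s1) -> odd (size s2) -> ~~ odd (size s3) ->
  s1 != [::] -> s3 != [::] -> conformal_minor A2 G.
Proof.
case: s1 => [|a [|b r1]]; case: s2 => [|d r2]; case: s3 => [|e [|k r3]];
  move=> hG xy xz o1 o2 o3 n1 n3 //.
pose h i := nth x [:: x; a; b; y; d; z; e; k] i.
pose q (e : nat * nat) := if e == (2, 3) then r1 else if e == (4, 5) then r2
  else if e == (7, 0) then r3 else [::].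
apply: (@hamilton_spanning_minor _ _ h q _ _ hG) => //.
- by apply/permP => P; rewrite /track_verts /h /q /= ?count_cat /= ?count_cat /=; count_lia.
- by move: o1 o2 o3; rewrite /q /= !negbK => -> -> ->.
- move: (hamilton_path hG).
  rewrite !path_rcons_cat /h /q /=.
  by move=> /and3P[/and3P[-> -> ->] /andP[-> ->] /and3P[-> -> ->]]; rewrite [adj _ _ _]xy [adj _ _ _]xz.
Qed.

Lemma A3_cycle x y z w s1 s2 s3 s4 :
  hamilton_cycle G (x :: s1 ++ y :: s2 ++ z :: s3 ++ w :: s4) ->
  adj G x y -> adj G z w -> ~~ odd (size s1) -> odd (size s2) -> ~~ odd (size s3) ->
  odd (size s4) -> s1 != [::] -> s3 != [::] -> conformal_minor A3 G.
Proof.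
case: s1 => [|a [|b r1]]; case: s2 => [|d r2]; case: s3 => [|e [|k r3]]; case: s4 => [|m r4];
  move=> hG xy zw o1 o2 o3 o4 n1 n3 //.
pose h i := nth x [:: x; a; b; y; d; z; e; k; w; m] i.
pose q (e : nat * nat) := if e == (2, 3) then r1 else if e == (4, 5) then r2
  else if e == (7, 8) then r3 else if e == (9, 0) then r4 else [::].
apply: (@hamilton_spanning_minor _ _ h q _ _ hG) => //.
- by apply/permP => P; rewrite /track_verts /h /q /= ?count_cat /= ?count_cat /= ?count_cat /=; count_lia.
- by move: o1 o2 o3 o4; rewrite /q /= !negbK => -> -> -> ->.
- move: (hamilton_path hG).
  rewrite !path_rcons_cat /h /q /=.
  move=> /and4P[/and3P[-> -> ->] /andP[-> ->] /and3P[-> -> ->] /andP[-> ->]].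
  by rewrite [adj _ _ _]xy [adj _ _ _]zw.
Qed.

Lemma A4_cycle x u y z v w : uniq [:: x; u; y; z; v; w] ->
  {subset vset G <= [:: x; u; y; z; v; w]} -> cycle (adj G) [:: x; u; y; z; v; w] ->
  adj G x z -> adj G u v -> adj G y w -> conformal_minor A4 G.
Proof.
move=> us Vs cG xz uv yw; pose c := [:: x; u; y; z; v; w].
pose h i := nth x [:: x; y; v; u; z; w] i.
have hG : hamilton_cycle G c.
  rewrite /hamilton_cycle us cG andbT; apply/eqP/setP => t; rewrite inE.
  by apply/idP/idP => [tc|/Vs //]; have := next_cycle cG tc => /adj_vset.
apply: (@hamilton_spanning_minor _ _ h (fun=> [::]) _ _ hG) => //.
  by apply/permP => P; rewrite /track_verts /h /=; count_lia.
move: cG; rewrite /h /= ?andbT => /and5P[xu uy yz zv /andP[vw wx]].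
by rewrite ![adj _ x _ && _]andbC !xu !xz ![adj G _ u]adj_sym !uv uy yz yw vw
  [adj G x w]adj_sym wx [adj G v z]adj_sym zv.
Qed.

(** The theta graph joins [y] and [z]. One path is the segment between them, one goes back along
    [s1] to [x] and over the chord [xz], and one goes over the chord [yw] and back along [s3]. The
    segment [s4] is left over and matched along itself. *)
Lemma A1_cycle x y z w s1 s2 s3 s4 :
  hamilton_cycle G (x :: s1 ++ y :: s2 ++ z :: s3 ++ w :: s4) ->
  adj G x z -> adj G y w -> odd (size s1) -> ~~ odd (size s2) -> odd (size s3) ->
  ~~ odd (size s4) -> s2 != [::] -> conformal_minor A1 G.
Proof.
move=> hG xz yw o1 o2 o3 o4 n2; have := hamilton_path hG.
rewrite !path_rcons_cat => /and4P[p1 p2 p3 p4].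
have /and4P[_ uc /eqP Ec _] := hG.
have pp : perm_eq (x :: s1 ++ y :: s2 ++ z :: s3 ++ w :: s4)
    ((y :: z :: s2 ++ rcons (rev s1) x ++ w :: rev s3) ++ s4).
  apply/permP => P; rewrite -!cats1 /= ?count_cat /= ?count_cat /= ?count_cat /= ?count_cat.
  by rewrite /= !count_rev; count_lia.
have us := uc; rewrite (perm_uniq pp) cat_uniq in us.
have /and3P[us1 /hasPn us2 us4] := us.
apply: (@theta_A1 _ _ y z s2 (rcons (rev s1) x) (w :: rev s3)) => //.
- by rewrite size_rcons /= !size_rev o1 o3.
- by split=> //; case: (rev s1).
- rewrite p2 rcons_path -adj_path_rev p1 last_rcons [adj G x z]xz /=; split=> //.
  by rewrite [adj G y w]yw -adj_path_rev.
- have Vs v : v \in s4 -> v \notin [set t in y :: z :: s2 ++ rcons (rev s1) x ++ w :: rev s3].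
    by move=> /us2; rewrite [in X in _ -> X]in_set.
  have sE : pairs s4 \subset eset G.
    apply: subset_trans (pairs_path_edges _) _.
    case: (s4) p4 => [|b r]; rewrite ?path_edges0 ?sub0set // path_edges_path /=.
    by rewrite rcons_path => /and3P[].
  exists (pairs s4); apply: pairs_pm => //=.
    apply/subsetP => e e4; rewrite inE (subsetP sE _ e4) /=.
    by apply/pred0P => v /=; apply/negP => /andP[/(pairs_mem e4)/Vs/negPf->].
  apply/setP => v; rewrite in_setD -Ec !in_set (perm_mem pp) mem_cat.
  apply/andP/idP => [[/negPf->]//|vs]; rewrite vs orbT; split=> //.
  by have := Vs v vs; rewrite in_set.
Qed.

End CycleMinors.
(* Positions on a cycle of length N: [gap N a b k] says that k vertices lie
   strictly between positions a and b in the direction of traversal. *)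
Definition gap (N a b k : nat) : bool := (a + k.+1 == b) || (a + k.+1 == b + N).

Definition cyc3 (a b d : nat) : bool :=
  [|| (a < b) && (b < d), (b < d) && (d < a) | (d < a) && (a < b)].

Definition cyc4 (a b d e : nat) : bool :=
  [|| [&& a < b, b < d & d < e], [&& b < d, d < e & e < a],
      [&& d < e, e < a & a < b] | [&& e < a, a < b & b < d]].

(** In the applications [i] and [k] are even, hence of one colour. The disjuncts here and in
    [sc_pos] are the two directions of traversal; that the chords cross follows from the gaps by
    [cyc4_gaps]. *)
Definition par_pos (i j k l : nat) : bool := cyc4 i j k l || cyc4 i l k j.

Definition sc_pos (N i j k l : nat) : bool :=
  gap N k j 0 && gap N l i 0 || gap N j k 0 && gap N i l 0.

Lemma cyc3_total a b d : a != b -> b != d -> a != d -> cyc3 a b d || cyc3 a d b.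
Proof. rewrite /cyc3; case: (ltngtP a b); case: (ltngtP b d); case: (ltngtP a d); lia. Qed.

Ltac cyc4_cases a b d e := rewrite /cyc4;
  case: (ltngtP a b); case: (ltngtP a d); case: (ltngtP a e);
  case: (ltngtP b d); case: (ltngtP b e); case: (ltngtP d e) => //=; lia.

Lemma cyc4_total a b d e : a != b -> a != d -> a != e -> b != d -> b != e -> d != e ->
  [|| cyc4 a b d e, cyc4 a e d b, cyc4 a b e d, cyc4 b a d e, cyc4 a d b e | cyc4 a e b d].
Proof. cyc4_cases a b d e. Qed.

Lemma cyc4_rot a b d e : cyc4 a b d e = cyc4 b d e a.
Proof. rewrite /cyc4; apply/idP/idP; lia. Qed.

Lemma cyc4_asym a b d e : cyc4 a b d e ->
  [&& ~~ cyc4 a b e d, ~~ cyc4 b a d e, ~~ cyc4 a d b e & ~~ cyc4 a e b d].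
Proof. by cyc4_cases a b d e. Qed.

Lemma cyc4_move N a a' b d e : [&& a < N, a' < N, b < N, d < N & e < N] ->
  gap N a' a 0 -> a' != b -> a' != d -> a' != e -> cyc4 a b d e -> cyc4 a' b d e.
Proof.
move=> lt /orP[] /eqP E n1 n2 n3 /or4P[] /and3P[o1 o2 o3]; rewrite /cyc4; lia.
Qed.

Lemma cyc4_gap2 N a b d x y : [&& a < N, b < N, d < N, x < N & y < N] ->
  gap N a b 0 -> gap N b d 0 -> cyc4 a x d y -> x = b.
Proof.
by move=> lt /orP[] /eqP E1 /orP[] /eqP E2 /or4P[] /and3P[o1 o2 o3]; lia.
Qed.

Lemma gap0_inj N a b d : a < N -> b < N -> d < N -> gap N a d 0 -> gap N b d 0 -> a = b.
Proof. rewrite /gap; lia. Qed.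

Lemma par_pos_swap i j k l : par_pos j i l k = par_pos i j k l.
Proof. by rewrite /par_pos (cyc4_rot j i l k) -(cyc4_rot i j k l) orbC. Qed.

Lemma sc_pos_swap N i j k l : sc_pos N j i l k = sc_pos N i j k l.
Proof. by rewrite /sc_pos andbC [gap N i l 0 && _]andbC. Qed.

(** As [k], [j] and [l], [i] are consecutive, a chord parallel to [ij] lies beside [kl] with the
    wrong orientation, so it is not parallel to both. Parallel to one and strongly crossed with the
    other would put two distinct ends at one position. If it is strongly crossed with both, the six
    ends follow one another in the order l, i, q, k, j, p. *)
Lemma sc_pos_third_fwd N i j k l p q :
  [&& i < N, j < N, k < N, l < N, p < N & q < N] -> uniq [:: i; j; k; l; p; q] ->
  gap N k j 0 -> gap N l i 0 -> par_pos i j p q || sc_pos N i j p q ->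
  par_pos k l p q || sc_pos N k l p q ->
  [&& gap N l i 0, gap N i q 0, gap N q k 0, gap N k j 0, gap N j p 0 & gap N p l 0].
Proof.
case/and5P => iN jN kN lN /andP[pN qN].
rewrite /= !inE !negb_or => /and5P[/and5P[ij ik il ip iq] /and4P[jk jl jp jq]
  /and3P[kl kp kq] /andP[lp lq] /andP[pq _]] kj li.
have -> : sc_pos N i j p q = gap N j p 0 && gap N i q 0.
  rewrite /sc_pos; case E: (gap N p j 0); last by [].
  by rewrite (gap0_inj pN kN jN E kj) eqxx in kp.
have -> : sc_pos N k l p q = gap N p l 0 && gap N q k 0.
  rewrite /sc_pos; case E: (gap N l p 0); last by rewrite orbF.
  by move: li E ip; rewrite /gap; clear -iN lN pN; lia.
have lt4 a b d e f : a < N -> b < N -> d < N -> e < N -> f < N ->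
  [&& a < N, b < N, d < N, e < N & f < N] by move=> -> -> -> -> ->.
case/orP => [r1|/andP[g1 g2]]; case/orP => [r2|/andP[g3 g4]].
- have : cyc4 l k p q || cyc4 l q p k.
    case/orP: r1 => r1; apply/orP; [left|right].
      have := cyc4_move (lt4 _ _ _ _ _ iN lN jN pN qN) li.
      rewrite [l == j]eq_sym jl lp lq => /(_ isT isT isT r1); rewrite (cyc4_rot l k) (cyc4_rot l j).
      by apply: (cyc4_move (lt4 _ _ _ _ _ jN kN pN qN lN) kj).
    have := cyc4_move (lt4 _ _ _ _ _ iN lN qN pN jN) li.
    rewrite [l == j]eq_sym jl lp lq => /(_ isT isT isT r1).
    rewrite -(cyc4_rot k) -(cyc4_rot j).
    by apply: (cyc4_move (lt4 _ _ _ _ _ jN kN lN qN pN) kj).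
  case/orP => /cyc4_asym/and4P[n1 n2 n3 n4]; case/orP: r2 => r2.
  + by rewrite r2 in n2.
  + by rewrite (cyc4_rot l k q p) r2 in n1.
  + by rewrite (cyc4_rot k l p q) in r2; rewrite r2 in n3.
  + by rewrite (cyc4_rot l k q p) r2 in n4.
- case/orP: r1 => r1.
    rewrite (cyc4_rot i j p q) (cyc4_rot j p q i) in r1.
    by rewrite (cyc4_gap2 (lt4 _ _ _ _ _ pN lN iN qN jN) g3 li r1) eqxx in lq.
  rewrite (cyc4_rot i q p j) (cyc4_rot q p j i) in r1.
  by rewrite (cyc4_gap2 (lt4 _ _ _ _ _ pN lN iN jN qN) g3 li r1) eqxx in jl.
- case/orP: r2 => r2.
    by rewrite (cyc4_gap2 (lt4 _ _ _ _ _ kN jN pN lN qN) kj g1 r2) eqxx in jl.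
  by rewrite (cyc4_gap2 (lt4 _ _ _ _ _ kN jN pN qN lN) kj g1 r2) eqxx in jq.
- by rewrite li g2 g4 kj g1 g3.
Qed.

(* Exchanging the two colours exchanges the two directions in [sc_pos]. *)
Lemma sc_pos_third N i j k l p q :
  [&& i < N, j < N, k < N, l < N, p < N & q < N] -> uniq [:: i; j; k; l; p; q] ->
  sc_pos N i j k l -> par_pos i j p q || sc_pos N i j p q ->
  par_pos k l p q || sc_pos N k l p q ->
  [&& gap N l i 0, gap N i q 0, gap N q k 0, gap N k j 0, gap N j p 0 & gap N p l 0] ||
  [&& gap N i l 0, gap N l p 0, gap N p j 0, gap N j k 0, gap N k q 0 & gap N q i 0].
Proof.
move=> lt us /orP[/andP[g1 g2]|/andP[g1 g2]] r1 r2.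
  by rewrite (sc_pos_third_fwd lt us g1 g2 r1 r2).
rewrite -par_pos_swap -sc_pos_swap in r1; rewrite -par_pos_swap -sc_pos_swap in r2.
rewrite orbC (@sc_pos_third_fwd N l k j i q p) //.
- by case/and5P: lt => -> -> -> -> /andP[-> ->].
- rewrite (_ : uniq _ = uniq [:: i; j; k; l; p; q]) //; apply: perm_uniq.
  by apply/permP => P /=; count_lia.
Qed.

Lemma cyc4_gaps N i j k l : i < N -> j < N -> k < N -> l < N ->
  gap N k j 0 -> gap N l i 0 -> i != k -> j != l -> i != j -> k != l -> cyc4 i k j l.
Proof.
move=> iN jN kN lN /orP[] /eqP E1 /orP[] /eqP E2 *; rewrite /cyc4; lia.
Qed.

Lemma six_gaps N a b d e f g : a < N -> b < N -> d < N -> e < N -> f < N -> g < N ->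
  gap N a b 0 -> gap N b d 0 -> gap N d e 0 -> gap N e f 0 -> gap N f g 0 -> gap N g a 0 ->
  uniq [:: a; b; d; e; f; g] -> N = 6.
Proof.
move=> aN bN dN eN fN gN g1 g2 g3 g4 g5 g6 /=; rewrite !inE !negb_or.
case/and5P=> [/and5P[_ ad ae _ _] /and4P[_ be _ _] _ _ _].
move: g1 g2 g3 g4 g5 g6; rewrite /gap => /orP[] /eqP ? /orP[] /eqP ? /orP[] /eqP ?
  /orP[] /eqP ? /orP[] /eqP ? /orP[] /eqP ?; lia.
Qed.

Lemma neq_parity a b : odd a -> ~~ odd b -> (a != b) * (b != a).
Proof.
move=> oa ob; have ab : a != b by apply: contraNneq ob => <-.
by rewrite [b == a]eq_sym ab.
Qed.

(** * Cutting a cycle at given positions *)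

Section Cut.
Variables (T : finType) (x0 : T).
Implicit Types (s c : seq T) (i j : nat).

Definition cut s i j := take (j - i.+1) (drop i.+1 s).

Lemma drop_cut s i j : i < j -> j <= size s -> drop i s = nth x0 s i :: cut s i j ++ drop j s.
Proof.
move=> ij js; rewrite (drop_nth x0) ?(leq_trans ij) //; congr (_ :: _).
by rewrite -{1}[drop i.+1 s](cat_take_drop (j - i.+1)) drop_drop subnK.
Qed.

Lemma size_cut s i j : i < j -> j <= size s -> size (cut s i j) = j - i.+1.
Proof. by move=> ij js; rewrite size_takel // size_drop leq_sub2r. Qed.

Definition shift N a t := if a <= t then t - a else t + N - a.

Lemma shiftE N a t :
  (a <= t) && (shift N a t == t - a) || (t < a) && (shift N a t == t + N - a).
Proof. by rewrite /shift; case: leqP => _; rewrite eqxx. Qed.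

Lemma nth_rot_shift c a t : a < size c -> t < size c ->
  nth x0 (rot a c) (shift (size c) a t) = nth x0 c t.
Proof.
move=> ac tc; rewrite /rot nth_cat size_drop /shift; case: (leqP a t) => at_.
  by rewrite ifT; [rewrite nth_drop subnKC | lia].
rewrite ifN; last by rewrite -leqNgt; lia.
by rewrite nth_take; [congr nth|]; lia.
Qed.

Lemma rot_split3 c a b d : a < size c -> b < size c -> d < size c -> cyc3 a b d ->
  exists s1 s2 s3, rot a c = nth x0 c a :: s1 ++ nth x0 c b :: s2 ++ nth x0 c d :: s3 /\
    [/\ gap (size c) a b (size s1), gap (size c) b d (size s2) & gap (size c) d a (size s3)].
Proof.
move=> ac bc dc abd; have szr := size_rot a c; set N := size c in szr ac bc dc *.
have := (shiftE N a a, shiftE N a b, shiftE N a d); case=> -[Sa Sb] Sd.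
have [a0 ab bd dN] : [/\ shift N a a = 0, shift N a a < shift N a b,
    shift N a b < shift N a d & shift N a d < N].
  by move: abd; rewrite /cyc3 => abd; clearbody N; split; lia.
exists (cut (rot a c) (shift N a a) (shift N a b)), (cut (rot a c) (shift N a b) (shift N a d)),
  (cut (rot a c) (shift N a d) N).
split.
  rewrite -[LHS](drop0) -a0 (drop_cut ab) ?szr 1?ltnW ?(ltn_trans bd) // nth_rot_shift //.
  rewrite (drop_cut bd) ?szr 1?ltnW // nth_rot_shift //.
  by rewrite (drop_cut dN) ?szr // nth_rot_shift // -szr drop_size cats0.
rewrite !size_cut ?szr // 1?ltnW ?(ltn_trans bd) // /gap.
by clearbody N; split; lia.
Qed.

Lemma rot_split4 c a b d e :
  a < size c -> b < size c -> d < size c -> e < size c -> cyc4 a b d e ->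
  exists s1 s2 s3 s4, rot a c = nth x0 c a :: s1 ++ nth x0 c b :: s2 ++ nth x0 c d :: s3
    ++ nth x0 c e :: s4 /\
    [/\ gap (size c) a b (size s1), gap (size c) b d (size s2), gap (size c) d e (size s3)
      & gap (size c) e a (size s4)].
Proof.
move=> ac bc dc ec abd; have szr := size_rot a c; set N := size c in szr ac bc dc ec *.
have := (shiftE N a a, shiftE N a b, shiftE N a d, shiftE N a e); case=> -[[Sa Sb] Sd] Se.
have [a0 ab bd [de eN]] : [/\ shift N a a = 0, shift N a a < shift N a b,
    shift N a b < shift N a d & shift N a d < shift N a e /\ shift N a e < N].
  by move: abd; rewrite /cyc4 => abd; clearbody N; do !split; lia.
exists (cut (rot a c) (shift N a a) (shift N a b)), (cut (rot a c) (shift N a b) (shift N a d)),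
  (cut (rot a c) (shift N a d) (shift N a e)), (cut (rot a c) (shift N a e) N).
have dN := ltn_trans de eN; have bN := ltn_trans bd dN.
split.
  rewrite -[LHS](drop0) -a0 (drop_cut ab) ?szr 1?ltnW // nth_rot_shift //.
  rewrite (drop_cut bd) ?szr 1?ltnW // nth_rot_shift //.
  rewrite (drop_cut de) ?szr 1?ltnW // nth_rot_shift //.
  by rewrite (drop_cut eN) ?szr // nth_rot_shift // -szr drop_size cats0.
rewrite !size_cut ?szr // 1?ltnW // /gap.
by clearbody N; split; lia.
Qed.

End Cut.

(** * Chords in terms of positions on the cycle *)

Section Positions.
Variables (T : finType) (G : graph T) (c : seq T) (x0 : T) (B : {set T}).
Hypotheses (hc : hamilton_cycle G c) (colB : proper_coloring B (eset G)).
Local Notation N := (size c).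
Local Notation X i := (nth x0 c i).

Let uc : uniq c. Proof. by case/and4P: hc. Qed.
Let cE : cycle_edges c \subset eset G.
Proof. by case/and4P: hc => _ _ _; apply: cycle_edges_adj. Qed.
Let N2 : 2 < N. Proof. by case/and4P: hc. Qed.

Lemma gap0_cycle_edge a b : a < N -> b < N -> gap N a b 0 -> [set X a; X b] \in cycle_edges c.
Proof.
move=> aN bN ab; apply/(cycle_edgesP x0 _ uc); exists a => //; congr [set _; nth _ _ _].
move: ab; rewrite /gap !addn1 => /orP[] /eqP E; rewrite E; first by rewrite modn_small.
by rewrite addnC modnDl modn_small.
Qed.

(** Any proper colouring of the cycle, whether or not it is [B], is the parity of positions up to
    exchange of the colours; this turns colour conditions into parity conditions. *)
Lemma hamilton_color F i : proper_coloring F (cycle_edges c) -> i < N ->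
  (X i \in F) = (X 0 \in F) (+) odd i.
Proof.
move=> colF; elim: i => [|i IH] iN; first by rewrite addbF.
have := colF _ _ (gap0_cycle_edge (ltnW iN) iN _); rewrite /gap addn1 eqxx => /(_ isT).
by rewrite IH 1?ltnW //=; case: (X 0 \in F); case: (X i.+1 \in F); case: odd.
Qed.

Lemma proper_coloring_sub F : proper_coloring F (eset G) -> proper_coloring F (cycle_edges c).
Proof. by move=> colF x y /(subsetP cE)/colF. Qed.

Lemma hamilton_even : ~~ odd N.
Proof.
have colc := proper_coloring_sub colB.
have [n1 n2] : N.-1 < N /\ 0 < N by lia.
have := colc _ _ (gap0_cycle_edge n1 n2 _); rewrite (hamilton_color colc n1) /gap => /(_ _).
rewrite (_ : _ || _); last by lia.
by move=> /(_ isT); rewrite -[in Z in _ -> ~~ odd Z](prednK n2) /= negbK; case: (X 0 \in B); case: odd.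
Qed.

Lemma nth_vset i : i < N -> X i \in vset G.
Proof. by case/and4P: hc => _ _ /eqP <- _ iN; rewrite inE mem_nth. Qed.

Lemma edge_positions e : e \in eset G ->
  exists i j, [/\ i < N /\ j < N, ~~ odd i, odd j & e = [set X i; X j]].
Proof.
move=> eG; have [x [y [xy Ee xV yV]]] := eset2P eG.
have P z : z \in vset G -> exists2 i, i < N & z = X i.
  case/and4P: hc => _ _ /eqP <- _; rewrite inE => zc.
  by exists (index z c); rewrite ?index_mem ?nth_index.
have [i iN Ei] := P x xV; have [j jN Ej] := P y yV.
have colc := proper_coloring_sub colB.
have /colB : [set x; y] \in eset G by rewrite -Ee.
rewrite Ei Ej (hamilton_color colc iN) (hamilton_color colc jN).
case oi: (odd i); case oj: (odd j); rewrite ?eqxx // => _.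
  by exists j, i; rewrite oi oj setUC Ee Ei Ej.
by exists i, j; rewrite oi oj Ee Ei Ej.
Qed.

Lemma nth_eq i j : i < N -> j < N -> (X i == X j) = (i == j).
Proof. by move=> iN jN; rewrite nth_uniq. Qed.

Lemma subseq_cat_cons (x : T) (s1 s2 r : seq T) : subseq r s2 -> subseq (x :: r) (s1 ++ x :: s2).
Proof.
move=> rs; apply: (@subseq_trans _ (x :: s2)); first by rewrite /= eqxx.
exact: suffix_subseq.
Qed.

Lemma cyc4_order a b d e : a < N -> b < N -> d < N -> e < N -> cyc4 a b d e ->
  cyclic_order c [:: X a; X b; X d; X e].
Proof.
move=> aN bN dN eN /(rot_split4 x0 aN bN dN eN)[s1 [s2 [s3 [s4 [E _]]]]].
exists a; left; rewrite E [subseq _ _]/= eqxx.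
by do 3 apply: subseq_cat_cons; apply: sub0seq.
Qed.

Lemma cyc4_order_rev a b d e : a < N -> b < N -> d < N -> e < N -> cyc4 a b d e ->
  cyclic_order c [:: X e; X d; X b; X a].
Proof.
move=> aN bN dN eN /(rot_split4 x0 aN bN dN eN)[s1 [s2 [s3 [s4 [E _]]]]].
exists (size (rev c) - a); right; rewrite -/(rotr a (rev c)) -rev_rot E.
rewrite -[[:: _; _; _; _]]/(rev [:: X a; X b; X d; X e]) subseq_rev [subseq _ _]/= eqxx.
by do 3 apply: subseq_cat_cons; apply: sub0seq.
Qed.

Lemma labelled_positions i j k l : i < N -> j < N -> k < N -> l < N ->
  ~~ odd i -> odd j -> ~~ odd k -> odd l -> i != k -> j != l ->
  labelled_chords c [set X i; X j] [set X k; X l] (X i) (X j) (X k) (X l).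
Proof.
move=> iN jN kN lN oi oj ok ol ik jl; have colc := proper_coloring_sub colB; split=> //.
  apply/pred0P => z /=; apply/negP => /andP[/set2P[]-> /set2P[] /eqP];
  by rewrite nth_eq //; lia.
exists B => //; rewrite (hamilton_color colc iN) (hamilton_color colc jN).
rewrite (hamilton_color colc kN) (hamilton_color colc lN) (negPf oi) oj (negPf ok) ol.
by rewrite addbF addbT; split=> //; case: (_ \in B).
Qed.

Lemma par_positions i j k l : i < N -> j < N -> k < N -> l < N ->
  ~~ odd i -> odd j -> ~~ odd k -> odd l -> par_pos i j k l ->
  parallel c [set X i; X j] [set X k; X l].
Proof.
move=> iN jN kN lN oi oj ok ol par; exists (X i), (X j), (X k), (X l); split.
  by apply: labelled_positions => //; move: par; rewrite /par_pos /cyc4; lia.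
case/orP: par => p; first exact: cyc4_order.
by apply: cyc4_order_rev => //; move: p; rewrite /cyc4; lia.
Qed.

Lemma sc_positions i j k l : i < N -> j < N -> k < N -> l < N ->
  ~~ odd i -> odd j -> ~~ odd k -> odd l -> i != k -> j != l -> sc_pos N i j k l ->
  strongly_crossed c [set X i; X j] [set X k; X l].
Proof.
move=> iN jN kN lN oi oj ok ol ik jl sc; exists (X i), (X j), (X k), (X l).
have [E1 E2] : [set X i; X l] \in cycle_edges c /\ [set X j; X k] \in cycle_edges c.
  case/orP: sc => /andP[g1 g2]; last by rewrite !gap0_cycle_edge.
  by rewrite [[set X i; _]]setUC [[set X j; _]]setUC !gap0_cycle_edge.
split=> //; first exact: labelled_positions.
have := (neq_parity oj oi, neq_parity oj ok, neq_parity ol oi, neq_parity ol ok).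
case=> -[[D1 D2] D3] D4; case/orP: sc => /andP[g1 g2].
  by apply: cyc4_order => //; apply: (cyc4_gaps (N := N)); rewrite ?D1 ?D4.
apply: cyc4_order_rev => //; apply: (cyc4_gaps (N := N)); rewrite ?D1 ?D4 //.
  by rewrite eq_sym.
by rewrite eq_sym.
Qed.

Definition chord_pos i j : Prop :=
  [/\ i < N /\ j < N, ~~ odd i, odd j & [set X i; X j] \in chords G c].

Lemma chord_positions e : e \in chords G c -> exists i j, chord_pos i j /\ e = [set X i; X j].
Proof.
move=> eD; have /setDP[eG _] := eD; have [i [j [ij oi oj E]]] := edge_positions eG.
by exists i, j; split=> //; split=> //; rewrite -E.
Qed.

Lemma chord_adj i j : chord_pos i j -> adj G (X i) (X j).
Proof. by case=> _ _ _ /setDP[]. Qed.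

Lemma chord_gap i j : chord_pos i j -> ~~ gap N i j 0 /\ ~~ gap N j i 0.
Proof.
move=> [[iN jN] _ _ /setDP[_ nE]]; split; apply: contra nE => g; first exact: gap0_cycle_edge.
by rewrite setUC gap0_cycle_edge.
Qed.

(** A chord is not an edge of the cycle, which gives the nonempty segments that A2 and A3 need. For
    crossed chords the A1 construction is applied to each of two opposite even segments, so both
    must be empty. *)
Lemma chord_pair i j k l : chord_pos i j -> chord_pos k l -> (i, j) != (k, l) ->
  ~ conformal_minor A1 G -> ~ conformal_minor A2 G -> ~ conformal_minor A3 G ->
  [/\ i != k, j != l & par_pos i j k l || sc_pos N i j k l].
Proof.
move=> ij kl D nA1 nA2 nA3; have eN := hamilton_even.
have [[iN jN] oi oj _] := ij; have [[kN lN] ok ol _] := kl.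
have aij := chord_adj ij; have akl := chord_adj kl.
have aji : adj G (X j) (X i) by rewrite adj_sym.
have alk : adj G (X l) (X k) by rewrite adj_sym.
have [gij gji] := chord_gap ij; have [gkl glk] := chord_gap kl.
have A2x a b d : a < N -> b < N -> d < N -> cyc3 a b d -> adj G (X a) (X b) ->
    adj G (X a) (X d) -> odd a != odd b -> odd b = odd d -> ~~ gap N a b 0 -> ~~ gap N d a 0 ->
    False.
  move=> aN bN dN /(rot_split3 x0 aN bN dN)[s1 [s2 [s3 [E [g1 g2 g3]]]]] ab ad oab obd n1 n3.
  apply: nA2; have := hc; rewrite -(hamilton_rot _ a) E => h.
  have s1n : s1 != [::] by apply: contraNneq n1 => s0; rewrite s0 in g1.
  have s3n : s3 != [::] by apply: contraNneq n3 => s0; rewrite s0 in g3.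
  apply: (A2_cycle h) => //; move: g1 g2 g3; rewrite /gap; clear -eN oab obd; lia.
have A3x a b d e : a < N -> b < N -> d < N -> e < N -> cyc4 a b d e -> adj G (X a) (X b) ->
    adj G (X d) (X e) -> odd a != odd b -> odd b = odd d -> odd d != odd e ->
    ~~ gap N a b 0 -> ~~ gap N d e 0 -> False.
  move=> aN bN dN eeN /(rot_split4 x0 aN bN dN eeN)[s1 [s2 [s3 [s4 [E [g1 g2 g3 g4]]]]]].
  move=> ab ad oab obd ode n1 n3.
  apply: nA3; have := hc; rewrite -(hamilton_rot _ a) E => h.
  have s1n : s1 != [::] by apply: contraNneq n1 => s0; rewrite s0 in g1.
  have s3n : s3 != [::] by apply: contraNneq n3 => s0; rewrite s0 in g3.
  apply: (A3_cycle h) => //; move: g1 g2 g3 g4; rewrite /gap; clear -eN oab obd ode; lia.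
have A1x a b d e : a < N -> b < N -> d < N -> e < N -> cyc4 a b d e -> adj G (X a) (X d) ->
    adj G (X b) (X e) -> odd a = odd b -> odd b != odd d -> odd d = odd e ->
    gap N b d 0.
  move=> aN bN dN eeN /(rot_split4 x0 aN bN dN eeN)[s1 [s2 [s3 [s4 [E [g1 g2 g3 g4]]]]]].
  move=> ab ad oab obd ode; apply: contraT => n2.
  case: nA1; have := hc; rewrite -(hamilton_rot _ a) E => h.
  have s2n : s2 != [::] by apply: contraNneq n2 => s0; rewrite s0 in g2.
  apply: (A1_cycle h) => //; move: g1 g2 g3 g4; rewrite /gap; clear -eN oab obd ode; lia.
have ik : i != k.
  apply: contraNneq D => ik; rewrite -ik in kl ok kN akl gkl glk alk *.
  rewrite xpair_eqE eqxx /=; apply: contraT => jl.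
  have : cyc3 i j l || cyc3 i l j.
    by apply: cyc3_total => //; rewrite (neq_parity _ oi).
  by case/orP => /A2x []; rewrite ?(negPf oi) ?oj ?ol.
have jl : j != l.
  apply: contraNneq D => jl; rewrite -jl in kl ol lN akl gkl glk alk *.
  have : cyc3 j i k || cyc3 j k i.
    by apply: cyc3_total => //; rewrite (neq_parity oj).
  by case/orP => /A2x []; rewrite ?(negPf oi) ?(negPf ok) ?oj.
split=> //; have := @cyc4_total i j k l.
rewrite ik jl (neq_parity oj oi) (neq_parity oj ok) (neq_parity ol oi) (neq_parity ol ok).
move=> /(_ isT isT isT isT isT isT).
case/or4P => [p|p|p|]; try by rewrite /par_pos p ?orbT.
  by case: (A3x _ _ _ _ iN jN lN kN p); rewrite ?(negPf oi) ?(negPf ok) ?oj ?ol.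
case/or3P => p.
- by case: (A3x _ _ _ _ jN iN kN lN p); rewrite ?(negPf oi) ?(negPf ok) ?oj ?ol.
- apply/orP; right; apply/orP; left; apply/andP; split.
    by apply: (A1x i k j l) => //; rewrite ?(negPf oi) ?(negPf ok) ?oj ?ol.
  apply: (A1x j l i k) => //; rewrite ?(negPf oi) ?(negPf ok) ?oj ?ol //.
  by rewrite -(cyc4_rot k j l i) -(cyc4_rot i k j l).
- apply/orP; right; apply/orP; right; apply/andP; split.
    apply: (A1x l j k i) => //; rewrite ?(negPf oi) ?(negPf ok) ?oj ?ol //.
    by rewrite -(cyc4_rot i l j k).
  apply: (A1x k i l j) => //; rewrite ?(negPf oi) ?(negPf ok) ?oj ?ol //.
  by rewrite (cyc4_rot k i l j).
Qed.

Lemma chord_triple i j k l p q : chord_pos i j -> chord_pos k l -> chord_pos p q ->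
  (i, j) != (k, l) -> (i, j) != (p, q) -> (k, l) != (p, q) -> sc_pos N i j k l ->
  ~ conformal_minor A1 G -> ~ conformal_minor A2 G -> ~ conformal_minor A3 G ->
  conformal_minor A4 G.
Proof.
move=> ij kl pq D1 D2 D3 sc nA1 nA2 nA3; have eN := hamilton_even.
have [ik jl _] := chord_pair ij kl D1 nA1 nA2 nA3.
have [ip jq r1] := chord_pair ij pq D2 nA1 nA2 nA3.
have [kp lq r2] := chord_pair kl pq D3 nA1 nA2 nA3.
have aij := chord_adj ij; have akl := chord_adj kl; have apq := chord_adj pq.
have [[iN jN] oi oj _] := ij; have [[kN lN] ok ol _] := kl; have [[pN qN] op oq _] := pq.
have A4x a b d e f g : a < N -> b < N -> d < N -> e < N -> f < N -> g < N ->
    gap N a b 0 -> gap N b d 0 -> gap N d e 0 -> gap N e f 0 -> gap N f g 0 -> gap N g a 0 ->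
    uniq [:: a; b; d; e; f; g] ->
    adj G (X a) (X e) -> adj G (X b) (X f) -> adj G (X d) (X g) -> conformal_minor A4 G.
  move=> aN bN dN eeN fN gN g1 g2 g3 g4 g5 g6 us ae bf dg.
  have N6 : N = 6.
    exact: (six_gaps aN bN dN eeN fN gN g1 g2 g3 g4 g5 g6 us).
  have uX : uniq [:: X a; X b; X d; X e; X f; X g].
    by move: us; rewrite /= !inE !nth_eq.
  have adjX s t : s < N -> t < N -> gap N s t 0 -> adj G (X s) (X t).
    by move=> sN tN st; apply: (subsetP cE); apply: gap0_cycle_edge.
  apply: (A4_cycle uX); rewrite // ?[cycle _ _]/= ?adjX //.
  have [||_ E] := uniq_min_size uX (s2 := c).
  - by move=> x; rewrite !inE => /or4P[|||/or3P[]] /eqP->; apply: mem_nth.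
  - by rewrite N6.
  - by move=> x; case/and4P: hc => _ _ /eqP <- _; rewrite inE E.
have lt6 : [&& i < N, j < N, k < N, l < N, p < N & q < N].
  by rewrite iN jN kN lN pN qN.
have us : uniq [:: i; j; k; l; p; q].
  rewrite /= !inE !negb_or ik ip jl jq kp lq.
  rewrite (neq_parity oj oi) (neq_parity oj ok) (neq_parity oj op) (neq_parity ol oi).
  by rewrite (neq_parity ol ok) (neq_parity ol op) (neq_parity oq oi) (neq_parity oq ok) (neq_parity oq op).
case/orP: (sc_pos_third lt6 us sc r1 r2) => /and5P[g1 g2 g3 g4 /andP[g5 g6]].
- apply: (A4x i q k j p l) => //; last by rewrite adj_sym.
  by rewrite (perm_uniq (_ : perm_eq _ [:: i; j; k; l; p; q])) //; apply/permP => P /=; count_lia.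
- apply: (A4x i l p j k q) => //; last by rewrite adj_sym.
  by rewrite (perm_uniq (_ : perm_eq _ [:: i; j; k; l; p; q])) //; apply/permP => P /=; count_lia.
Qed.

End Positions.

Lemma no_minors_classes (T : finType) (G : graph T) :
  matching_covered G -> bipartite G -> 4 <= #|vset G| ->
  [/\ ~ conformal_minor A1 G, ~ conformal_minor A2 G,
      ~ conformal_minor A3 G & ~ conformal_minor A4 G] ->
  [\/ B0 G, B1 G, B2 G | B3 G].
Proof.
move=> mcG bG V4 [nA1 nA2 nA3 nA4]; have [B colB] := bG.
have [c hc] := hamilton_or_A1 mcG bG V4 nA1.
have [x0 _] : exists x0 : T, True by case: (c) hc => // x l; exists x.
pose N := size c; pose X i := nth x0 c i.
pose cpos i j := [&& ~~ odd i, odd j & [set X i; X j] \in chords G c].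
have cposP (i j : 'I_N) : cpos i j -> chord_pos G c x0 i j by case/and3P; split.
have eN := hamilton_even x0 hc colB.
case E: [exists i : 'I_N, [exists j : 'I_N, [exists k : 'I_N, [exists l : 'I_N,
  [&& cpos i j, cpos k l, (val i, val j) != (val k, val l) & sc_pos N i j k l]]]]].
  case/existsP: E => i /existsP[j /existsP[k /existsP[l /and4P[ij kl D sc]]]].
  have Cij := cposP _ _ ij; have Ckl := cposP _ _ kl.
  have [ik jl _] := chord_pair hc colB Cij Ckl D nA1 nA2 nA3.
  have [[iN jN] oi oj ijD] := Cij; have [[kN lN] ok ol klD] := Ckl.
  constructor 3; exists c => //; split=> //; exists [set X i; X j], [set X k; X l].
  have sets p q p' q' : p < N -> q < N -> p' < N -> q' < N -> ~~ odd p -> odd q -> ~~ odd p' ->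
      odd q' -> [set X p; X q] = [set X p'; X q'] -> (p, q) = (p', q').
    move=> pN qN p'N q'N op oq op' oq' /eq_set2[][/eqP+ /eqP+].
      by rewrite !(nth_eq x0 hc) // => /eqP-> /eqP->.
    by rewrite !(nth_eq x0 hc) // (negPf (neq_parity oq' op).2).
  split.
  - by apply: contraNneq D => /sets ->.
  - apply/eqP; rewrite eqEsubset; apply/andP; split; last first.
      by apply/subsetP => g /set2P[]->.
    apply/subsetP => g gD; have [p [q [Cpq Eg]]] := chord_positions x0 hc colB gD.
    apply: contraT => ng; case: nA4.
    have [[pN qN] op oq _] := Cpq.
    apply: (chord_triple hc colB Cij Ckl Cpq) => //.
      by apply: contraNneq ng => -[Ep Eq]; rewrite Eg -Ep -Eq !inE eqxx.
    by apply: contraNneq ng => -[Ep Eq]; rewrite Eg -Ep -Eq !inE eqxx orbT.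
  - by apply: (@sc_positions _ _ _ x0 _ hc colB).
(* B0 and B1 do not arise separately: for fewer than two chords the condition of B3 is vacuous. *)
constructor 4; split=> //; exists c => // e f eD fD ef.
have [i [j [Cij Ee]]] := chord_positions x0 hc colB eD.
have [k [l [Ckl Ef]]] := chord_positions x0 hc colB fD.
have D : (i, j) != (k, l) by apply: contraNneq ef => -[E1 E2]; rewrite Ee Ef E1 E2.
have [ik jl] := chord_pair hc colB Cij Ckl D nA1 nA2 nA3.
have [[iN jN] oi oj ijD] := Cij; have [[kN lN] ok ol klD] := Ckl.
case/orP => [par|sc]; first by rewrite Ee Ef; apply: (@par_positions _ _ _ x0 _ hc colB).
move: E; rewrite (_ : [exists i, _]) //; apply/existsP; exists (Ordinal iN).
apply/existsP; exists (Ordinal jN); apply/existsP; exists (Ordinal kN).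
apply/existsP; exists (Ordinal lN); rewrite /cpos /= oi oj ok ol D sc.
by rewrite [_ \in _]ijD [_ \in _]klD.
Qed.

(** * Forcing numbers in the classes B2 and B3 *)

Section Families.
Variable T : finType.
Implicit Types (G H : graph T) (M S F : {set {set T}}) (P : {set {set {set T}}}).

(* [uniform (pms G)] is the equality gf(G) = Af(G), with common value k. *)
Definition uniform P : Prop := exists k,
  [/\ exists2 S, separates P S & #|S| <= k, forall S, separates P S -> k <= #|S|,
      forall M, M \in P -> exists2 S, blocks P M S & #|S| <= k
    & exists2 M, M \in P & forall S, blocks P M S -> k <= #|S|].

Definition pms_in G F : {set {set {set T}}} := [set M in pms G | M \subset F].

(** The traces [S :&: M] are distinct subsets of S. *)
Lemma separates_card P S : separates P S -> #|P| <= 2 ^ #|S|.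
Proof.
move=> sepS; rewrite -card_powerset -(card_in_imset sepS); apply: subset_leq_card.
by apply/subsetP => _ /imsetP[M _ ->]; rewrite inE subsetIl.
Qed.

(** S avoids M but meets every [f i], so it has an element in each of the disjoint differences, and
    these elements are distinct. *)
Lemma blocks_card (I : finType) (D : {set I}) (f : I -> {set {set T}}) P M S :
  blocks P M S -> {in D, forall i, f i \in P /\ f i != M} ->
  {in D &, forall i j, i != j -> [disjoint f i :\: M & f j :\: M]} -> #|D| <= #|S|.
Proof.
move=> [dS bS] fP fD; pose g i := odflt set0 [pick e in S :&: f i].
have gP i : i \in D -> g i \in S /\ g i \in f i :\: M.
  move=> iD; have [fiP fiM] := fP i iD; rewrite /g; case: pickP => [e|E] /=.
    rewrite !inE => /andP[eS ->]; rewrite eS andbT; split=> //.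
    by apply/negP => eM; have/pred0P/(_ e) := dS; rewrite /= eS eM.
  have /negP[] := bS _ fiP fiM; apply/pred0P => e.
  by have := E e; rewrite !inE.
have gI : {in D &, injective g}.
  move=> i j iD jD E; apply/eqP; apply: contraT => /(fD i j iD jD)/pred0P/(_ (g i)) /=.
  by rewrite {2}E (gP i iD).2 (gP j jD).2.
rewrite -(card_in_imset gI); apply: subset_leq_card.
by apply/subsetP => _ /imsetP[i iD ->]; case: (gP i iD).
Qed.

Lemma uniform1 P M : P = [set M] -> uniform P.
Proof.
move=> EP; exists 0; split=> //; last by exists M; rewrite ?EP ?set11.
- exists set0; rewrite ?cards0 // EP => M1 M2.
  by rewrite !inE => /eqP-> /eqP->.
- move=> M'; rewrite EP inE => /eqP->; exists set0; rewrite ?cards0 //.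
  split; first by rewrite disjoints_subset sub0set.
  by move=> M''; rewrite inE => ->.
Qed.

(** Sets that separate or block the family serve for H unchanged. Conversely, sets for H are cut
    down to [eset H], since a set that blocks a member of the family has to avoid N. *)
Lemma conformal_uniform G H : conformal H G -> matchable H ->
  (forall F, pms_in G F != set0 -> uniform (pms_in G F)) -> gf H = Af H.
Proof.
move=> [/andP[sV sE] [N PN]] [M0 PM0] unif.
have /pmP[NE cN uN] := PN.
have NH v e : e \in N -> v \in e -> v \in vset H -> False.
  move=> eN ve vH; have := subsetP NE e eN; rewrite inE => /andP[_ /pred0P/(_ v)].
  by rewrite /= ve vH.
have NG : N \subset eset G.
  by apply: subset_trans NE _; apply/subsetP => e; rewrite inE => /andP[].
have NE0 e : e \in N -> e \notin eset H.
  move=> eN; apply/negP => eH; have [x [y [_ Ee xV _]]] := eset2P eH.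
  by apply: (NH x e eN) => //; rewrite Ee set21.
pose F := eset H :|: N; pose P := pms_in G F.
have toP M : M \in pms H -> M :|: N \in P.
  rewrite !inE => /pmP[ME cM uM]; rewrite setSU // andbT; apply/pmP; split.
  - by rewrite subUset NG (subset_trans ME).
  - move=> v vG; case vH: (v \in vset H).
      by have [e eM ve] := cM v vH; exists e; rewrite // inE eM.
    have [|e eN ve] := cN v; first by rewrite inE vH.
    by exists e; rewrite // inE eN orbT.
  - move=> e e' v /setUP[eM|eN] /setUP[e'M|e'N] ve ve'.
    + exact: uM ve ve'.
    + by case: (NH v e' e'N ve'); apply: eset_vset (subsetP ME e eM) ve.
    + by case: (NH v e eN ve); apply: eset_vset (subsetP ME e' e'M) ve'.
    + exact: uN ve ve'.
have ofP Q : Q \in P -> Q :&: eset H \in pms H /\ Q = (Q :&: eset H) :|: N.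
  rewrite !inE => /andP[/pmP[QE cQ uQ] QF].
  have inF e : e \in Q -> e \in eset H \/ e \in N by move=> /(subsetP QF)/setUP.
  split.
    apply/pmP; split=> [|v vH|e e' v]; first exact: subsetIr.
      have [e eQ ve] := cQ v (subsetP sV v vH); exists e => //.
      by rewrite inE eQ; case: (inF e eQ) => // eN; case: (NH v e eN ve vH).
    by rewrite !inE => /andP[eQ _] /andP[e'Q _]; apply: uQ.
  apply/setP => e; rewrite !inE; apply/idP/idP => [eQ|/orP[/andP[]//|eN]].
    by case: (inF e eQ) => ->; rewrite ?eQ ?orbT.
  have [x [y [_ Ee xG _]]] := eset2P (subsetP NG e eN).
  have xe : x \in e by rewrite Ee set21.
  have [e' e'Q xe'] := cQ x xG.
  case: (inF e' e'Q) => [e'H|e'N]; first by case: (NH x e eN xe); apply: eset_vset xe'.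
  by rewrite (uN e e' x).
have MI M : M \in pms H -> (M :|: N) :&: eset H = M.
  rewrite inE => /andP[ME _]; rewrite setIUl (setIidPl ME) (_ : N :&: _ = set0) ?setU0 //.
  apply/setP => e; rewrite !inE; case eN: (e \in N) => //=.
  exact: negbTE (NE0 e eN).
have P0 : P != set0 by apply/set0Pn; exists (M0 :|: N); apply: toP; rewrite inE.
have [k [[S1 sepS1 S1k] sepk blk [M1 M1P M1k]]] := unif F P0.
have gfk : gf H = k.
  apply/eqP; rewrite eqn_leq; apply/andP; split.
    apply: leq_trans S1k; apply: gf_leq => M M' PM PM' E.
    rewrite -(MI M PM) -(MI M' PM'); congr (_ :&: _).
    by apply: sepS1; rewrite ?toP // !setIUr E.
  have [S sepS <-] := gf_witness H.
  apply: leq_trans (subset_leq_card (subsetIl S (eset H))); apply: sepk => Q Q' QP Q'P E.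
  have [Q1 ->] := ofP Q QP; have [Q2 ->] := ofP Q' Q'P; congr (_ :|: _).
  by apply: sepS => //; rewrite [Q :&: _]setIC [Q' :&: _]setIC !setIA.
suff -> : Af H = k by [].
apply/eqP; rewrite eqn_leq; apply/andP; split.
  apply: Af_leq => M PM; have [S [dS bS] Sk] := blk _ (toP M PM); exists S => //.
  have [dM dN] : [disjoint S & M] /\ [disjoint S & N].
    by split; apply: disjointWr dS; [apply: subsetUl | apply: subsetUr].
  split=> // M' PM' D; have := bS _ (toP M' PM'); rewrite disjoints_subset.
  rewrite setCU subsetI -!disjoints_subset dN andbT; apply.
  by apply: contra D => /eqP E; rewrite -(MI M PM) -(MI M' PM') E.
have [QM EQ] := ofP M1 M1P; apply: (leq_Af QM) => S [dS bS].
apply: leq_trans (subset_leq_card (subsetIl S (eset H))); apply: M1k; split.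
  rewrite EQ; apply/pred0P => e /=; rewrite !inE; apply/negP => /andP[/andP[eS eH]].
  case/orP => [eM|eN]; last by have := NE0 e eN; rewrite eH.
  by have/pred0P/(_ e) := dS; rewrite /= eS inE eM.
move=> Q QP D; have [Q1 EQ1] := ofP Q QP.
have /bS : Q :&: eset H \in pms H by [].
move=> /(_ _)/pred0Pn[|e].
  by apply: contra D => /eqP E; rewrite EQ EQ1 E.
rewrite /= !inE => /and3P[eS eQ eH]; apply/pred0Pn; exists e.
by rewrite /= !inE eS eH eQ.
Qed.

End Families.

(** * Perfect matchings along a Hamilton cycle *)

Section HamiltonMatchings.
Variables (T : finType) (G : graph T) (c : seq T) (x0 : T) (B : {set T}).
Hypotheses (hc : hamilton_cycle G c) (colB : proper_coloring B (eset G)).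
Local Notation N := (size c).
Local Notation X i := (nth x0 c i).
Local Notation D := (chords G c).
Implicit Types (M A : {set {set T}}) (b : nat -> bool) (d e : {set T}).

Let uc : uniq c. Proof. by case/and4P: hc. Qed.
Let N2 : 2 < N. Proof. by case/and4P: hc. Qed.
Let eN : ~~ odd N. Proof. exact (hamilton_even x0 hc colB). Qed.

Definition prv i := if i is i'.+1 then i' else N.-1.

Definition Ed i : {set T} := [set X i; X (i.+1 %% N)].

Lemma prv_lt i : i < N -> prv i < N.
Proof. by case: i => [|i] /= iN; lia. Qed.

Lemma odd_prv i : i < N -> odd (prv i) = ~~ odd i.
Proof. by move: eN; case: i => [|i] /= eN' iN; [|rewrite negbK]; lia. Qed.

Lemma nxt_prv i j : i < N -> j < N -> (j.+1 %% N == i) = (j == prv i).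
Proof.
move=> iN jN; case: (ltnP j.+1 N) => jN'.
  by rewrite modn_small //; case: i iN => [|i] /= iN; lia.
have -> : j.+1 = N by lia.
by rewrite modnn; case: i iN => [|i] /= iN; lia.
Qed.

Lemma Ed_cycle i : i < N -> Ed i \in cycle_edges c.
Proof. by move=> iN; apply/(cycle_edgesP x0 _ uc); exists i. Qed.

Lemma Ed_edge i : i < N -> Ed i \in eset G.
Proof.
move=> iN; apply: subsetP (Ed_cycle iN).
by case/and4P: hc => _ _ _; apply: cycle_edges_adj.
Qed.

Lemma Ed_chord i : i < N -> Ed i \notin D.
Proof. by move=> /Ed_cycle E; rewrite inE E. Qed.

Lemma edge_cases e : e \in eset G -> e \in D \/ exists2 i, i < N & e = Ed i.
Proof.
move=> eG; case E: (e \in cycle_edges c); last by left; rewrite inE E.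
by right; apply/(cycle_edgesP x0 _ uc).
Qed.

Lemma mem_Ed i j : i < N -> j < N -> (X i \in Ed j) = (j == i) || (j == prv i).
Proof.
move=> iN jN; rewrite !inE !(nth_eq x0 hc) ?ltn_mod //; last by lia.
by rewrite -nxt_prv // [i == j]eq_sym [i == _]eq_sym.
Qed.

Lemma Ed_inj i j : i < N -> j < N -> Ed i = Ed j -> i = j.
Proof.
move=> iN jN E; have : X i \in Ed j by rewrite -E set21.
have : X j \in Ed i by rewrite E set21.
rewrite !mem_Ed // => /orP[/eqP//|/eqP E1] /orP[/eqP//|/eqP E2].
by move: E1 E2 N2 iN jN; case: i {E} => [|i]; case: j => [|j] /=; lia.
Qed.

Definition mat A b := A :|: [set Ed (val i) | i : 'I_N & odd i == b i].

Lemma mem_mat_Ed A b i : A \subset D -> i < N -> (Ed i \in mat A b) = (odd i == b i).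
Proof.
move=> sD iN; rewrite inE; case E: (Ed i \in A).
  by have := Ed_chord iN; rewrite (subsetP sD _ E).
apply/imsetP/idP => [[j + /(Ed_inj iN (ltn_ord j)) ->]|bi]; first by rewrite inE.
by exists (Ordinal iN); rewrite ?inE.
Qed.

Lemma mem_mat_D A b d : d \in D -> (d \in mat A b) = (d \in A).
Proof.
move=> dD; rewrite inE orbC; case E: (d \in imset _ _) => //=.
by case/imsetP: E dD => i _ ->; rewrite (negPf (Ed_chord (ltn_ord i))).
Qed.

Lemma mat_cases A b e : e \in mat A b ->
  e \in A \/ exists2 i, i < N & e = Ed i /\ odd i == b i.
Proof.
case/setUP => [|/imsetP[i]]; first by left.
by rewrite inE => bi ->; right; exists i.
Qed.

Lemma vset_nth v : v \in vset G -> exists2 i, i < N & v = X i.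
Proof.
case/and4P: hc => _ _ /eqP <- _; rewrite inE => vc.
by exists (index v c); rewrite ?index_mem ?nth_index.
Qed.

(* In a perfect matching, [b i] below tells on which of the two alternating
   patterns of the cycle the edge [Ed i] is; the pattern changes exactly at the
   ends of the chords A of the matching. *)
Definition steps A b := forall i, i < N ->
  ((exists2 d, d \in A & X i \in d) -> b i = ~~ odd i /\ b (prv i) = odd i) /\
  ((forall d, d \in A -> X i \notin d) -> b (prv i) = b i).

Lemma end_dec A i :
  (exists2 d, d \in A & X i \in d) \/ (forall d, d \in A -> X i \notin d).
Proof.
case E: [exists d in A, X i \in d]; first by left; apply/exists_inP.
by right=> d dD; apply: contraFN E => id; apply/exists_inP; exists d.
Qed.

(** At an end of a chord of A, [steps] rejects both cycle edges; at any other vertex the two cycle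
    edges have equal phase and opposite parity, so exactly one is taken. *)
Lemma mat_pm A b : A \subset D ->
  (forall d d' v, d \in A -> d' \in A -> v \in d -> v \in d' -> d = d') ->
  steps A b -> mat A b \in pms G.
Proof.
move=> sD dD st; have DG : A \subset eset G by apply: subset_trans sD (subsetDl _ _).
rewrite inE; apply/pmP; split.
- apply/subsetP => e /mat_cases[/(subsetP DG)//|[i iN [-> _]]]; exact: Ed_edge.
- move=> v /vset_nth[i iN ->]; have [se sn] := st i iN; have pN := prv_lt iN.
  case: (end_dec A i) => [[d dD' id]|nd]; first by exists d; rewrite // inE dD'.
  case E: (odd i == b i).
    by exists (Ed i); rewrite ?mem_mat_Ed // set21.
  exists (Ed (prv i)); rewrite ?mem_mat_Ed ?mem_Ed ?eqxx ?orbT // sn // odd_prv //.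
  by move: E; case: odd; case: (b i).
- move=> e e' v em e'm ve ve'.
  have [i iN Ev] : exists2 i, i < N & v = X i.
    apply: vset_nth; case: (mat_cases em) ve => [/(subsetP DG)/eset_vset|]; first by apply.
    by case=> j jN [-> _]; apply: eset_vset (Ed_edge jN).
  have [se sn] := st i iN; subst v.
  have EE d j : d \in A -> X i \in d -> j < N -> odd j == b j -> X i \in Ed j -> False.
    move=> dD' id jN oj; rewrite mem_Ed // => /orP[]/eqP Ej; move: oj; rewrite Ej;
      have [|E1 E2] := se; try by exists d.
      by rewrite E1; case: odd.
    by rewrite E2 odd_prv //; case: odd.
  have PP : odd i == b i -> odd (prv i) == b (prv i) -> False.
    case: (end_dec A i) => [H|/sn->]; first by case: (se H) => -> _; case: odd.
    by rewrite odd_prv //; case: odd; case: (b i).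
  case: (mat_cases em) ve => [eD|[j jN [-> oj]]] ve;
    case: (mat_cases e'm) ve' => [e'D|[k kN [-> ok]]] ve'.
  + exact: dD ve ve'.
  + by case: (EE e k).
  + by case: (EE e' j).
  + move: ve ve'; rewrite !mem_Ed // => /orP[]/eqP Ej /orP[]/eqP Ek; subst j k => //.
      by case: PP.
    by case: PP.
Qed.

Lemma pm_steps M : M \in pms G -> steps (M :&: D) (fun i => (Ed i \in M) == odd i).
Proof.
rewrite inE => /pmP[ME cM uM] i iN; have pN := prv_lt iN.
have iE : X i \in Ed i by rewrite set21.
have pE : X i \in Ed (prv i) by rewrite mem_Ed // eqxx orbT.
split=> [[d] | nd].
  rewrite inE => /andP[dM dD] id; rewrite odd_prv //.
  have noE j : j < N -> X i \in Ed j -> (Ed j \in M) = false.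
    move=> jN ij; apply/negP => jM; have := Ed_chord jN.
    by rewrite -(uM d (Ed j) (X i)) // dD.
  by rewrite !noE //; case: odd.
rewrite odd_prv //; suff -> : (Ed (prv i) \in M) = ~~ (Ed i \in M).
  by case: (_ \in M); case: odd.
apply/idP/negP => [pM iM|iM].
  have /Ed_inj E := uM _ _ _ pM iM pE iE; have := odd_prv iN.
  by rewrite E //; case: odd.
have [|e eM ie] := cM (X i); first exact: nth_vset.
case: (edge_cases (subsetP ME e eM)) => [eD|[j jN Ej]].
  by have := nd e; rewrite inE eM eD ie => /(_ isT).
move: ie eM; rewrite Ej mem_Ed // => /orP[]/eqP-> //.
Qed.

Lemma pm_ext M M' : M \in pms G -> M' \in pms G -> M :&: D = M' :&: D ->
  (forall i, i < N -> (Ed i \in M) = (Ed i \in M')) -> M = M'.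
Proof.
rewrite !inE => /andP[/subsetP ME _] /andP[/subsetP ME' _] /setP ED EE.
have X1 M1 M2 : (forall e, e \in M1 -> e \in eset G) -> (forall e, (e \in M1 :&: D) = (e \in M2 :&: D)) ->
    (forall i, i < N -> (Ed i \in M1) = (Ed i \in M2)) -> M1 \subset M2.
  move=> s1 e1 e2; apply/subsetP => e eM; case: (edge_cases (s1 e eM)) => [eD|[i iN Ei]].
    by have := e1 e; rewrite !in_setI eM eD !andbT => <-.
  by move: eM; rewrite Ei e2.
by apply/eqP; rewrite eqEsubset !X1 // => i iN; rewrite EE.
Qed.

End HamiltonMatchings.

(** * Chords as disjoint intervals of positions *)

Section Intervals.
Variables (T : finType) (G : graph T) (c : seq T) (x0 : T) (B : {set T}).
Hypotheses (hc : hamilton_cycle G c) (colB : proper_coloring B (eset G)).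
Local Notation N := (size c).
Local Notation X i := (nth x0 c i).
Local Notation D := (chords G c).
Local Notation Ed := (Ed c x0).
Implicit Types (M F A : {set {set T}}) (d e : {set T}).

Variables lo hi : {set T} -> nat.
Hypothesis chord_ends : forall d, d \in D ->
  [/\ lo d < hi d, hi d < N, ~~ odd (lo d), odd (hi d) & d = [set X (lo d); X (hi d)]].
Hypothesis chord_sep : forall d d', d \in D -> d' \in D -> d != d' ->
  (hi d < lo d') || (hi d' < lo d).

Let N2 : 2 < N. Proof. by case/and4P: hc. Qed.
Let eN : ~~ odd N. Proof. exact (hamilton_even x0 hc colB). Qed.

(** The phase of M_A: odd edges below the chords of A, even edges elsewhere. So M_A arises from the
    even edges of the cycle by switching along the cycles that the chords of A form with their
    intervals. *)
Definition inside A i : bool := [exists d in A, (lo d <= i) && (i < hi d)].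

Lemma inside_in A d i : A \subset D -> d \in D -> lo d <= i -> i < hi d -> inside A i = (d \in A).
Proof.
move=> sA dD i1 i2; apply/exists_inP/idP => [[d' d'A /andP[j1 j2]]|dA]; last first.
  by exists d; rewrite // i1 i2.
case: (eqVneq d' d) => [<- //|dd]; have := chord_sep (subsetP sA _ d'A) dD dd.
by move: i1 i2 j1 j2; clear; lia.
Qed.

Lemma inside_out A i : A \subset D ->
  (forall d, d \in D -> ~~ ((lo d <= i) && (i < hi d))) -> inside A i = false.
Proof.
by move=> sA nd; apply/exists_inP => -[d /(subsetP sA)/nd/negPf->].
Qed.

Lemma inside_dec i : (exists2 d, d \in D & lo d <= i < hi d) \/
  (forall d, d \in D -> ~~ ((lo d <= i) && (i < hi d))).
Proof.
case E: [exists d in D, (lo d <= i) && (i < hi d)]; first by left; apply/exists_inP.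
by right=> d dD; apply: contraFN E => id; apply/exists_inP; exists d.
Qed.

Lemma mem_chord d i : d \in D -> i < N -> (X i \in d) = (i == lo d) || (i == hi d).
Proof.
move=> dD iN; have [lt hN _ _ {1}->] := chord_ends dD.
by rewrite !inE !(nth_eq x0 hc) // (ltn_trans lt).
Qed.

Lemma inside_steps A : A \subset D -> steps c x0 A (inside A).
Proof.
move=> sA i iN; have pN := prv_lt x0 hc colB iN; split=> [[d dA id]|nd].
  have dD := subsetP sA d dA; have [lt hN ol oh _] := chord_ends dD.
  move: id; rewrite mem_chord // => /orP[]/eqP Ei.
    rewrite (inside_in (d := d)) ?Ei // dA ol (inside_out sA) ?(negPf ol) //.
    move=> d' d'D; have [lt' hN' _ _ _] := chord_ends d'D; case: (eqVneq d' d) => [->|dd].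
      by move: lt hN; case: (lo d) => [|k] /=; clear; lia.
    have := chord_sep d'D dD dd; move: lt hN lt' hN'.
    by case: (lo d) => [|k] /=; clear; lia.
  rewrite (inside_out sA); last first.
    move=> d' d'D; have [lt' hN' _ _ _] := chord_ends d'D; case: (eqVneq d' d) => [->|dd].
      by rewrite Ei; clear; lia.
    by have := chord_sep d'D dD dd; move: lt hN lt' hN' Ei; clear; lia.
  rewrite (inside_in (d := d)) ?dA ?Ei ?oh //; move: lt; rewrite -Ei; case: (i) => [|k] //=; clear; lia.
apply: eq_existsb => d; case dA: (d \in A) => //=.
have dD := subsetP sA d dA; have [lt hN _ _ _] := chord_ends dD.
have := nd d dA; rewrite mem_chord // negb_or => /andP[n1 n2].
by move: lt hN iN n1 n2; case: (i) => [|k] /=; clear; lia.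
Qed.

Definition Mt A := mat c x0 A (inside A).

Lemma Mt_pm A : A \subset D -> Mt A \in pms G.
Proof.
move=> sA; apply: (mat_pm hc colB sA) => [d d' v dA d'A vd vd'|]; last exact: inside_steps.
have dD := subsetP sA d dA; have d'D := subsetP sA d' d'A.
have vG : v \in vset G.
  by apply: (eset_vset (e := d)) => //; have /setDP[] := dD.
have [i iN Ei] := vset_nth x0 hc vG; subst v.
apply/eqP; apply: contraT => /(chord_sep dD d'D); move: vd vd'; rewrite !mem_chord //.
have [lt _ _ _ _] := chord_ends dD; have [lt' _ _ _ _] := chord_ends d'D.
by move: lt lt'; clear; lia.
Qed.

Lemma Mt_chords A : A \subset D -> Mt A :&: D = A.
Proof.
move=> sA; apply/setP => d; rewrite in_setI; case dD: (d \in D).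
  by rewrite andbT (mem_mat_D x0 hc).
by rewrite andbF; apply/esym/negbTE; apply: contraFN dD => /(subsetP sA).
Qed.

Lemma mem_Mt_Ed A i : A \subset D -> i < N -> (Ed i \in Mt A) = (odd i == inside A i).
Proof. by move=> sA iN; rewrite (mem_mat_Ed x0 hc colB _ sA). Qed.

(** This edge is odd and lies below no chord, so it is in no M_A; it marks the extra matching. *)
Let z := Ed N.-1.

Lemma z_Mt A : A \subset D -> z \notin Mt A.
Proof.
move=> sA; rewrite mem_Mt_Ed //; last by lia.
rewrite inside_out // => [|d dD]; first by lia.
by have [_ hN _ _ _] := chord_ends dD; move: hN; clear; lia.
Qed.

(** Starting from [z], the phase stays odd until the first chord end. That end is an even position
    [lo d], before which a matching containing [d] has the even phase; so no chord is used. *)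
Lemma z_pm M i : M \in pms G -> z \in M -> M :&: D = set0 /\ (i < N -> (Ed i \in M) = odd i).
Proof.
move=> PM zM; have st := pm_steps x0 hc colB PM; pose b j := (Ed j \in M) == odd j.
have bz : b N.-1 by rewrite /b zM; lia.
have sMD : M :&: D \subset D by apply: subsetIr.
have all_b k : k <= N -> (forall j, j < k -> forall d, d \in M :&: D -> X j \notin d) ->
    forall j, j < k -> b j.
  move=> kN nk; elim=> [|j IH] jk.
    by have [_ /(_ (nk 0 jk))] := st 0 (leq_trans jk kN); rewrite /= -/(b _) -/(b _) => <-.
  have [_ /(_ (nk _ jk))] := st j.+1 (leq_trans jk kN).
  by rewrite /= -/(b _) -/(b _) => <-; apply: IH; apply: ltnW.
have MD : M :&: D = set0.
  apply/eqP; apply: contraT => /set0Pn[d0 d0M].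
  case: (arg_minnP (P := mem (M :&: D)) lo d0M) => d dM min.
  have dD := subsetP sMD d dM; have [lt hN ol _ _] := chord_ends dD.
  have lN := ltn_trans lt hN.
  have [st1 _] := st (lo d) lN; have [|_] := st1.
    by exists d => //; rewrite mem_chord // eqxx.
  rewrite (negPf ol) -/(b _) => bp.
  have := all_b (lo d) (ltnW lN); move: bp; case El: (lo d) => [|k] /=.
    by rewrite bz.
  move=> bk /(_ _ k (ltnSn k)); rewrite bk; apply=> j jk d' d'M.
  have d'D := subsetP sMD d' d'M; have [lt' _ _ _ _] := chord_ends d'D.
  have := min d' d'M; rewrite mem_chord // ?negb_or; last by rewrite -El in jk; apply: ltn_trans lN.
  by rewrite El; move: jk lt'; clear; lia.
split=> // iN; have : b i.
  by apply: (all_b N) => // j _ d; rewrite MD inE.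
by rewrite /b => /eqP.
Qed.

(** The two phases agree on [z], and [steps] carries the agreement round the cycle. *)
Lemma no_z_pm M : M \in pms G -> z \notin M -> M = Mt (M :&: D).
Proof.
move=> PM zM; have sMD : M :&: D \subset D by apply: subsetIr.
have st := pm_steps x0 hc colB PM; have si := inside_steps sMD.
apply: (pm_ext (x0 := x0) hc PM (Mt_pm sMD)) => [|i iN]; first by rewrite Mt_chords.
rewrite mem_Mt_Ed //.
suff : ((Ed i \in M) == odd i) = inside (M :&: D) i by move=> <-; case: (_ \in M); case: odd.
have S j : j < N -> ((Ed (prv c j) \in M) == odd (prv c j)) = inside (M :&: D) (prv c j) ->
    ((Ed j \in M) == odd j) = inside (M :&: D) j.
  move=> jN E; have [s1 s2] := st j jN; have [t1 t2] := si j jN.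
  case: (end_dec c x0 (M :&: D) j) => H; first by rewrite (s1 H).1 (t1 H).1.
  by rewrite -(s2 H) -(t2 H).
elim: i iN => [|i IH] iN; apply: S => //=; last by apply: IH; apply: ltnW.
rewrite -/z (negPf zM) inside_out // => [|d dD]; first by lia.
by have [_ hN _ _ _] := chord_ends dD; move: hN; clear; lia.
Qed.

Lemma z_unique M M' : M \in pms G -> M' \in pms G -> z \in M -> z \in M' -> M = M'.
Proof.
move=> PM PM' zM zM'; apply: (pm_ext (x0 := x0) hc PM PM') => [|i iN].
  by rewrite (z_pm 0 PM zM).1 (z_pm 0 PM' zM').1.
by rewrite (z_pm i PM zM).2 ?(z_pm i PM' zM').2.
Qed.

(** Below any given chord A agrees with A1 or with A2, so every edge of [Mt A] is in one of the two
    matchings. This is why the sets A with [Mt A] inside F form an interval. *)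
Lemma Mt_mix A1 A2 A F : A1 \subset D -> A2 \subset D -> A1 :&: A2 \subset A ->
  A \subset A1 :|: A2 -> Mt A1 \in pms_in G F -> Mt A2 \in pms_in G F -> Mt A \in pms_in G F.
Proof.
move=> s1 s2 sI sU; rewrite !in_set => /andP[_ F1] /andP[_ F2].
have sA : A \subset D by apply: subset_trans sU _; rewrite subUset s1.
have := Mt_pm sA; rewrite in_set => -> /=; apply/subsetP => e /mat_cases[eA|[i iN [-> oi]]].
  case/setUP: (subsetP sU e eA) => eAi; [apply: (subsetP F1) | apply: (subsetP F2)];
    by rewrite (mem_mat_D x0 hc) // (subsetP sA).
suff [E|E] : inside A i = inside A1 i \/ inside A i = inside A2 i.
- by apply: (subsetP F1); rewrite mem_Mt_Ed // -E.
- by apply: (subsetP F2); rewrite mem_Mt_Ed // -E.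
case: (inside_dec i) => [[d dD /andP[i1 i2]]|nd]; last by rewrite !inside_out //; left.
rewrite !(inside_in (d := d)) //; case dA: (d \in A).
  by case/setUP: (subsetP sU d dA) => ->; [left | right].
case d1: (d \in A1); last by left.
right; apply/esym/negbTE; apply: contraFN dA => d2.
by apply: (subsetP sI); rewrite inE d1 d2.
Qed.

(** Dropping a chord adds only even edges below it. Hence the differences for two chords are
    disjoint from each other and from the extra matching, which is odd. *)
Lemma Mt_diff A d e : A \subset D -> d \in D -> e \in Mt (A :\ d) :\: Mt A ->
  exists i, [/\ i < N, e = Ed i, ~~ odd i, lo d <= i & i < hi d].
Proof.
move=> sA dD /setDP[+ eA]; have sAd : A :\ d \subset D by apply: subset_trans (subsetDl _ _) sA.
case/mat_cases => [/setD1P[_ eA']|[i iN [Ei oi]]].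
  by rewrite (mem_mat_D x0 hc) ?eA' // (subsetP sA) in eA.
move: eA; rewrite Ei mem_Mt_Ed // => nA.
case: (inside_dec i) => [[d' dD' /andP[i1 i2]]|nd]; last first.
  by rewrite !inside_out // in oi nA; rewrite oi in nA.
move: oi nA; rewrite !(inside_in (d := d')) // !inE; case: (eqVneq d' d) => [<-|_] /=.
  by move=> oi _; exists i; split=> //; case: odd oi.
by move=> ->.
Qed.

Lemma intervals_uniform F : pms_in G F != set0 -> uniform (pms_in G F).
Proof.
case/set0Pn => M0 PM0; set P := pms_in G F in PM0 *.
have Pp M : M \in P -> M \in pms G by rewrite inE => /andP[].
pose Q A := (A \subset D) && (Mt A \in P).
(* If no M_A lies in F, the extra matching is the only member. *)
case: (pickP Q) => [A0 QA0|nQ]; last first.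
  apply: (uniform1 (M := M0)); apply/setP => M; rewrite [RHS]in_set1.
  have zP M' : M' \in P -> z \in M'.
    move=> PM'; apply: contraT => zM'; have := nQ (M' :&: D).
    by rewrite /Q subsetIr -no_z_pm ?PM' // Pp.
  apply/idP/eqP => [PM|->] //; apply: z_unique; rewrite ?Pp ?zP //.
case: (arg_minnP (fun A : {set {set T}} => #|A|) QA0) => Amin /andP[sn Pn] mn.
case: (arg_maxnP (fun A : {set {set T}} => #|A|) QA0) => Amax /andP[sx Px] mx.
have between A : Q A -> (Amin \subset A) && (A \subset Amax).
  move=> /andP[sA PA]; apply/andP; split.
    have /mn : Q (Amin :&: A).
      rewrite /Q (subset_trans (subsetIl _ _)) //=.
      by apply: (Mt_mix sn sA) => //; apply: subset_trans (subsetIl _ _) (subsetUl _ _).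
    by move=> le; rewrite (sameP setIidPl eqP) eqEcard subsetIl.
  have /mx : Q (Amax :|: A).
    rewrite /Q subUset sx sA /=.
    by apply: (Mt_mix sx sA) => //; apply: subset_trans (subsetIl _ _) (subsetUl _ _).
  by move=> le; rewrite (sameP setUidPl eqP) eq_sym eqEcard subsetUl.
have Qi A : Amin \subset A -> A \subset Amax -> Q A.
  move=> s1 s2; rewrite /Q (subset_trans s2 sx) /=.
  apply: (Mt_mix sn sx) => //; first exact: subset_trans (subsetIl _ _) s1.
  exact: subset_trans s2 (subsetUr _ _).
pose Df := Amax :\: Amin; pose zP := [exists M in P, z \in M].
have sf : Df \subset D by apply: subset_trans (subsetDl _ _) sx.
pose Z : {set {set T}} := if zP then [set z] else set0.
have cZ : #|Z| = zP by rewrite /Z; case: (zP); rewrite ?cards1 ?cards0.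
have inZ M : M \in P -> z \in M -> z \in Z.
  by move=> PM zM; rewrite /Z (_ : zP) ?set11 //; apply/exists_inP; exists M.
have QM M : M \in P -> z \notin M -> Q (M :&: D).
  by move=> PM zM; rewrite /Q subsetIr -no_z_pm // Pp.
have ZM M e : z \notin M -> e \in Z -> e \notin M.
  by rewrite /Z; case: (zP); rewrite inE // => ? /eqP->.
(* The free chords [Df] tell the M_A apart, and [z] detects the extra matching. *)
exists (#|Df| + zP); split.
- exists (Df :|: Z); last by rewrite -cZ leq_card_setU.
  move=> M1 M2 P1 P2 /setP E.
  have Ez : (z \in M1) = (z \in M2).
    have := E z; rewrite !in_setI !in_setU.
    case z1: (z \in M1); first by rewrite (inZ M1) // orbT /= => <-.
    by case z2: (z \in M2); first by rewrite (inZ M2) // orbT.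
  case z1: (z \in M1); first by apply: z_unique; rewrite ?Pp // -Ez.
  have [n1 n2] : z \notin M1 /\ z \notin M2 by rewrite -Ez z1.
  rewrite (no_z_pm (Pp _ P1) n1) (no_z_pm (Pp _ P2) n2); congr Mt.
  have /andP[a1 b1] := between _ (QM _ P1 n1); have /andP[a2 b2] := between _ (QM _ P2 n2).
  apply/setP => d; case dn: (d \in Amin); first by rewrite (subsetP a1) ?(subsetP a2).
  case dx: (d \in Amax); last first.
    by rewrite (contraFF (subsetP b1 d) dx) (contraFF (subsetP b2 d) dx).
  by have := E d; rewrite !in_setI !in_setU in_setD dn dx /= => ->.
- move=> S /separates_card cS.
  (* A single member beyond a power of two already forces one more element of S. *)
  have cP : 2 ^ #|Df| + zP <= #|P|.
    pose I1 := [set Mt (Amin :|: A) | A in powerset Df].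
    pose I2 := [set M in P | z \in M].
    have sQ A : A \in powerset Df -> Q (Amin :|: A).
      rewrite inE => sA; apply: Qi; rewrite ?subsetUl // subUset.
      rewrite (subset_trans sA (subsetDl _ _)) andbT.
      by have /andP[] := between Amax (introT andP (conj sx Px)).
    have c1 : #|I1| = 2 ^ #|Df|.
      rewrite card_in_imset ?card_powerset // => A A' sA sA' E.
      have /andP[sA1 _] := sQ A sA; have /andP[sA2 _] := sQ A' sA'.
      have := Mt_chords sA1; rewrite E Mt_chords // => /setP E'; apply/setP => d.
      move: sA sA'; rewrite !inE => /subsetP sA /subsetP sA'.
      case dn: (d \in Amin); last by have := E' d; rewrite !inE dn.
      case dA: (d \in A); first by have := sA d dA; rewrite inE dn.
      by case dA': (d \in A') => //; have := sA' d dA'; rewrite inE dn.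
    have c2 : zP <= #|I2|.
      case E: zP => //; have /exists_inP[M PM zM] := E.
      by rewrite card_gt0; apply/set0Pn; exists M; rewrite inE PM.
    apply: leq_trans (_ : #|I1 :|: I2| <= _); last first.
      apply: subset_leq_card; apply/subsetP => M /setUP[/imsetP[A sA ->]|].
        by have /andP[] := sQ A sA.
      by rewrite inE => /andP[].
    rewrite cardsU (_ : I1 :&: I2 = set0) ?cards0 ?subn0 ?c1 ?leq_add2l //.
    apply/setP => M; rewrite !inE; apply/negP => /andP[/imsetP[A sA ->] /andP[_]].
    by have /andP[sA1 _] := sQ A sA; rewrite (negPf (z_Mt sA1)).
  have := leq_trans cP cS; case: (zP) => /=.
    by rewrite !addn1 ltn_exp2l.
  by rewrite !addn0 leq_exp2l.
- move=> M PM; case zM: (z \in M).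
    have zPt : zP by apply/exists_inP; exists M.
    have noD d : d \in D -> d \notin M.
      move=> dD; apply/negP => dM; have := (z_pm 0 (Pp M PM) zM).1.
      by move/setP/(_ d); rewrite in_setI dM dD inE.
    have noE i : i < N -> ~~ odd i -> Ed i \notin M.
      by move=> iN oi; rewrite (z_pm i (Pp M PM) zM).2.
    have noz M' : M' \in P -> M' != M -> z \notin M'.
      by move=> PM' D'; apply: contra D' => zM'; apply/eqP/z_unique; rewrite ?Pp.
    (* To block the extra matching, take a free chord [d] and the even edge at [lo d]: each M_A
       contains one of them, and two elements are allowed since [Df] is nonempty. Without free
       chords there is at most one other member, met by one of its chords or, if it has none, by
       [Ed 0]. *)
    case: (set_0Vmem Df) => [Df0|[d dDf]].
      have EA M' : M' \in P -> M' != M -> M' = Mt Amin.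
        move=> PM' D'; have nz := noz M' PM' D'; rewrite (no_z_pm (Pp M' PM') nz); congr Mt.
        have /andP[a1 b1] := between _ (QM _ PM' nz); apply/eqP; rewrite eqEsubset a1 andbT.
        apply: subset_trans b1 _; rewrite -setD_eq0; exact/eqP.
      rewrite zPt Df0 cards0; case: (set_0Vmem Amin) => [An0|[d dAn]].
        exists [set Ed 0]; rewrite ?cards1 //; split.
          by rewrite disjoints_subset sub1set inE noE // ltnW // ltnW.
        move=> M' PM' D'; rewrite (EA M' PM' D'); apply/pred0Pn; exists (Ed 0).
        rewrite /= set11 mem_Mt_Ed ?An0 ?sub0set //; last by rewrite ltnW // ltnW.
        by rewrite /inside; apply/eqP/esym/exists_inP => -[d]; rewrite inE.
      exists [set d]; rewrite ?cards1 //; split.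
        by rewrite disjoints_subset sub1set inE noD // (subsetP sn).
      move=> M' PM' D'; rewrite (EA M' PM' D'); apply/pred0Pn; exists d.
      by rewrite /= set11 (mem_mat_D x0 hc) // (subsetP sn).
    have dD := subsetP sf d dDf; have [lt hN ol _ _] := chord_ends dD.
    have lN := ltn_trans lt hN.
    exists [set d; Ed (lo d)].
      split.
        by rewrite disjoints_subset subUset !sub1set !inE noD // noE.
      move=> M' PM' D'; have nz := noz M' PM' D'; have EM := no_z_pm (Pp M' PM') nz.
      have sM : M' :&: D \subset D by apply: subsetIr.
      case dM : (d \in M'); first by apply/pred0Pn; exists d; rewrite /= set21 dM.
      apply/pred0Pn; exists (Ed (lo d)); rewrite /= set22 EM mem_Mt_Ed //.
      by rewrite (inside_in (d := d)) // in_setI dM (negPf ol).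
    rewrite zPt cards2; apply: leq_trans (_ : 2 <= _); first by case: (_ != _).
    by rewrite addn1 ltnS card_gt0; apply/set0Pn; exists d.
  have nz : z \notin M by rewrite zM.
  have EM := no_z_pm (Pp M PM) nz; have /andP[an ax] := between _ (QM M PM nz).
  set A := M :&: D in EM an ax; have sA : A \subset D by apply: subsetIr.
  (* Each free chord contributes an element that M_A lacks and that appears once the status of the
     chord changes: the chord itself, or the even edge at its lower end. *)
  exists ((Df :\: A) :|: [set Ed (lo d) | d in Df :&: A] :|: Z); last first.
    apply: leq_trans (leq_card_setU _ _) _; rewrite cZ leq_add2r.
    apply: leq_trans (leq_card_setU _ _) _; rewrite -(cardsID A Df) addnC leq_add2r.
    exact: leq_imset_card.
  split.
    apply/pred0P => e /=; apply/negP => /andP[/setUP[/setUP[/setDP[eDf neA]|eI]|eZ] eM].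
    + by rewrite in_setI eM (subsetP sf) in neA.
    + case/imsetP: eI => d /setIP[dDf dA] Ee; have dD := subsetP sf d dDf.
      have [lt hN ol _ _] := chord_ends dD; move: eM; rewrite Ee EM mem_Mt_Ed //.
        by rewrite (inside_in (d := d)) // dA (negPf ol).
      exact: ltn_trans hN.
    + by have := ZM M e nz eZ; rewrite eM.
  move=> M' PM' D'; case zM': (z \in M').
    by apply/pred0Pn; exists z; rewrite /= zM' andbT in_setU (inZ M') ?orbT.
  have nz' : z \notin M' by rewrite zM'.
  have EM' := no_z_pm (Pp M' PM') nz'; have /andP[an' ax'] := between _ (QM M' PM' nz').
  set A' := M' :&: D in EM' an' ax'; have sA' : A' \subset D by apply: subsetIr.
  have inDf d : (d \in A) != (d \in A') -> d \in Df.
    move=> dd; rewrite in_setD; apply/andP; split.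
      by apply: contra dd => dn; rewrite (subsetP an) ?(subsetP an').
    apply: contraNT dd => dx; rewrite (contraNF (subsetP ax d) dx).
    by rewrite (contraNF (subsetP ax' d) dx).
  have [d dd] : exists d, (d \in A) != (d \in A').
    apply/existsP; apply: contraNT D'; rewrite negb_exists => /forallP E.
    by rewrite EM' EM; apply/eqP; congr Mt; apply/setP => d; have := E d; rewrite negbK => /eqP.
  have dDf := inDf d dd; have dD := subsetP sf d dDf; have [lt hN ol _ _] := chord_ends dD.
  case dA: (d \in A); rewrite dA in dd.
    apply/pred0Pn; exists (Ed (lo d)); rewrite /= EM' mem_Mt_Ed ?(negPf ol) //; last exact: ltn_trans hN.
    have -> : (false == inside A' (lo d)) by rewrite (inside_in (d := d)) //; case: (_ \in _) dd.
    rewrite !in_setU andbT; apply/orP; left; apply/orP; right.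
    by apply/imsetP; exists d; rewrite // in_setI dDf.
  apply/pred0Pn; exists d; rewrite /= !in_setU in_setD dDf dA /=.
  by have : d \in A' by [case: (d \in A') dd]; rewrite in_setI => /andP[].
(* From the largest set, single steps within the interval only drop chords and so add even edges,
   while the extra matching ([None]) adds odd ones; this makes the differences disjoint. *)
- exists (Mt Amax) => // S bS.
  pose I := [set Some d | d in Df] :|: (if zP then [set None] else set0).
  pose M2 := odflt set0 [pick M in P | z \in M].
  have M2P : zP -> M2 \in P /\ z \in M2.
    move=> /exists_inP[M PM zM]; rewrite /M2; case: pickP => [M' /andP[]//|/(_ M)].
    by rewrite PM zM.
  have cI : #|Df| + zP = #|I|.
    rewrite /I cardsU card_imset; last by move=> ? ? [].
    rewrite (_ : _ :&: _ = set0) ?cards0 ?subn0; first by case: (zP); rewrite ?cards1 ?cards0.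
    apply/setP => o; rewrite !inE; case: (zP); rewrite ?inE ?andbF //.
    by apply/negP => /andP[/imsetP[d _ ->]].
  rewrite cI; apply: (blocks_card (f := fun o => if o is Some d then Mt (Amax :\ d) else M2) bS).
    move=> o /setUP[/imsetP[d dDf ->]|].
      have /andP[dn dx] : (d \notin Amin) && (d \in Amax) by rewrite -in_setD.
      have /andP[sd Pd] : Q (Amax :\ d).
        apply: Qi; last exact: subsetDl.
        have /andP[sx' _] := between Amax (introT andP (conj sx Px)).
        by rewrite subsetD1 sx' dn.
      split=> //; apply: contraTneq dx => E.
      by rewrite -(Mt_chords sx) -E Mt_chords // !inE eqxx.
    case zE: zP; rewrite inE // => /eqP->; have [M2p zM2] := M2P zE; split=> //.
    by apply: contraTneq zM2 => ->; apply: z_Mt.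
  have zd d : d \in Df -> zP -> [disjoint Mt (Amax :\ d) :\: Mt Amax & M2 :\: Mt Amax].
    move=> dDf zE; have [M2p zM2] := M2P zE; apply/pred0P => e /=; apply/negP => /andP[].
    move/(Mt_diff sx (subsetP sf d dDf)) => [i [iN Ei oi _ _]] /setDP[].
    by rewrite Ei (z_pm i (Pp _ M2p) zM2).2 // (negPf oi).
  have zN : None \in I -> zP.
    by case/setUP => [/imsetP[d _]//|]; case: (zP); rewrite inE.
  have zS d : Some d \in I -> d \in Df.
    by case/setUP => [/imsetP[d' + [->]]//|]; case: (zP); rewrite inE.
  move=> [d|] [d'|] oI oI' dd; last by rewrite eqxx in dd.
  + have dDf := zS d oI; have dDf' := zS d' oI'; apply/pred0P => e /=; apply/negP => /andP[].
    move/(Mt_diff sx (subsetP sf d dDf)) => [i [iN Ei oi i1 i2]].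
    move/(Mt_diff sx (subsetP sf d' dDf')) => [j [jN Ej oj j1 j2]].
    have E : i = j by apply: (Ed_inj (x0 := x0) hc colB) => //; rewrite -Ei -Ej.
    have := @chord_sep d d' (subsetP sf d dDf) (subsetP sf d' dDf').
    have ndd : d != d' by apply: contraNneq dd => ->.
    by move/(_ ndd); move: i1 i2 j1 j2 E; clear; lia.
  + exact: zd (zS d oI) (zN oI').
  + by rewrite disjoint_sym; apply: zd (zS d' oI') (zN oI).
Qed.

End Intervals.

(** * Families of matchings with two binary coordinates *)

Section Squares.
Variable T : finType.
Implicit Types (M S : {set {set T}}) (P : {set {set {set T}}}) (w u v : bool -> {set T}).

(** Each member contains exactly one of [w true] and [w false]. One of them separates, and the one
    missing from M lies in all other members. *)
Lemma line_uniform P w M1 M2 : M1 \in P -> M2 \in P -> M1 != M2 ->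
  (forall M, M \in P -> (w false \in M) = ~~ (w true \in M)) ->
  {in P &, injective (fun M => w true \in M)} -> uniform P.
Proof.
move=> P1 P2 D12 wP injw; exists 1; split.
- exists [set w true]; rewrite ?cards1 // => M M' PM PM' /setP/(_ (w true)).
  by rewrite !inE eqxx /=; apply: injw.
- move=> S sepS; have := leq_trans _ (separates_card sepS).
  move=> /(_ 2); case: (#|S|) => // H; suff: 1 < 1 by []; apply: H.
  by apply/card_gt1P; exists M1, M2.
- move=> M PM; exists [set w (~~ (w true \in M))]; rewrite ?cards1 //; split.
    rewrite disjoints_subset sub1set inE.
    by case E: (w true \in M); rewrite /= ?E // wP // E.
  move=> M' PM' D'; rewrite disjoints_subset sub1set inE negbK.
  have : (w true \in M') != (w true \in M) by apply: contra D' => /eqP/injw->.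
  by case E: (w true \in M) => /=; rewrite ?wP //; case: (_ \in M').
- exists M1 => // S [_ bS]; rewrite card_gt0; apply: contraTneq (bS M2 P2 _) => [->|].
    by rewrite disjoints_subset sub0set.
  by rewrite eq_sym.
Qed.

(** Membership of [u true] and [v true] places P in a square. If some member has both its neighbours
    in P, the value is 2: three members need two separating elements, and the disjoint differences
    at this corner need two blocking ones. Otherwise P has one member or one coordinate is injective
    on it. *)
Lemma square_uniform P u v : P != set0 ->
  (forall M, M \in P -> (u false \in M) = ~~ (u true \in M)) ->
  (forall M, M \in P -> (v false \in M) = ~~ (v true \in M)) ->
  (forall M M', M \in P -> M' \in P -> (u true \in M) = (u true \in M') ->
    (v true \in M) = (v true \in M') -> M = M') ->
  (forall M M1 M2, M \in P -> M1 \in P -> M2 \in P ->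
    (u true \in M1) = ~~ (u true \in M) -> (v true \in M1) = (v true \in M) ->
    (u true \in M2) = (u true \in M) -> (v true \in M2) = ~~ (v true \in M) ->
    [disjoint M1 :\: M & M2 :\: M]) ->
  uniform P.
Proof.
case/set0Pn => M0 PM0 uP vP inj corner.
pose L M M1 M2 := [&& (u true \in M1) == ~~ (u true \in M), (v true \in M1) == (v true \in M),
  (u true \in M2) == (u true \in M) & (v true \in M2) == ~~ (v true \in M)].
case E: [exists M in P, exists M1 in P, exists M2 in P, L M M1 M2]; last first.
  have noL M M1 M2 : M \in P -> M1 \in P -> M2 \in P -> L M M1 M2 -> False.
    move=> PM P1 P2 H; apply: (negP (negbT E)).
    by apply/exists_inP; exists M => //; apply/exists_inP; exists M1 => //; apply/exists_inP; exists M2.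
  case: (pickP [pred M | M \in P & M != M0]) => [M1 /andP[/= PM1 D1]|E1]; last first.
    apply: (uniform1 (M := M0)); apply/setP => M; rewrite [RHS]in_set1.
    apply/idP/eqP => [PM|->] //; apply/eqP; apply: contraFT (E1 M) => D1.
    by rewrite /= PM.
  case: (eqVneq (u true \in M0) (u true \in M1)) => [Eu|Du].
    have Dv : (v true \in M0) != (v true \in M1).
      by apply: contra D1 => /eqP Ev; apply/eqP/esym/inj.
    apply: (line_uniform PM0 PM1 _ vP); first by rewrite eq_sym.
    move=> M M' PM PM' EV; apply: inj => //; apply/eqP; apply: contraT => D2.
    (* If M and M' differed in the first coordinate only, a member W with the other second
       coordinate would complete a corner at M or at M'. *)
    have [W PW DW] : exists2 W, W \in P & (v true \in W) = ~~ (v true \in M).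
      case: (eqVneq (v true \in M0) (~~ (v true \in M))) => [E0|E0]; first by exists M0.
      by exists M1 => //; move: E0 Dv; do !case: (_ \in _).
    case: (eqVneq (u true \in W) (u true \in M)) => EW.
      case: (noL M M' W PM PM' PW); rewrite /L EW DW EV !eqxx andbT /=.
      by move: D2; do !case: (_ \in _).
    case: (noL M' M W PM' PM PW); rewrite /L DW EV !eqxx !andbT /=.
    by move: D2 EW; do !case: (_ \in _).
  apply: (line_uniform PM0 PM1 _ uP); first by rewrite eq_sym.
  move=> M M' PM PM' EU; apply: inj => //; apply/eqP; apply: contraT => D2.
  have [W PW DW] : exists2 W, W \in P & (u true \in W) = ~~ (u true \in M).
    case: (eqVneq (u true \in M0) (~~ (u true \in M))) => [E0|E0]; first by exists M0.
    by exists M1 => //; move: E0 Du; do !case: (_ \in _).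
  case: (eqVneq (v true \in W) (v true \in M)) => EW.
    case: (noL M W M' PM PW PM'); rewrite /L EW DW EU !eqxx /=.
    by move: D2; do !case: (_ \in _).
  case: (noL M' W M PM' PW PM); rewrite /L DW EU !eqxx /=.
  by move: D2 EW; do !case: (_ \in _).
have /exists_inP[M PM /exists_inP[M1 PM1 /exists_inP[M2 PM2 /and4P[/eqP u1 /eqP v1 /eqP u2 /eqP v2]]]] := E.
have D1 : M1 != M by apply: contra_eqN u1 => /eqP->; case: (_ \in _).
have D2 : M2 != M by apply: contra_eqN v2 => /eqP->; case: (_ \in _).
have D12 : M1 != M2 by apply: contra_eqN u1 => /eqP->; rewrite u2; case: (_ \in _).
exists 2; split.
- exists [set u true; v true]; last by rewrite cards2; case: (_ != _).
  move=> Q Q' PQ PQ' /setP EQ; apply: inj => //.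
    by have := EQ (u true); rewrite !inE eqxx.
  by have := EQ (v true); rewrite !inE eqxx orbT.
- move=> S /separates_card cS; have : 2 < #|P|.
    by apply/card_gt2P; exists M, M1, M2; split=> //; split=> //; rewrite eq_sym.
  by move=> /leq_trans/(_ cS); case: (#|S|) => [|[|]].
- move=> Q PQ; exists [set u (~~ (u true \in Q)); v (~~ (v true \in Q))]; last first.
    by rewrite cards2; case: (_ != _).
  split.
    rewrite disjoints_subset subUset !sub1set !inE; apply/andP; split.
      by case Eu: (u true \in Q); rewrite /= ?Eu // uP // Eu.
    by case Ev: (v true \in Q); rewrite /= ?Ev // vP // Ev.
  move=> Q' PQ' DQ; case: (eqVneq (u true \in Q') (u true \in Q)) => [Eu|Du].
    have Dv : (v true \in Q') != (v true \in Q).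
      by apply: contra DQ => /eqP Ev; apply/eqP/inj.
    apply/pred0Pn; exists (v (~~ (v true \in Q))); rewrite /= set22 /=.
    by case Ev: (v true \in Q) Dv => /=; rewrite ?vP //; case: (_ \in Q').
  apply/pred0Pn; exists (u (~~ (u true \in Q))); rewrite /= set21 /=.
  by case Eu: (u true \in Q) Du => /=; rewrite ?uP //; case: (_ \in Q').
- exists M => // S bS; rewrite -card_bool -cardsT.
  apply: (blocks_card (f := fun b : bool => if b then M1 else M2) bS) => [[] _|] //.
  move=> [] [] _ _ //= _; first exact: corner.
  by rewrite disjoint_sym; apply: corner.
Qed.

End Squares.

(** * Two strongly crossed chords *)

Section Crossed.
Variables (T : finType) (G : graph T) (c : seq T) (x0 : T) (B : {set T}).
Hypotheses (hc : hamilton_cycle G c) (colB : proper_coloring B (eset G)).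
Local Notation N := (size c).
Local Notation X i := (nth x0 c i).
Local Notation D := (chords G c).
Local Notation Ed := (Ed c x0).
Implicit Types (M F : {set {set T}}).

Variable k : nat.
Hypotheses (k_even : ~~ odd k) (k_gt0 : 0 < k) (kN : k.+2 < N.-1).
Let e := [set X 0; X k.+1].
Let f := [set X k; X N.-1].
Hypothesis chordsE : D = [set e; f].

Let N2 : 2 < N. Proof. by case/and4P: hc. Qed.
Let eN : ~~ odd N. Proof. exact (hamilton_even x0 hc colB). Qed.

(** The chord ends cut the cycle into two long arcs, with phases [a] and [b], and the single edges
    at [k] and [N.-1], whose phases are then forced. Equal phases of the arcs mean that no chord is
    used; unequal ones decide between [e] and [f]. *)
Definition crossed_phase (a b : bool) i : bool :=
  if i < k then a else if i == k then a || b else if i < N.-1 then b else a && b.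

Lemma crossed_pm M : M \in pms G -> exists a b,
  [/\ (e \in M) = a && ~~ b, (f \in M) = ~~ a && b
    & forall i, i < N -> (Ed i \in M) = (odd i == crossed_phase a b i)].
Proof.
move=> PM; have st := pm_steps x0 hc colB PM; pose b i := (Ed i \in M) == odd i.
have eD : e \in D by rewrite chordsE set21.
have fD : f \in D by rewrite chordsE set22.
have me i : i < N -> (X i \in e) = (i == 0) || (i == k.+1).
  by move=> iN; rewrite !inE !(nth_eq x0 hc) //; move: kN; clear; lia.
have mf i : i < N -> (X i \in f) = (i == k) || (i == N.-1).
  by move=> iN; rewrite !inE !(nth_eq x0 hc) //; move: kN N2; clear; lia.
have flat i : i < N -> (e \in M -> (i != 0) && (i != k.+1)) ->
    (f \in M -> (i != k) && (i != N.-1)) -> b (prv c i) = b i.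
  move=> iN ei fi; have [_ H] := st i iN; apply: H => d; rewrite in_setI chordsE.
  case/andP => dM /set2P[] Ee; rewrite Ee in dM *.
    by rewrite me // negb_or (ei dM).
  by rewrite mf // negb_or (fi dM).
have at_end i d : i < N -> d \in M -> d \in D -> X i \in d -> b i = ~~ odd i /\ b (prv c i) = odd i.
  by move=> iN dM dD id; have [H _] := st i iN; apply: H; exists d; rewrite // in_setI dM.
have [kN1 kN2 kN3] : [/\ k.+1 < N, k < N & N.-1 < N] by split; move: kN; clear; lia.
have lowB i : i < k -> b i = b 0.
  elim: i => [//|i IH] ik; rewrite -flat /= ?IH ?(ltnW ik) //.
  - by move: ik kN2; clear; lia.
  - by move: ik; clear; lia.
  - by move: ik kN; clear; lia.
have highB i : k < i -> i < N.-1 -> b i = b k.+1.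
  elim: i => [//|i IH]; rewrite ltnS leq_eqVlt => /orP[/eqP-> //|ki] iN.
  rewrite -flat /= ?IH ?(ltnW iN) //.
  - by move: iN; clear; lia.
  - by move: ki; clear; lia.
  - by move: ki iN; clear; lia.
have N00 : 0 < N by move: N2; clear; lia.
have bk1 : b k.-1 = b 0 by apply: lowB; move: k_gt0; clear; lia.
have bN2 : b N.-1.-1 = b k.+1 by apply: highB; move: kN; clear; lia.
have pk : prv c k = k.-1 by case: (k) k_gt0.
have pN : prv c N.-1 = N.-1.-1 by case: (N.-1) kN.
have oN : odd N.-1 by move: eN N2; clear; lia.
(* The constraints of [e], and in [pF] those of [f], involve only four phases, so a finite case
   distinction remains. *)
have pE : if e \in M then [&& b 0, ~~ b N.-1, ~~ b k.+1 & b k]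
    else (b N.-1 == b 0) && (b k == b k.+1).
  case eM: (e \in M).
    have [E1 E2] := at_end 0 e N00 eM eD (set21 _ _).
    have [E3 E4] := at_end k.+1 e kN1 eM eD (set22 _ _).
    by rewrite E1 E3 [b N.-1]E2 [b k]E4 /= k_even.
  have F0 : b (prv c 0) = b 0.
    by apply: flat; rewrite ?eM // => _; move: k_gt0 N2; clear; lia.
  have Fk : b (prv c k.+1) = b k.+1.
    by apply: flat; rewrite ?eM // => _; move: kN; clear; lia.
  by apply/andP; split; apply/eqP.
have pF : if f \in M then [&& b k, ~~ b 0, ~~ b N.-1 & b k.+1]
    else (b 0 == b k) && (b k.+1 == b N.-1).
  case fM: (f \in M).
    have [E1 E2] := at_end k f kN2 fM fD (set21 _ _).
    have [E3 E4] := at_end N.-1 f kN3 fM fD (set22 _ _).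
    by rewrite E1 E3 -bk1 -pk E2 -bN2 -pN E4 k_even oN.
  have Fk : b (prv c k) = b k.
    by apply: flat; rewrite ?fM // => _; move: k_gt0; clear; lia.
  have FN : b (prv c N.-1) = b N.-1.
    by apply: flat; rewrite ?fM // => _; move: kN; clear; lia.
  by rewrite -bk1 -pk Fk -bN2 -pN FN !eqxx.
have [a1 a2 a3 a4] : [/\ (e \in M) = b 0 && ~~ b k.+1, (f \in M) = ~~ b 0 && b k.+1,
    b k = b 0 || b k.+1 & b N.-1 = b 0 && b k.+1].
  by move: pE pF; do 2 case: (_ \in M); case: (b 0); case: (b k.+1); case: (b k); case: (b N.-1).
exists (b 0), (b k.+1); split=> // i iN.
suff -> : crossed_phase (b 0) (b k.+1) i = b i by rewrite /b; case: (_ \in M); case: odd.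
rewrite /crossed_phase; case: ltnP => [/lowB //|ki]; case: (i =P k) => [-> //|ik].
case: ltnP => [iN1|Ni]; first by rewrite highB //; move: ki ik; clear; lia.
by rewrite -a4; congr b; move: iN Ni; clear; lia.
Qed.

Lemma crossed_uniform F : pms_in G F != set0 -> uniform (pms_in G F).
Proof.
move=> P0; have Pp M : M \in pms_in G F -> M \in pms G by rewrite inE => /andP[].
have [k1 [k2 k3]] : [/\ 1 < k, k.+1 < N & k.+2 < N].
  by split; move: k_gt0 k_even kN; clear; lia.
have kp : k < N.-1 by move: kN; clear; lia.
have N0 : 1 < N /\ 0 < N by move: N2; clear; lia.
have uE M a b : (forall i, i < N -> (Ed i \in M) = (odd i == crossed_phase a b i)) ->
    [/\ (Ed 1 \in M) = a, (Ed 0 \in M) = ~~ a, (Ed k.+1 \in M) = b & (Ed k.+2 \in M) = ~~ b].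
  have ph i : k < i -> i < N.-1 -> crossed_phase a b i = b.
    by move=> ki iN; rewrite /crossed_phase ltnNge (ltnW ki) /= gtn_eqF // iN.
  move=> E; split.
  - by rewrite E ?N0.1 // /crossed_phase k1; case: (a).
  - by rewrite E ?N0.2 // /crossed_phase k_gt0; case: (a).
  - rewrite E // ph //=; last by move: kN; clear; lia.
    by rewrite k_even; case: (b).
  - by rewrite E // ph //= negbK (negPf k_even); case: (b).
(* Each coordinate is read on an even and an odd edge inside one of the long arcs; there is room
   because [k] is even and positive and [k.+2 < N.-1]. *)
apply: (@square_uniform _ _ (fun x => if x then Ed 1 else Ed 0)
  (fun x => if x then Ed k.+1 else Ed k.+2)) => //.
- by move=> M /Pp/crossed_pm[a [b [_ _ /uE[-> -> _ _]]]].
- by move=> M /Pp/crossed_pm[a [b [_ _ /uE[_ _ -> ->]]]].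
- move=> M M' /Pp PM /Pp PM'; have [a [b [eM fM iM]]] := crossed_pm PM.
  have [a' [b' [eM' fM' iM']]] := crossed_pm PM'.
  have [-> _ -> _] := uE _ _ _ iM; have [-> _ -> _] := uE _ _ _ iM' => Ea Eb; subst a' b'.
  apply: (pm_ext (x0 := x0) hc PM PM') => [|i iN]; last by rewrite iM // iM'.
  apply/setP => d; rewrite !in_setI chordsE; case: (boolP (d \in [set e; f])); rewrite ?andbF //.
  by case/set2P => ->; rewrite ?eM ?eM' ?fM ?fM'.
- move=> M M1 M2 /Pp PM /Pp PM1 /Pp PM2.
  have [a [b [eM fM iM]]] := crossed_pm PM; have [a1 [b1 [eM1 fM1 iM1]]] := crossed_pm PM1.
  have [a2 [b2 [eM2 fM2 iM2]]] := crossed_pm PM2.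
  have [-> _ -> _] := uE _ _ _ iM; have [-> _ -> _] := uE _ _ _ iM1.
  have [-> _ -> _] := uE _ _ _ iM2 => E1 E2 E3 E4; subst a1 b1 a2 b2.
  apply/pred0P => d /=; apply/negP => /andP[/setDP[d1 dM] /setDP[d2 _]].
  have dG : d \in eset G by move: PM1; rewrite inE => /andP[/subsetP/(_ d d1)].
  (* M1 keeps the phase of M on the second long arc, M2 on the first; on the chords and the single
     edges the values of [a] and [b] exclude a common new edge. *)
  case: (edge_cases x0 hc dG) => [|[i iN Ei]].
    rewrite chordsE => /set2P[] Ed'; move: d1 d2 dM; rewrite Ed' ?eM ?eM1 ?eM2 ?fM ?fM1 ?fM2;
      by case: a {iM iM1 iM2 eM eM1 eM2 fM fM1 fM2}; case: b.
  move: d1 d2 dM; rewrite Ei iM // iM1 // iM2 // /crossed_phase.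
  case: ltnP => _; first by move=> _ ->.
  case: (i =P k) => [-> | _]; first by rewrite (negPf k_even); case: (a); case: (b).
  case: ltnP => [_ -> //|Ni].
  have -> : i = N.-1 by move: iN Ni; clear; lia.
  have -> : odd N.-1 by move: eN N2; clear; lia.
  by case: (a); case: (b).
Qed.

End Crossed.

(** * Cyclic orders and the choice of a starting point *)

Section CyclicOrder.
Variable T : finType.
Implicit Types (c s t : seq T) (e f : {set T}) (x y : T).

Lemma rot_rot_exists m i c : exists j, rot j (rot m c) = rot i c.
Proof.
have small k : exists2 k', k' <= size c & rot k' c = rot k c.
  case: (leqP k (size c)) => [kc|/ltnW kc]; first by exists k.
  by exists 0; rewrite // rot0 rot_oversize.
have [m' mc <-] := small m; have [i' ic <-] := small i.
exists (if i' + (size c - m') <= size c then i' + (size c - m') else i' + (size c - m') - size c).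
by rewrite -[in RHS](rotK m' c) /rotr size_rot [RHS]rot_add_mod size_rot ?leq_subr.
Qed.

Lemma cyclic_order_rot m c s : cyclic_order c s -> cyclic_order (rot m c) s.
Proof.
move=> [i [sc|sc]].
  by have [j E] := rot_rot_exists m i c; exists j; left; rewrite E.
have [j E] := rot_rot_exists (size (rev c) - m) i (rev c).
by exists j; right; rewrite rev_rot -E in sc *.
Qed.

Lemma cyclic_order_rev c s : cyclic_order c s -> cyclic_order (rev c) s.
Proof. by move=> [i sc]; exists i; rewrite revK; case: sc; [right | left]. Qed.

(** Reading the cycle from [x], in the direction in which the list occurs, keeps its edges and all
    cyclic orders, so chords and their relations carry over. *)
Lemma cyclic_order_normal (G : graph T) c x s : hamilton_cycle G c ->
  cyclic_order c (x :: s) -> exists c',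
  [/\ hamilton_cycle G c', cycle_edges c' = cycle_edges c,
      forall t, cyclic_order c t -> cyclic_order c' t, subseq (x :: s) c' & nth x c' 0 = x].
Proof.
move=> hc [i sc].
have [c1 [h1 E1 o1 s1]] : exists c1, [/\ hamilton_cycle G c1, cycle_edges c1 = cycle_edges c,
    forall t, cyclic_order c t -> cyclic_order c1 t & subseq (x :: s) c1].
  have uc : uniq c by case/and4P: hc.
  case: sc => sc; [exists (rot i c) | exists (rot i (rev c))]; split=> //.
  - by rewrite hamilton_rot.
  - exact: cycle_edges_rot.
  - by move=> t; apply: cyclic_order_rot.
  - by rewrite hamilton_rot hamilton_rev.
  - by rewrite cycle_edges_rot ?rev_uniq // cycle_edges_rev.
  - by move=> t /cyclic_order_rev; apply: cyclic_order_rot.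
have xc1 : x \in c1 by apply: (mem_subseq s1); rewrite mem_head.
have u1 : uniq c1 by case/and4P: h1.
case/splitPr: xc1 h1 E1 o1 s1 u1 => p1 p2 h1 E1 o1 s1 u1.
exists (x :: p2 ++ p1); have R : rot (size p1) (p1 ++ x :: p2) = x :: p2 ++ p1.
  by rewrite rot_size_cat.
rewrite -R; split=> //.
- by rewrite hamilton_rot.
- by rewrite cycle_edges_rot.
- by move=> t /o1; apply: cyclic_order_rot.
- rewrite R -cat_cons; apply: (subseq_trans _ (prefix_subseq _ _)).
  have xp : x \notin p1.
    by move: u1; rewrite cat_uniq => /and3P[_ /hasPn/(_ x (mem_head _ _))].
  elim: p1 xp s1 {h1 E1 o1 u1 R} => [//|y p1 IH]; rewrite inE negb_or => /andP[xy xp].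
  by rewrite /= eqxx (negPf xy) => /(IH xp); rewrite /= eqxx.
- by rewrite R.
Qed.

Lemma subseq_index c s : uniq c -> subseq s c -> sorted ltn [seq index x c | x <- s].
Proof.
move=> uc sc; apply: (subseq_sorted ltn_trans (map_subseq (index^~ c) sc)).
rewrite (_ : [seq _ | _ <- c] = iota 0 (size c)) ?iota_ltn_sorted //.
case: c uc {sc} => // x0 c uc; apply: (@eq_from_nth _ 0); rewrite ?size_map ?size_iota // => i ic.
by rewrite (nth_map x0) // nth_iota // index_uniq.
Qed.

Lemma cyclic_order_cyc4 c x y x' y' : uniq c -> cyclic_order c [:: x; y; x'; y'] ->
  cyc4 (index x c) (index y c) (index x' c) (index y' c) ||
  cyc4 (index y' c) (index x' c) (index y c) (index x c).
Proof.
move=> uc [i sc].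
have back d : subseq [:: x; y; x'; y'] (rot i d) -> exists k, subseq (rot k [:: x; y; x'; y']) d.
  move=> /(subseq_rot (size d - i))[k _]; rewrite -{1}(size_rot i d) -/(rotr i _) rotK => sk.
  by exists k.
have small d : subseq [:: x; y; x'; y'] (rot i d) ->
    exists2 k, k < 4 & subseq (rot k [:: x; y; x'; y']) d.
  move=> /back[k sk]; case: (ltnP k 4) => k4; first by exists k.
  by exists 0; rewrite // rot0; rewrite rot_oversize in sk.
case: sc => /small[k k4 sk].
  have := subseq_index uc sk; case: k k4 {sk} => [|[|[|[|k]]]] //= _ /and4P[i1 i2 i3 _];
  by rewrite /cyc4 i1 i2 i3 ?orbT.
move: sk; rewrite -[rot k _]revK subseq_rev => /(subseq_index uc).
case: k k4 => [|[|[|[|k]]]] //= _ /and4P[i1 i2 i3 _]; by rewrite /cyc4 i1 i2 i3 ?orbT.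
Qed.

End CyclicOrder.

(** * Normal forms for the classes B2 and B3 *)

Section Normal.
Variables (T : finType) (G : graph T) (B : {set T}).
Hypothesis colB : proper_coloring B (eset G).
Implicit Types (c : seq T) (e f : {set T}).

(** The labels come from some proper colouring of the cycle, which is parity up to exchange. So
    either both even ends or both odd ends come first, and either labelling gives [par_pos]. *)
Lemma parallel_pos c x0 i j k l : hamilton_cycle G c ->
  i < size c -> j < size c -> k < size c -> l < size c ->
  ~~ odd i -> odd j -> ~~ odd k -> odd l ->
  parallel c [set nth x0 c i; nth x0 c j] [set nth x0 c k; nth x0 c l] -> par_pos i j k l.
Proof.
move=> hc iN jN kN lN oi oj ok ol [x1 [x2 [y1 [y2 [[E1 E2 _ [F colF [_ _ cc]]] o]]]]].
have uc : uniq c by case/and4P: hc.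
have := cyclic_order_cyc4 uc o; move: cc.
have col i' : i' < size c -> (nth x0 c i' \in F) = (nth x0 c 0 \in F) (+) odd i'.
  by move=> iN'; apply: (@hamilton_color _ G _ _ hc).
case/esym/eq_set2: E1 => -[-> ->]; case/esym/eq_set2: E2 => -[-> ->];
  rewrite (col _ iN) || rewrite (col _ jN); rewrite (col _ kN) || rewrite (col _ lN);
  rewrite ?(negPf oi) ?(negPf ok) ?oj ?ol ?addbF ?addbT;
  try (by case: (_ \in F)); move=> _; rewrite !index_uniq // /par_pos.
  by rewrite (cyc4_rot i l k j).
by rewrite (cyc4_rot j i l k) (cyc4_rot k l i j) (cyc4_rot l i j k) orbC.
Qed.

Lemma parallel_normal c c' e f : cycle_edges c' = cycle_edges c ->
  (forall t, cyclic_order c t -> cyclic_order c' t) -> parallel c e f -> parallel c' e f.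
Proof.
move=> E o [x1 [x2 [y1 [y2 [[E1 E2 d col] /o o']]]]]; exists x1, x2, y1, y2.
by split=> //; split=> //; rewrite E.
Qed.

(* The chords become disjoint intervals once the cycle is read from an end of a
   suitable chord: two parallel chords fix the direction of all the others. *)
Lemma par_pos_interval a b d p q : 0 < a -> a < b -> b < d -> ~~ odd p -> odd q ->
  par_pos 0 a p q -> par_pos b d p q -> p < q.
Proof.
move=> a0 ab bd op oq; rewrite /par_pos /cyc4 => p1 p2; move: p1 p2 op oq.
by case/orP => /or4P[] /and3P[? ? ?]; case/orP => /or4P[] /and3P[? ? ?]; lia.
Qed.

Lemma par_pos_disjoint p q p' q' : p < q -> p' < q' -> par_pos p q p' q' ->
  (q < p') || (q' < p).
Proof. by move=> pq pq'; case/orP => /or4P[] /and3P[*]; lia. Qed.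

Lemma chord_eq_pos c x0 i j k l : hamilton_cycle G c ->
  i < size c -> j < size c -> k < size c -> l < size c ->
  ~~ odd i -> odd j -> ~~ odd k -> odd l ->
  [set nth x0 c i; nth x0 c j] = [set nth x0 c k; nth x0 c l] -> i = k /\ j = l.
Proof.
move=> hc iN jN kN lN oi oj ok ol /eq_set2[][/eqP+ /eqP+]; rewrite !(nth_eq x0 hc) //.
  by move=> /eqP-> /eqP->.
by rewrite (negPf (neq_parity ol oi).2).
Qed.

Lemma parallel_intervals c : hamilton_cycle G c ->
  (forall e f, e \in chords G c -> f \in chords G c -> e != f -> parallel c e f) ->
  exists c' x0 lo hi, [/\ hamilton_cycle G c',
    forall d, d \in chords G c' -> [/\ lo d < hi d, hi d < size c', ~~ odd (lo d), odd (hi d)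
      & d = [set nth x0 c' (lo d); nth x0 c' (hi d)]]
    & forall d d', d \in chords G c' -> d' \in chords G c' -> d != d' ->
      (hi d < lo d') || (hi d' < lo d)].
Proof.
move=> hc parc; have [x0 _] : exists x0 : T, True by case: (c) hc => // x l; exists x.
(* It suffices that each chord begins at its even end: parallel chords that all run forward are
   disjoint intervals. *)
suff [c' [hc' parc' lt']] : exists c', [/\ hamilton_cycle G c',
    forall e f, e \in chords G c' -> f \in chords G c' -> e != f -> parallel c' e f
  & forall p q, p < size c' -> q < size c' -> ~~ odd p -> odd q ->
      [set nth x0 c' p; nth x0 c' q] \in chords G c' -> p < q].
  have ex (d : {set T}) : exists pq : nat * nat, d \in chords G c' ->
      [/\ pq.1 < pq.2, pq.2 < size c', ~~ odd pq.1, odd pq.2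
        & d = [set nth x0 c' pq.1; nth x0 c' pq.2]].
    case dD: (d \in chords G c'); last by exists (0, 0).
    have [p [q [[[pN qN] op oq pqD] E]]] := chord_positions x0 hc' colB dD.
    by exists (p, q) => _; split=> //; apply: lt'.
  have [F FP] := fin_all_exists ex.
  exists c', x0, (fun d => (F d).1), (fun d => (F d).2); split=> // d d' dD d'D dd'.
  have [lt1 h1 o1 o2 E1] := FP d dD; have [lt2 h2 o3 o4 E2] := FP d' d'D.
  apply: par_pos_disjoint => //; apply: (parallel_pos (x0 := x0) hc'); rewrite ?(ltn_trans lt1) ?(ltn_trans lt2) //.
  by rewrite -E1 -E2; apply: parc'.
(* Given two chords, the cycle is read from [x1]; they then have the positions 0, a and b, d of
   [par_pos_interval]. *)
case: (pickP [pred ef : {set T} * {set T} |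
    [&& ef.1 \in chords G c, ef.2 \in chords G c & ef.1 != ef.2]]) => [[e f] /and3P[/= eD fD ef]|none].
  have [x1 [x2 [y1 [y2 [[Ee Ef _ [F colF [c1 c2 c3]]] o]]]]] := parc e f eD fD ef.
  have [c' [hc' E o' sub x1E]] := cyclic_order_normal hc o.
  have ED : chords G c' = chords G c by rewrite /chords E.
  have parc' e1 f1 : e1 \in chords G c' -> f1 \in chords G c' -> e1 != f1 -> parallel c' e1 f1.
    by rewrite ED => e1D f1D ef1; apply: parallel_normal E o' _; apply: parc.
  exists c'; split=> // p q pN qN op oq pqD.
  have uc' : uniq c' by case/and4P: hc'.
  have sz : 0 < size c' by case/and4P: hc' => /ltnW/ltnW.
  have xE x : x \in [:: x1; x2; y1; y2] -> x = nth x0 c' (index x c') /\ index x c' < size c'.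
    by move=> /(mem_subseq sub) xc; rewrite nth_index // index_mem.
  have [X1 _] := xE x1 (mem_head _ _).
  have i1 : index x1 c' = 0.
    by rewrite -[x1 in LHS]x1E (set_nth_default x0) // index_uniq.
  have [|X2 N2] := xE x2; first by rewrite !inE eqxx ?orbT.
  have [|Y1 N3] := xE y1; first by rewrite !inE eqxx ?orbT.
  have [|Y2 N4] := xE y2; first by rewrite !inE eqxx ?orbT.
  have := subseq_index uc' sub; rewrite /= i1 => /and4P[l1 l2 l3 _].
  have col i : i < size c' -> (nth x0 c' i \in F) = (x1 \in F) (+) odd i.
    by move=> iN; rewrite X1 i1; apply: (@hamilton_color _ G _ _ hc') => //; rewrite E.
  rewrite Y1 (col _ N3) in c3; rewrite X2 (col _ N2) in c1.
  rewrite Y1 Y2 (col _ N3) (col _ N4) in c2.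
  have [p1 [p2 p3]] : ~~ odd (index y1 c') /\ odd (index x2 c') /\ odd (index y2 c').
    by move: c1 c2 c3; case: (x1 \in F); case: odd; case: odd; case: odd.
  rewrite X1 X2 i1 in Ee; rewrite Y1 Y2 in Ef; rewrite -ED in eD fD.
  case: (eqVneq e [set nth x0 c' p; nth x0 c' q]) => [Epq|De].
    have [<- <- //] : 0 = p /\ index x2 c' = q.
    by apply: (chord_eq_pos (x0 := x0) hc'); rewrite // -Ee.
  case: (eqVneq f [set nth x0 c' p; nth x0 c' q]) => [Epq|Df].
    have [<- <- //] : index y1 c' = p /\ index y2 c' = q.
    by apply: (chord_eq_pos (x0 := x0) hc'); rewrite // -Ef.
  apply: (par_pos_interval l1 l2 l3 op oq).
    by apply: (parallel_pos (x0 := x0) hc'); rewrite // -Ee; apply: parc'.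
  by apply: (parallel_pos (x0 := x0) hc'); rewrite // -Ef; apply: parc'.
(* There is at most one chord; if there is one, the cycle is read from its even end. *)
have same e f : e \in chords G c -> f \in chords G c -> e = f.
  move=> eD fD; apply/eqP; apply: contraFT (none (e, f)) => ef.
  by rewrite /= eD fD.
case: (set_0Vmem (chords G c)) => [D0|[e eD]].
  by exists c; split=> // p q _ _ _ _; rewrite D0 inE.
have [i [j [[[iN jN] oi oj _] Ee]]] := chord_positions x0 hc colB eD.
have uc : uniq c by case/and4P: hc.
have ED : chords G (rot i c) = chords G c by rewrite /chords cycle_edges_rot.
have hc' : hamilton_cycle G (rot i c) by rewrite hamilton_rot.
exists (rot i c); split=> //; first by rewrite ED => e1 f1 e1D f1D /eqP[]; apply: same.
move=> p q pN qN op oq; rewrite ED => /(same _ _ eD) E.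
have r0 : nth x0 (rot i c) 0 = nth x0 c i.
  by have := nth_rot_shift x0 iN iN; rewrite /shift leqnn subnn.
have : nth x0 (rot i c) 0 \in e by rewrite Ee r0 set21.
have sz : 0 < size (rot i c) by case/and4P: hc' => /ltnW/ltnW.
rewrite E !inE !(nth_eq x0 hc') // => /orP[]/eqP E0; last by rewrite -E0 in oq.
by rewrite -E0; case: (q) oq.
Qed.

Lemma B2_uniform F : B2 G -> pms_in G F != set0 -> uniform (pms_in G F).
Proof.
move=> [c hc [ev [e [f [ef chE [x1 [x2 [y1 [y2 [[Ee Ef _ [K colK [c1 c2 c3]]] o m1 m2]]]]]]]]]].
have [c' [hc' E o' sub x1E]] := cyclic_order_normal hc o.
have ED : chords G c' = [set e; f] by rewrite -chE /chords E.
have uc' : uniq c' by case/and4P: hc'.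
have sz : 0 < size c' by case/and4P: hc' => /ltnW/ltnW.
pose x0 := x1.
have xE x : x \in [:: x1; y1; x2; y2] -> x = nth x0 c' (index x c') /\ index x c' < size c'.
  by move=> /(mem_subseq sub) xc; rewrite nth_index // index_mem.
have [X1 _] := xE x1 (mem_head _ _).
have i1 : index x1 c' = 0 by rewrite -[x1 in LHS]x1E index_uniq.
have [|X2 N2] := xE x2; first by rewrite !inE eqxx ?orbT.
have [|Y1 N3] := xE y1; first by rewrite !inE eqxx ?orbT.
have [|Y2 N4] := xE y2; first by rewrite !inE eqxx ?orbT.
have := subseq_index uc' sub; rewrite /= i1 => /and4P[l1 l2 l3 _].
have col i : i < size c' -> (nth x0 c' i \in K) = (x1 \in K) (+) odd i.
  by move=> iN; rewrite X1 i1; apply: (@hamilton_color _ G _ _ hc') => //; rewrite E.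
rewrite Y1 (col _ N3) in c3; rewrite X2 (col _ N2) in c1.
rewrite Y1 Y2 (col _ N3) (col _ N4) in c2.
have [p1 [p2 p3]] : ~~ odd (index y1 c') /\ odd (index x2 c') /\ odd (index y2 c').
  by move: c1 c2 c3; case: (x1 \in K); case: odd; case: odd; case: odd.
have edge a b : a < size c' -> b < size c' -> [set nth x0 c' a; nth x0 c' b] \in cycle_edges c ->
    exists2 i, i < size c' & ((i == a) || (i == prv c' a)) && ((i == b) || (i == prv c' b)).
  move=> aN bN; rewrite -E => /(cycle_edgesP x0 _ uc')[i iN Ei]; exists i => //.
  by rewrite -!(mem_Ed x0 hc' colB) // /Ed -Ei set21 set22.
have eN := hamilton_even x0 hc' colB.
(* [x1] is at position 0 and y1, x2, y2 follow in this order, so [y2], a neighbour of [x1], must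
   come last; similarly [x2] comes right after [y1]. *)
have k2 : index y2 c' = (size c').-1.
  rewrite X1 Y2 i1 in m1; have [i iN] := edge _ _ sz N4 m1.
  by move: l1 l2 l3 N4; case: (index y2 c') => [|k] /=; clear; lia.
have k1 : index x2 c' = (index y1 c').+1.
  rewrite X2 Y1 in m2; have [i iN] := edge _ _ N2 N3 m2.
  by move: l1 l2 l3 N4 N2; case: (index y1 c') => [|k]; case: (index x2 c') => [|k'] /=; clear; lia.
apply: (@crossed_uniform _ G c' x0 B hc' colB (index y1 c')) => //.
  by move: l2 l3 p3 p1; rewrite k1 k2; clear; lia.
by rewrite ED Ee Ef {1}X1 {1}X2 {1}Y1 {1}Y2 i1 k1 k2.
Qed.

Lemma B3_uniform F : B3 G -> pms_in G F != set0 -> uniform (pms_in G F).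
Proof.
move=> [_ [c hc parc]].
have [c' [x0 [lo [hi [hc' ends sep]]]]] := parallel_intervals hc parc.
exact: (intervals_uniform hc' colB ends sep).
Qed.

End Normal.

Lemma classes_strongly_uniform (T : finType) (G : graph T) :
  matching_covered G -> bipartite G -> [\/ B0 G, B1 G, B2 G | B3 G] -> strongly_uniform G.
Proof.
move=> [_ mcG] bG cl; have [B colB] := bG.
(* B0 and B1 fall under B3, having no two distinct chords. *)
have {cl} cl : B2 G \/ B3 G.
  case: cl => [[c hc [_ D0]]|[_ [c hc D1]]|h|h]; [right|right|by left|by right]; split=> //;
    exists c => // e f; first by rewrite D0 inE.
  by have /eqP/cards1P[g ->] := D1; rewrite !inE => /eqP-> /eqP->; rewrite eqxx.
have [c hc] : exists c, hamilton_cycle G c by case: cl => [[c hc _]|[_ [c hc _]]]; exists c.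
split.
  case: (c) hc => // x s hc; have N0 : 0 < size (x :: s) by [].
  by have [M PM _] := mcG _ (Ed_edge x hc N0); exists M.
move=> H cH mH; apply: (conformal_uniform cH mH) => F.
by case: cl => [/(B2_uniform colB)|/(B3_uniform colB)]; apply.
Qed.

Theorem theorem3p1 (T : finType) (G : graph T)
    (G_matching_covered : matching_covered G) (G_bipartite : bipartite G)
    (G_order : 4 <= #|vset G|) :
  (strongly_uniform G <->
     [/\ ~ conformal_minor A1 G, ~ conformal_minor A2 G,
         ~ conformal_minor A3 G & ~ conformal_minor A4 G]) /\
  ([/\ ~ conformal_minor A1 G, ~ conformal_minor A2 G,
       ~ conformal_minor A3 G & ~ conformal_minor A4 G] <->
     [\/ B0 G, B1 G, B2 G | B3 G]).
Proof.
have cl := no_minors_classes G_matching_covered G_bipartite G_order.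
have su := classes_strongly_uniform G_matching_covered G_bipartite.
split; split; first exact: strongly_uniform_no_minors.
- by move=> /cl/su.
- exact: cl.
- by move=> /su; apply: strongly_uniform_no_minors.
Qed.
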